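(* Let $(\Pi,\mathcal{I})$ be an Erlangen plane. The following conditions are equivalent: 1. $(\Pi,\mathcal{I})$ is a Euclidean plane. 2. The defect of every triangle in $(\Pi,\mathcal{I})$ is $0$. 3. For any translation $\tau$ one has $\tau=\tau_{CD}$ whenever $D=\tau(C)$. 4. The defect of some non-flat triangle in $(\Pi,\mathcal{I})$ is $0$. 5. Every two translations commute. 6. Translations form an Abelian subgroup of $\mathcal{I}$. 7. Translations form a subgroup of $\mathcal{I}$.
   Context: A betweenness relation on a set $\Pi$ is a ternary relation ''$C$ is between $A$ and $B$'' such that, writing $s[A,B]$ for the set of all points between $A$ and $B$: (a) each point is between itself and any point of $\Pi$; (b) if $A$ is between $B$ and $C$, then $A$ is between $C$ and $B$; (c) if $C\in s[A,B]$, then $s[A,B]=s[A,C]\cup s[C,B]$ and $s[A,C]\cap s[C,B]=s[C,C]=\{C\}$. A closed line segment is a set of the form $s[A,B]$; its interior is $s(A,B)=s[A,B]\setminus\{A,B\}$. A subset $S$ is convex if $s[A,B]\subset S$ for all $A,B\in S$. A closed line segment is connected if, whenever it is expressed as a union of two disjoint non-empty convex subsets, precisely one of them is a closed line segment. An isomorphism is a bijection with $f(s[A,B])=s[f(A),f(B)]$ for all $A,B$. A line is a set $l$ with betweenness, consisting of at least two points, such that for every $A\in l$ the complement $l\setminus\{A\}$ is the union of two disjoint non-empty convex sets $c_1,c_2$ with $A\in s[B,C]$ whenever $B\in c_1$, $C\in c_2$. A line in $\Pi$ is a convex subset that is a line with the inherited betweenness. A ray emanating from $A$ is a convex set $r$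 such that: $A\in r$ but $A$ is not between any two other points of $r$; every three points of $r$ are contained in a closed line segment which is a subset of $r$; $r$ is not equal to any closed line segment. It is maximal if it is not a proper subset of another ray emanating from $A$. A space with maximal rays is a set with betweenness such that (1) if $s[A,B]$ and $s[A,C]$ have a common interior point, then one of them is contained in the other; (2) if $A\neq B$ and $s[A,B]$ is connected, then there is a connected $s[C,D]$ with $s[A,B]\subset s(C,D)$. When all segments are connected and $A\ne B$, $\mathrm{ray}[A,B]$ is the maximal ray emanating from $A$ and containing $B$, and $l(A,B)$ is the largest line in $\Pi$ containing $s[A,B]$ (a maximal line). A plane is a space $\Pi$ with maximal rays such that: $\Pi$ contains at least two points; for each pair of different points $A,B$ the segment $s[A,B]$ is connected and $\Pi\setminus l(A,B)$ is the union of two disjoint non-empty convex sets $h_1,h_2$ (half-planes with boundary $l(A,B)$) such that $s[C,D]$ intersects $l(A,B)$ at exactly one point whenever $C\in h_1$, $D\in h_2$. An Erlangen plane is a pair $(\Pi,\mathcal{I})$ of a plane $\Pi$ and a subgroup $\mathcal{I}$ of the group of isomorphisms of $\Pi$ such that for every two pairs $(h_1,r_1)$, $(h_2,r_2)$ consisting of a half-plane and a maximal ray in its boundary there is exactly one element of $\mathcal{I}$ sending $h_1$ onto $h_2$ and $r_1$ onto $r_2$. Two lines $l(A,B)$, $l(C,D)$ are parallel if they are equal or disjoint. A Euclidean plane is an Erlangen plane such that for every line $l(A,B)$ and every point $C$ there is a unique maximal line containing $C$ and parallel to $l(A,B)$. Translations: $\tau_{AB}$ is the identity if $A=B$; otherwise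 it is the element of $\mathcal{I}$ sending $\mathrm{ray}[A,B]$ to the maximal ray emanating from $B$ contained in $\mathrm{ray}[A,B]$ and preserving both half-planes of $l(A,B)$. A translation is a map of the form $\tau_{AB}$. Angles: for $A\in\Pi$ let $\partial(\Pi,A)$ be the set of maximal rays emanating from $A$. Two such rays $r_1,r_2$ are antipodal ($r_2=a(r_1)$) if $A\in s(B,C)$ for some $B\in r_1,C\in r_2$. Betweenness on $\partial(\Pi,A)$: if $r_1,r_2$ are antipodal or equal, $s[r_1,r_2]=\{r_1,r_2\}$; otherwise $r_3\in s[r_1,r_2]$ iff $r_3$ intersects $s[B,C]$ for every $B\in r_1$, $C\in r_2$. The elements of $\mathcal{I}$ fixing $A$ act on $\partial(\Pi,A)$; segments of $\partial(\Pi,A)$ are congruent if one is carried onto the other by such an element. The measure (in degrees) of segments (angles) of $\partial(\Pi,A)$ is the non-negative real-valued function that is equal on congruent segments, additive (the measure of $s[r_1,r_2]$ is the sum of those of $s[r_1,r_3]$ and $s[r_3,r_2]$ for $r_3\in s[r_1,r_2]$), equals $180$ for $s[r,a(r)]$, and equals $90$ for right angles, i.e. for $s[r,r']$ where the element of $\mathcal{I}$ fixing $r$ and swapping the half-planes with boundary $r\cup a(r)$ sends $r'$ to $a(r')$. A triangle $\Delta(ABC)$ is given by three different points; its angle at $A$ is that between $\mathrm{ray}[A,B]$ and $\mathrm{ray}[A,C]$. It is non-flat if $A,B,C$ are non-collinear. The defect of a triangle formed by three non-collinear points is $180$ degrees minus the sum of its angles. *)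

(* Defs.v *)
From mathcomp Require Import all_boot all_order all_algebra.
From mathcomp Require Import all_classical reals.

Set Implicit Arguments.
Unset Strict Implicit.
Unset Printing Implicit Defensive.

Import Order.TTheory GRing.Theory Num.Theory.
Local Open Scope classical_set_scope.
Local Open Scope ring_scope.

(* A ternary relation "C is between A and B" on T is represented by the
   function [s : T -> T -> set T], where [s A B] is the set of all points
   between A and B. *)

Section Betweenness.
Variables (T : Type) (s : T -> T -> set T).
Implicit Types (A B C D : T) (c l r h S : set T) (f : T -> T).

Definition is_betweenness : Prop :=
  [/\ forall A B, s A B A,
      forall A B C, s B C A -> s C B A
    & forall A B C, s A B C ->
        [/\ s A B = s A C `|` s C B,
            s A C `&` s C B = s C C
          & s C C = [set C]]].

Definition closed_segment S : Prop := exists A B, S = s A B.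

Definition seg_interior A B : set T := s A B `\` [set A; B].

Definition convex c : Prop := forall A B, c A -> c B -> s A B `<=` c.

Definition connected_segment S : Prop :=
  closed_segment S /\
  forall c1 c2, S = c1 `|` c2 -> c1 `&` c2 = set0 ->
    c1 !=set0 -> c2 !=set0 -> convex c1 -> convex c2 ->
    (closed_segment c1 /\ ~ closed_segment c2) \/
    (~ closed_segment c1 /\ closed_segment c2).

Definition isomorphism f : Prop :=
  bijective f /\ forall A B, f @` s A B = s (f A) (f B).

(* [ray_from A r] : r is a ray emanating from A *)
Definition ray_from A r : Prop :=
  [/\ convex r,
      r A /\ (forall B C, r B -> r C -> B <> A -> C <> A -> ~ s B C A),
      forall B C D, r B -> r C -> r D ->
        exists S, [/\ closed_segment S, S `<=` r & [/\ S B, S C & S D]]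
    & ~ closed_segment r].

Definition maximal_ray A r : Prop :=
  ray_from A r /\ forall r', ray_from A r' -> ~ (r `<` r').

Definition space_with_maximal_rays : Prop :=
  [/\ is_betweenness,
      forall A B C, (seg_interior A B `&` seg_interior A C) !=set0 ->
        s A B `<=` s A C \/ s A C `<=` s A B
    & forall A B, A <> B -> connected_segment (s A B) ->
        exists C D, connected_segment (s C D) /\ s A B `<=` seg_interior C D].

End Betweenness.

Definition is_line (T : Type) (s : T -> T -> set T) : Prop :=
  (exists A B : T, A <> B) /\
  forall A : T, exists c1 c2 : set T,
    [/\ ~` [set A] = c1 `|` c2,
        c1 `&` c2 = set0,
        c1 !=set0 /\ c2 !=set0,
        convex s c1 /\ convex s c2
      & forall B C, c1 B -> c2 C -> s B C A].

Definition inherited (T : Type) (s : T -> T -> set T) (l : set T)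
    (A B : {x : T | l x}) : set {x : T | l x} :=
  [set C | s (sval A) (sval B) (sval C)].
Arguments inherited {T} s l A B.

Definition line_in (T : Type) (s : T -> T -> set T) (l : set T) : Prop :=
  convex s l /\ is_line (inherited s l).

(* Definite descriptions are rendered by [xget x0 P], which is some element of
   P if P is nonempty, and x0 otherwise. *)

Section Plane.
Variables (T : Type) (s : T -> T -> set T).
Implicit Types (A B C D : T) (c l r h : set T) (f : T -> T).

(* ray[A,B] *)
Definition ray A B : set T :=
  xget set0 [set r : set T | maximal_ray s A r /\ r B].

(* l(A,B) *)
Definition maxline A B : set T :=
  xget set0 [set l : set T |
    [/\ line_in s l, s A B `<=` l
      & forall l', line_in s l' -> s A B `<=` l' -> l' `<=` l]].

Definition maximal_line l : Prop := exists A B, A <> B /\ l = maxline A B.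

Definition collinear A B C : Prop :=
  exists l, line_in s l /\ [/\ l A, l B & l C].

Definition opposite_half_planes l h1 h2 : Prop :=
  [/\ ~` l = h1 `|` h2,
      h1 `&` h2 = set0,
      h1 !=set0 /\ h2 !=set0,
      convex s h1 /\ convex s h2
    & forall C D, h1 C -> h2 D -> exists! X, (s C D `&` l) X].

Definition half_plane l h : Prop := exists h', opposite_half_planes l h h'.

Definition is_plane : Prop :=
  [/\ space_with_maximal_rays s,
      exists A B : T, A <> B
    & forall A B, A <> B -> connected_segment s (s A B) /\
        exists h1 h2, opposite_half_planes (maxline A B) h1 h2].

Definition flag h r : Prop :=
  exists l, [/\ maximal_line l, half_plane l h, r `<=` l
              & exists A, maximal_ray s A r].

End Plane.

Definition is_subgroup (T : Type) (G H : set (T -> T)) : Prop :=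
  [/\ H `<=` G,
      H id,
      forall f g, H f -> H g -> H (f \o g)
    & forall f, H f -> exists g, [/\ H g, cancel f g & cancel g f]].

Section Erlangen.
Variables (T : Type) (s : T -> T -> set T) (I : set (T -> T)).
Implicit Types (A B C D : T) (l r h : set T) (f : T -> T).

Definition erlangen_plane : Prop :=
  [/\ is_plane s,
      is_subgroup [set f | isomorphism s f] I
    & forall h1 r1 h2 r2, flag s h1 r1 -> flag s h2 r2 ->
        exists! f, [/\ I f, f @` h1 = h2 & f @` r1 = r2]].

Definition parallel l l' : Prop := l = l' \/ l `&` l' = set0.

Definition euclidean_plane : Prop :=
  erlangen_plane /\
  forall l C, maximal_line s l ->
    exists! l', [/\ maximal_line s l', l' C & parallel l' l].

Definition tau A B : T -> T :=
  if pselect (A = B) then id else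
  @xget {classic T -> T} id [set f : T -> T |
    [/\ I f,
        f @` ray s A B =
          xget set0 [set r : set T | maximal_ray s B r /\ r `<=` ray s A B]
      & forall h, half_plane s (maxline s A B) h -> f @` h = h]].

Definition translation f : Prop := exists A B, f = tau A B.

End Erlangen.

Section Angles.
Variables (R : realType) (T : Type) (s : T -> T -> set T) (I : set (T -> T)).
Implicit Types (A B C : T) (r h : set T) (f : T -> T) (S : set (set T)).

(* the boundary of the plane at A, consisting of rays viewed as sets *)
Definition boundary A : set (set T) := [set r | maximal_ray s A r].

Definition antipodal A r1 r2 : Prop :=
  exists B C, [/\ r1 B, r2 C & seg_interior s B C A].

Definition ray_seg A r1 r2 : set (set T) :=
  [set r3 | boundary A r3 /\
     ((antipodal A r1 r2 \/ r1 = r2) /\ (r3 = r1 \/ r3 = r2) \/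
      ~ (antipodal A r1 r2 \/ r1 = r2) /\
      forall B C, r1 B -> r2 C -> (r3 `&` s B C) !=set0)].

Definition is_angle A S : Prop :=
  exists r1 r2, [/\ boundary A r1, boundary A r2 & S = ray_seg A r1 r2].

Definition congruent A S1 S2 : Prop :=
  exists f, [/\ I f, f A = A & [set f @` r | r in S1] = S2].

(* [ra], [ra'] are the antipodes of [r], [r'] *)
Definition right_angle A r r' : Prop :=
  exists ra ra' h1 h2 f,
    [/\ boundary A ra /\ antipodal A r ra,
        boundary A ra' /\ antipodal A r' ra',
        opposite_half_planes s (r `|` ra) h1 h2,
        [/\ I f, f @` r = r, f @` h1 = h2 & f @` h2 = h1]
      & f @` r' = ra'].

Definition is_angle_measure A (m : set (set T) -> R) : Prop :=
  [/\ forall S, is_angle A S -> 0 <= m S,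
      forall S1 S2, is_angle A S1 -> is_angle A S2 ->
        congruent A S1 S2 -> m S1 = m S2,
      forall r1 r2 r3, boundary A r1 -> boundary A r2 -> ray_seg A r1 r2 r3 ->
        m (ray_seg A r1 r2) = m (ray_seg A r1 r3) + m (ray_seg A r3 r2),
      forall r1 r2, boundary A r1 -> boundary A r2 -> antipodal A r1 r2 ->
        m (ray_seg A r1 r2) = 180
    & forall r1 r2, boundary A r1 -> boundary A r2 -> right_angle A r1 r2 ->
        m (ray_seg A r1 r2) = 90].

Definition angle_measure A : set (set T) -> R :=
  @xget {classic set (set T) -> R} (fun=> 0) [set m : set (set T) -> R | is_angle_measure A m].

(* the angle at the vertex A of the triangle ABC *)
Definition angle_at A B C : R :=
  angle_measure A (ray_seg A (ray s A B) (ray s A C)).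

Definition triangle A B C : Prop := [/\ A <> B, B <> C & A <> C].

Definition defect A B C : R :=
  180 - (angle_at A B C + angle_at B C A + angle_at C A B).

End Angles.

(* Main.v *)
(* Everything is expressed through half-turns: [tau A B] is the product of the
   half-turns about [A] and about the midpoint of [A] and [B], so translations
   are the products of two half-turns.  Midpoints, perpendiculars and bisectors
   exist because a decreasing self-map of a (Dedekind complete) segment has a
   fixed point.

   Each condition is compared with the existence of a rectangle, i.e. of two
   distinct lines with two distinct common perpendiculars.  A translation
   preserving a line other than its axis yields a rectangle; commuting
   translations, and a triangle around which the product of the translations
   along the sides is trivial, provide such a line.  So does a triangle of angle
   sum 180: if M and N are the midpoints of two sides, the half-turns about them
   transport the other two angles next to the common one, and the sum is 180
   exactly when both images of the third side lie on the same line, that is, when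
   the product of the two half-turns preserves the third side.

   Conversely, one rectangle forces every perpendicular of one side to be
   perpendicular to every perpendicular of the other (Bachmann's argument with
   glide reflections), and then repeated doubling along a line gives the parallel
   postulate by Archimedes.  Under that postulate the product of three half-turns
   is a half-turn, whence the statements on translations.

   The angle measure exists and is unique because angles at a point form a
   complete scale with halving (Hoelder's argument with dyadic multiples). *)

Require Import Defs.
From mathcomp Require Import all_boot all_order all_algebra.
From mathcomp Require Import all_classical reals.
From mathcomp Require Import lra ring.

Set Implicit Arguments.
Unset Strict Implicit.
Unset Printing Implicit Defensive.

Import Order.TTheory GRing.Theory Num.Theory.
Local Open Scope classical_set_scope.

(** The plane carries neither distance nor continuity, only betweenness and a group that is simply
    transitive on pairs of a half-plane and a ray in its boundary. Motions are therefore identified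
    by comparing them on a single flag, and fixed points come from the connectedness of segments.
    Half-turns are convenient because they are indexed by points and need neither a line nor a
    direction.

    Angles raise two obstacles. The measure is axiomatized at each vertex separately, so nothing in
    its definition compares the angles at different vertices of a triangle: a single function is
    built from one reference flag, every angle is carried there by the group, and uniqueness
    identifies this function with the measure at each vertex. Moreover, the segment between
    antipodal rays consists of these two rays only, so additivity does not link the value 180 to
    other angles; that adjacent angles on a line add up to 180 has to come from two right angles. *)

(** * Measures on a scale *)

(* The axioms satisfied by the angles in [0, 180[ under the subtraction
   [sub z x] = z - x, which is constrained only for [le x z]; [U] is the right
   angle, and [sc_Utop] says that U + U is out of range. *)
Record scale (W : Type) (O : set W) (le : W -> W -> Prop) (sub : W -> W -> W) (o U : W)
    : Prop := Scale {
  sc_o : O o;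
  sc_o_le : forall x, O x -> le o x;
  sc_anti : forall x y, O x -> O y -> le x y -> le y x -> x = y;
  sc_trans : forall x y z, O x -> O y -> O z -> le x y -> le y z -> le x z;
  sc_total : forall x y, O x -> O y -> le x y \/ le y x;
  sc_dense : forall x y, O x -> O y -> le x y -> x <> y ->
    exists z, [/\ O z, le x z, le z y, z <> x & z <> y];
  sc_sub : forall x z, O x -> O z -> le x z -> O (sub z x) /\ le (sub z x) z;
  sc_sub_o : forall z, O z -> sub z o = z;
  sc_subK : forall x z, O x -> O z -> le x z -> sub z (sub z x) = x;
  sc_sub_anti : forall x y z, O x -> O y -> O z -> le x y -> le y z ->
    le (sub z y) (sub z x);
  sc_sub_mono : forall x y z, O x -> O y -> O z -> le x y -> le y z ->
    le (sub y x) (sub z x);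
  sc_subB : forall x y z, O x -> O y -> O z -> le x y -> le y z ->
    sub (sub z x) (sub y x) = sub z y;
  sc_half : forall z, O z -> exists x, [/\ O x, le x z & sub z x = x];
  sc_U : O U;
  sc_Uo : U <> o;
  sc_Utop : forall x, O x -> le U x -> ~ le U (sub x U);
  sc_ded : forall P : set W, P o -> ~ P U ->
    (forall x y, O x -> O y -> le x y -> le y U -> P y -> P x) ->
    exists M, [/\ O M, le M U, forall x, O x -> le x M -> x <> M -> P x
      & forall x, O x -> le M x -> le x U -> x <> M -> ~ P x] }.

Definition scale_additive (R : realType) W (O : set W) (le : W -> W -> Prop)
    (sub : W -> W -> W) (m : W -> R) :=
  (forall x, O x -> 0 <= m x)%R /\
  forall x z, O x -> O z -> le x z -> m z = (m x + m (sub z x))%R.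

Section ScaleMeasure.
Variables (R : realType) (W : Type) (O : set W) (le : W -> W -> Prop).
Variables (sub : W -> W -> W) (o U : W).
Hypothesis hs : scale O le sub o U.

Let le_refl x : O x -> le x x.
Proof. by move=> hx; case: (sc_total hs hx hx). Qed.

(* k copies of [u] fit into [x]. *)
Fixpoint fits u k x : Prop := if k is k'.+1 then le u x /\ fits u k' (sub x u) else O x.

Lemma subxx x : O x -> sub x x = o.
Proof.
move=> hx; have := sc_subK hs (sc_o hs) hx (sc_o_le hs hx).
by rewrite (sc_sub_o hs hx).
Qed.

Lemma fits_le u k j x : O u -> O x -> (j <= k)%N -> fits u k x -> fits u j x.
Proof.
move=> hu; elim: k j x => [|k IH] [|j] x hx //= hjk [h1 h2]; split=> //.
by apply: IH => //; exact: (sc_sub hs hu hx h1).1.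
Qed.

Lemma fits_mono u k x y : O u -> O x -> O y -> le x y -> fits u k x -> fits u k y.
Proof.
move=> hu; elim: k x y => [//|k IH] x y hx hy hxy [hux h].
have huy := sc_trans hs hu hx hy hux hxy; split=> //.
apply: IH h; [exact: (sc_sub hs hu hx hux).1|exact: (sc_sub hs hu hy huy).1|].
exact: sc_sub_mono hs _ _ _ hu hx hy hux hxy.
Qed.

Lemma fits_add u k j x z : O u -> O x -> O z -> le x z ->
  fits u k x -> fits u j (sub z x) -> fits u (k + j) z.
Proof.
move=> hu; elim: k x z => [|k IH] x z hx hz hxz.
  move=> _; have [h1 h2] := sc_sub hs hx hz hxz; exact: fits_mono.
move=> [hux hk] hj; have huz := sc_trans hs hu hx hz hux hxz.
split=> //; apply: (IH (sub x u)) => //.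
- exact: (sc_sub hs hu hx hux).1.
- exact: (sc_sub hs hu hz huz).1.
- exact: sc_sub_mono hs _ _ _ hu hx hz hux hxz.
- by rewrite (sc_subB hs hu hx hz hux hxz).
Qed.

(** Dual to [fits_add]: together they show that the counts of [u] in [x] and in [sub z x] add up to
    the count in [z] with an error of at most one. *)
Lemma fits_addN u k j x z : O u -> O x -> O z -> le x z ->
  ~ fits u k x -> ~ fits u j (sub z x) -> ~ fits u (k + j) z.
Proof.
move=> hu; elim: k x z => [//|k IH] x z hx hz hxz nk nj [huz h].
have [hux|hxu] := sc_total hs hu hx.
  apply: (IH (sub x u) (sub z u)) => //.
  - exact: (sc_sub hs hu hx hux).1.
  - exact: (sc_sub hs hu hz huz).1.
  - exact: sc_sub_mono hs _ _ _ hu hx hz hux hxz.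
  - by move=> h'; apply: nk.
  - by rewrite (sc_subB hs hu hx hz hux hxz).
apply: nj; have [h1 h2] := sc_sub hs hx hz hxz; have [h3 h4] := sc_sub hs hu hz huz.
apply: (fits_mono hu h3 h1 (sc_sub_anti hs hx hu hz hxu huz)).
by apply: (fits_le hu h3 _ h); exact: leq_addl.
Qed.

Lemma fits_double u v k x : O u -> O v -> O x -> le v u -> sub u v = v ->
  fits u k x <-> fits v k.*2 x.
Proof.
move=> hu hv hx hvu e; elim: k x hx => [//|k IH] x hx /=.
split=> [[h1 h2]|[h1 [h2 h3]]].
  have h3 := sc_trans hs hv hu hx hvu h1.
  have h4 := sc_sub_mono hs hv hu hx hvu h1; rewrite e in h4.
  have e2 := sc_subB hs hv hu hx hvu h1; rewrite e in e2.
  by split=> //; split=> //; rewrite e2; apply/IH => //; exact: (sc_sub hs hu hx h1).1.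
have [hx1 hx2] := sc_sub hs hv hx h1.
(* If [x] were below [u], then [sub x v] would lie between [v] and [sub u v = v]; hence
   [sub u x = o] and [x = u]. *)
have hux : le u x.
  case: (sc_total hs hu hx) => // hxu.
  have h4 := sc_sub_mono hs hv hx hu h1 hxu; rewrite e in h4.
  have e1 := sc_anti hs hx1 hv h4 h2.
  have := sc_subK hs hv hx h1; rewrite e1 => e3.
  have := sc_subB hs hv hx hu h1 hxu; rewrite e e1 subxx // => e4.
  by have := sc_subK hs hx hu hxu; rewrite -e4 (sc_sub_o hs hu) => ->; exact: le_refl.
have e2 := sc_subB hs hv hu hx hvu hux; rewrite e in e2.
by split=> //; apply/IH; [exact: (sc_sub hs hu hx hux).1|rewrite -e2].
Qed.

Lemma halves_ex : exists u : nat -> W, u 0%N = U /\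
  forall n, [/\ O (u n), le (u n.+1) (u n) & sub (u n) (u n.+1) = u n.+1].
Proof.
have ex z : exists x, O z -> [/\ O x, le x z & sub z x = x].
  by case: (EM (O z)) => [/(sc_half hs)[x]|]; [exists x|exists z].
have [h hh] := choice ex.
exists (fun n => iter n h U); split=> // n.
have On : O (iter n h U).
  by elim: n => [|n IH]; [exact: sc_U hs|case: (hh _ IH)].
by case: (hh _ On).
Qed.

Section Halves.
Variable u : nat -> W.
Hypotheses (u0 : u 0%N = U)
  (hu : forall n, [/\ O (u n), le (u n.+1) (u n) & sub (u n) (u n.+1) = u n.+1]).

Let Ou n : O (u n). Proof. by case: (hu n). Qed.

Lemma fits_scale n p k x : O x -> fits (u n) k x <-> fits (u (n + p)) (k * 2 ^ p) x.
Proof.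
move=> hx; elim: p => [|p IH]; first by rewrite addn0 expn0 muln1.
rewrite IH addnS expnS [(2 * _)%N]mulnC mulnA muln2.
by have [h1 h2 h3] := hu (n + p); exact: fits_double.
Qed.

(** The bound is [2 * 2 ^ n] because [2 ^ n] copies of [u n] make up [U], and two copies of [U] do
    not fit by [sc_Utop]. *)
Lemma fits_top n x : O x -> ~ fits (u n) (2 * 2 ^ n) x.
Proof.
move=> hx; have := fits_scale 0 n 2 hx; rewrite add0n => <-.
by rewrite u0 => -[h1 [h2 _]]; exact: (sc_Utop hs hx h1).
Qed.

Lemma fits_lt n N k j x : O x -> fits (u n) k x -> ~ fits (u N) j x ->
  (k * 2 ^ N < j * 2 ^ n)%N.
Proof.
move=> hx /(fits_scale n N k hx) hk nj; rewrite ltnNge; apply/negP => h; apply: nj.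
apply/(fits_scale N n j hx); rewrite addnC; exact: fits_le h hk.
Qed.

Lemma fits_floor n x : O x -> exists k, fits (u n) k x /\ ~ fits (u n) k.+1 x.
Proof.
move=> hx; apply: contrapT => no.
suff all k : fits (u n) k x by exact: fits_top (all _).
by elim: k => [//|k IH]; apply: contrapT => h; apply: no; exists k.
Qed.

(** The Archimedean property, from Dedekind completeness. Otherwise the elements below all [u n]
    have a supremum [v] other than [o]. An element [w] above [v] with [w - v < v] exceeds some
    [u n], and then [w - v >= u n - u n.+1 = u n.+1 >= v]. *)
Lemma halves_small x : O x -> x <> o -> exists n, le (u n) x.
Proof.
move=> hx nx; apply: contrapT => no.
have lt n : le x (u n).
  by case: (sc_total hs hx (Ou n)) => // h; case: no; exists n.
have [oU nUo UO] : [/\ le o U, U <> o & O U] by split;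
  [apply: sc_o_le hs _ (sc_U hs)|exact: sc_Uo hs|exact: sc_U hs].
pose P y := forall n, le y (u n).
have Po : P o by move=> n; exact: sc_o_le hs _ _.
have uanti n m : (n <= m)%N -> le (u m) (u n).
  elim: m => [|m IH]; first by rewrite leqn0 => /eqP ->; exact: le_refl.
  rewrite leq_eqVlt => /orP[/eqP ->|/IH h]; first exact: le_refl.
  by have [_ h' _] := hu m; apply: (sc_trans hs _ _ _ h' h).
have nPU : ~ P U.
  move=> h; have [_ h1 h2] := hu 0; rewrite u0 in h1 h2.
  have := sc_anti hs (Ou 1) UO h1 (h 1%N) => e; rewrite e in h2.
  by rewrite subxx // in h2; apply: nUo.
have [|v [Ov vU below above]] := sc_ded hs Po nPU.
  by move=> y z hy hz hyz _ h n; apply: (sc_trans hs hy hz (Ou n) hyz).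
have nvo : v <> o.
  move=> e; apply: (above x hx _ _ _ lt); rewrite ?e //.
    exact: sc_o_le hs _ _.
  by rewrite -u0.
have vP : P v.
  move=> n; case: (sc_total hs Ov (Ou n)) => // h.
  have [->|nun] := EM (u n = v); first exact: le_refl.
  have [z [Oz h1 h2 n1 n2]] := sc_dense hs (Ou n) Ov h nun.
  have hz := below z Oz h2 n2 n.
  by case: n1; exact: sc_anti hs _ _ Oz (Ou n) hz h1.
have nvU : v <> U by move=> e; apply: nPU; rewrite -e.
have [y [Oy yv ey]] := sc_half hs Ov.
have nyo : y <> o.
  by move=> e; apply: nvo; rewrite e (sc_sub_o hs Ov) in ey.
have nyv : y <> v.
  by move=> e; rewrite e subxx // in ey; apply: nvo.
(* [w] lies strictly above [v] with [w - v < v]. *)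
have [w [Ow vw wU nwv wv]] :
    exists w, [/\ O w, le v w, le w U, w <> v & ~ le v (sub w v)].
  have [Oc _] := sc_sub hs Ov UO vU.
  have [cv|vc] := sc_total hs Oc Ov.
    (* When [U - v <= v], any [w] strictly between [v] and [U] works: [v <= w - v] would squeeze
       [w - v] to [U - v] and force [w = U]. *)
    have [w [Ow h1 h2 n1 n2]] := sc_dense hs Ov UO vU nvU.
    have [Owv _] := sc_sub hs Ov Ow h1.
    exists w; split=> // h.
    have h3 := sc_sub_mono hs Ov Ow UO h1 h2.
    have e1 := sc_anti hs Owv Oc h3 (sc_trans hs Oc Ov Owv cv h).
    have e2 := sc_subB hs Ov Ow UO h1 h2; rewrite e1 subxx // in e2.
    have := sc_subK hs Ow UO h2; rewrite -e2 (sc_sub_o hs UO) => e3.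
    exact: n2.
  (* Only subtraction is available: [w = v + y], with [y] half of [v], is obtained as
     [U - ((U - v) - y)]. *)
  have yc := sc_trans hs Oy Ov Oc yv vc.
  set c := sub U v in Oc vc yc.
  have [Od dc] := sc_sub hs Oy Oc yc; set d := sub c y in Od dc.
  have cU : le c U := (sc_sub hs Ov UO vU).2.
  have dU := sc_trans hs Od Oc UO dc cU.
  have [Ow wU] := sc_sub hs Od UO dU; set w := sub U d in Ow wU.
  have vw : le v w by rewrite -(sc_subK hs Ov UO vU); exact: sc_sub_anti hs _ _ _ Od Oc UO dc cU.
  have e1 : sub w v = y.
    have h := sc_subB hs Od Oc UO dc cU.
    have hcd : sub c d = y by exact: sc_subK hs _ _ Oy Oc yc.
    rewrite hcd (sc_subK hs Ov UO vU) in h.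
    have [Owv wvw] := sc_sub hs Ov Ow vw.
    by rewrite -h; apply: (sc_subK hs Oy Ow); rewrite -hcd;
      exact: sc_sub_mono hs _ _ _ Od Oc UO dc cU.
  exists w; split=> //.
    by move=> e; rewrite e subxx // in e1; apply: nyo.
  by rewrite e1 => h; apply: nyv; exact: sc_anti hs _ _ Oy Ov yv h.
have nPw : ~ P w by exact: above.
have [n hn] : exists n, le (u n) w.
  apply: contrapT => no'; apply: nPw => n.
  by case: (sc_total hs Ow (Ou n)) => // h; case: no'; exists n.
apply: wv.
have [_ h1 h2] := hu n.
have h3 := sc_sub_anti hs Ov (Ou n.+1) (Ou n) (vP n.+1) h1; rewrite h2 in h3.
have [Ouv _] := sc_sub hs Ov (Ou n) (vP n).
apply: (sc_trans hs Ov (Ou n.+1) (sc_sub hs Ov Ow vw).1 (vP n.+1)).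
apply: (sc_trans hs (Ou n.+1) Ouv (sc_sub hs Ov Ow vw).1 h3).
exact: sc_sub_mono hs _ _ _ Ov (Ou n) Ow (vP n) hn.
Qed.

(** * Real values from dyadic approximation *)

Local Open Scope ring_scope.

Definition step n : R := 90 / 2 ^+ n.

Lemma step_gt0 n : 0 < step n.
Proof. by rewrite divr_gt0 ?exprn_gt0 // ltr0n. Qed.

Lemma stepS n : step n = step n.+1 + step n.+1.
Proof.
by rewrite /step exprS; field; rewrite expf_neq0 // pnatr_eq0.
Qed.

Lemma step_small (a : R) (c : nat) : (forall n, a <= c%:R * step n) -> a <= 0.
Proof.
move=> h; rewrite leNgt; apply/negP => a0.
have n2 n : (n%:R : R) <= 2 ^+ n by rewrite -natrX ler_nat ltnW // ltn_expl.
have [n hn] : exists n : nat, c%:R * 90 / a < n%:R.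
  exists (Num.bound (c%:R * 90 / a)); apply: archi_boundP.
  by rewrite divr_ge0 ?mulr_ge0 // ltW.
have := h n; rewrite /step mulrA leNgt => /negP; apply.
rewrite ltr_pdivrMr ?exprn_gt0 ?ltr0n //.
by have := lt_le_trans hn (n2 n); rewrite ltr_pdivrMr // [ltRHS]mulrC.
Qed.

Lemma additive_step (m : W -> R) n : scale_additive O le sub m -> m U = 90 -> m (u n) = step n.
Proof.
move=> [_ add] mU; elim: n => [|n IH]; first by rewrite u0 mU /step expr0 divr1.
have [h1 h2 h3] := hu n.
have := add _ _ (Ou n.+1) (Ou n) h2; rewrite h3 IH stepS => e; lra.
Qed.

Lemma additive_le (m : W -> R) x z : scale_additive O le sub m -> O x -> O z -> le x z -> m x
  <= m z.
Proof.
move=> [m0 add] hx hz hxz; rewrite (add _ _ hx hz hxz) lerDl; apply: m0.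
exact: (sc_sub hs hx hz hxz).1.
Qed.

Lemma additive_floor (m : W -> R) n k x : scale_additive O le sub m -> m U = 90 -> O x ->
  fits (u n) k x -> k%:R * step n <= m x.
Proof.
move=> hm mU; elim: k x => [|k IH] x hx.
  by move=> _; rewrite mul0r; case: hm => m0 _; exact: m0.
move=> [h1 h2]; have [_ add] := hm.
rewrite (add _ _ (Ou n) hx h1) (additive_step n hm mU).
have := IH _ (sc_sub hs (Ou n) hx h1).1 h2.
by rewrite -natr1 mulrDl mul1r => h; lra.
Qed.

Lemma additive_ceil (m : W -> R) n k x : scale_additive O le sub m -> m U = 90 -> O x ->
  ~ fits (u n) k x -> m x <= k%:R * step n.
Proof.
move=> hm mU; elim: k x => [|k IH] x hx nk; first by case: nk.
have [_ add] := hm; have em := additive_step n hm mU.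
have k0 : 0 <= k%:R * step n by rewrite mulr_ge0 // ltW // step_gt0.
rewrite -natr1 mulrDl mul1r.
have [h1|h1] := sc_total hs (Ou n) hx.
  rewrite (add _ _ (Ou n) hx h1) em addrC lerD2r; apply: IH.
    exact: (sc_sub hs (Ou n) hx h1).1.
  by move=> h2; apply: nk; split.
by have := additive_le hm hx (Ou n) h1; rewrite em => h; lra.
Qed.

Lemma additive_uniq (m m' : W -> R) x : scale_additive O le sub m -> m U = 90 ->
  scale_additive O le sub m' -> m' U = 90 -> O x -> m x <= m' x.
Proof.
move=> hm mU hm' mU' hx; rewrite -subr_le0; apply: (@step_small _ 1) => n.
have [k [h1 h2]] := fits_floor n hx.
have := additive_ceil hm mU hx h2; have := additive_floor hm' mU' hx h1.
by rewrite -natr1 mulrDl mul1r => h3 h4; lra.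
Qed.

Lemma additive_gt0 (m : W -> R) x : scale_additive O le sub m -> m U = 90 -> O x -> x <> o ->
  0 < m x.
Proof.
move=> hm mU hx nx; have [n hn] := halves_small hx nx.
by apply: lt_le_trans (additive_le hm (Ou n) hx hn); rewrite (additive_step n hm mU) step_gt0.
Qed.

Definition floors x : set R := [set r | exists n k, fits (u n) k x /\ r = k%:R * step n].

Lemma floors_le n k x : O x -> ~ fits (u n) k x -> ubound (floors x) (k%:R * step n).
Proof.
move=> hx nk r [N [j [hj ->]]]; have h := fits_lt hx hj nk.
rewrite /step !mulrA ler_pdivrMr ?exprn_gt0 ?ltr0n //.
rewrite mulrAC ler_pdivlMr ?exprn_gt0 ?ltr0n //.
have : ((j * 2 ^ n)%N%:R : R) <= (k * 2 ^ N)%N%:R by rewrite ler_nat ltnW.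
by rewrite !natrM !natrX => h'; nra.
Qed.

Lemma floors_sup x : O x -> has_sup (floors x).
Proof.
move=> hx; split; first by exists 0; exists 0%N, 0%N; rewrite mul0r.
by exists ((2 * 2 ^ 0)%N%:R * step 0); apply: floors_le => //; exact: fits_top.
Qed.

Definition mu x := sup (floors x).

Lemma mu_floor n k x : O x -> fits (u n) k x -> k%:R * step n <= mu x.
Proof.
move=> hx hk; apply: sup_upper_bound; first exact: floors_sup.
by exists n, k.
Qed.

Lemma mu_ceil n k x : O x -> ~ fits (u n) k x -> mu x <= k%:R * step n.
Proof.
move=> hx hk; apply: ge_sup; first by case: (floors_sup hx).
exact: floors_le.
Qed.

(** Floors at level [n] bound all three values, so the two sides differ by at most two steps for
    every [n]. *)
Lemma mu_additive : scale_additive O le sub mu.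
Proof.
split=> [x hx|x z hx hz hxz].
  by have := @mu_floor 0 0 x hx hx; rewrite mul0r.
have [hy _] := sc_sub hs hx hz hxz; set y := sub z x in hy *.
apply/eqP; rewrite eq_le; apply/andP; split; rewrite -subr_le0;
  apply: (@step_small _ 2) => n; have [k [k1 k2]] := fits_floor n hx;
  have [j [j1 j2]] := fits_floor n hy.
- have := mu_ceil hz (fits_addN (Ou n) hx hz hxz k2 j2).
  have := mu_floor hx k1; have := mu_floor hy j1.
  by rewrite natrD -!natr1 !mulrDl !mul1r => a b c; lra.
- have := mu_floor hz (fits_add (Ou n) hx hz hxz k1 j1).
  have := mu_ceil hx k2; have := mu_ceil hy j2.
  by rewrite natrD -!natr1 !mulrDl !mul1r => a b c; lra.
Qed.

Lemma mu_U : 90 <= mu U.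
Proof.
have e : step 0 = 90 by rewrite /step expr0 divr1.
rewrite -e -[step 0]mul1r; apply: (@mu_floor 0 1); first exact: sc_U hs.
split; first by rewrite u0; exact: le_refl (sc_U hs).
by rewrite u0 /= subxx; [exact: sc_o hs|exact: sc_U hs].
Qed.

(* [mu U] is in fact 90, but rescaling avoids proving it. *)
Lemma normalized_mu : scale_additive O le sub (fun x => mu x * (90 / mu U)) /\
  mu U * (90 / mu U) = 90.
Proof.
have U0 : 0 < mu U by apply: lt_le_trans mu_U; rewrite ltr0n.
have [h0 h1] := mu_additive; split; last by rewrite mulrC divfK // gt_eqF.
split=> [x hx|x z hx hz hxz]; first by rewrite mulr_ge0 ?h0 // divr_ge0 // ltW.
by rewrite (h1 _ _ hx hz hxz) mulrDl.
Qed.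

End Halves.

Local Open Scope ring_scope.

Lemma scale_measure : exists m : W -> R, scale_additive O le sub m /\ m U = 90.
Proof.
have [u [u0 hu]] := halves_ex; have [h1 h2] := normalized_mu u0 hu.
by exists (fun x => mu u x * (90 / mu u U)).
Qed.

Lemma scale_measure_uniq (m m' : W -> R) x : scale_additive O le sub m -> m U = 90 ->
  scale_additive O le sub m' -> m' U = 90 -> O x -> m x = m' x.
Proof.
have [u [u0 hu]] := halves_ex => hm mU hm' mU' hx.
by apply/eqP; rewrite eq_le !(additive_uniq u0 hu).
Qed.

Lemma scale_measure_gt0 (m : W -> R) x : scale_additive O le sub m -> m U = 90 ->
  O x -> x <> o -> 0 < m x.
Proof.
by have [u [u0 hu]] := halves_ex; exact: additive_gt0 u0 hu _ _.
Qed.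

End ScaleMeasure.

Section Plane.
Variables (T : Type) (s : T -> T -> set T) (I : set (T -> T)).
Hypothesis erl : erlangen_plane s I.

(** * Segments, lines and rays *)

Lemma isplane : is_plane s. Proof. by case: erl. Qed.

Lemma isbetw : is_betweenness s.
Proof. by case: isplane => -[]. Qed.

Lemma sl A B : s A B A.
Proof. by case: isbetw. Qed.

Lemma sC A B X : s A B X -> s B A X.
Proof. by case: isbetw => _ h _; apply: h. Qed.

Lemma sr A B : s A B B.
Proof. exact/sC/sl. Qed.

Hint Resolve sl sr : core.

Lemma s_union A B C : s A B C -> s A B = s A C `|` s C B.
Proof. by case: isbetw => _ _ h /h[]. Qed.

Lemma s_cap A B C X : s A B C -> s A C X -> s C B X -> X = C.
Proof.
case: isbetw => _ _ h /h[_ e1 e2] h1 h2.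
have : (s A C `&` s C B) X by [].
by rewrite e1 e2.
Qed.

Lemma sxx A X : s A A X -> X = A.
Proof. by case: isbetw => _ _ h; case: (h A A A (sl A A)) => _ _ ->. Qed.

Lemma s_tr A B C D : s A B C -> s A C D -> s A B D.
Proof. by move=> /s_union-> ?; left. Qed.

Lemma s_in A B C D : s A B C -> s A C D -> s D B C.
Proof.
move=> h1 h2; have hD := s_tr h1 h2.
have : s A B C by []. rewrite (s_union hD) => -[h3|//].
by rewrite (s_cap h2 h3 (sr _ _)).
Qed.

Lemma s_anti A B C : s A B C -> s A C B -> B = C.
Proof. by move=> h1 h2; rewrite (s_cap h1 h2 (sr C B)). Qed.

Lemma s_split A B C D : s A B C -> s A B D -> s A C D \/ s C B D.
Proof. by move=> /s_union ->. Qed.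

Lemma s_tot A B X Y : s A B X -> s A B Y -> s A X Y \/ s A Y X.
Proof.
move=> hX hY; case: (s_split hY hX) => h; first by right.
by left; apply: sC; apply: (s_in (sC hY) (sC h)).
Qed.

Lemma s_sub A B X Y Z : s A B X -> s A B Y -> s X Y Z -> s A B Z.
Proof.
move=> hX hY hZ; case: (s_tot hX hY) => h.
  by apply: (s_tr hX); apply/sC/(s_tr (sC h))/hZ.
by apply: (s_tr hY); apply/sC/(s_tr (sC h))/sC.
Qed.

Lemma seg_conn A B : A <> B -> connected_segment s (s A B).
Proof. by case: isplane => _ _ h /h[]. Qed.

Lemma convex1 A : convex s [set A].
Proof. by move=> X Y -> -> Z /sxx. Qed.

Lemma seg_dense A B : A <> B -> exists X, [/\ s A B X, X <> A & X <> B].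
Proof.
move=> nAB; apply: contrapT => no.
have h X : s A B X -> X = A \/ X = B.
  move=> hX; apply: contrapT => /not_orP[n1 n2].
  by apply: no; exists X.
have cl C : closed_segment s [set C].
  by exists C, C; apply/seteqP; split=> X; [move=> -> | move=> /sxx].
case: (seg_conn nAB) => _ /(_ [set A] [set B]) [].
- apply/seteqP; split=> X; first by move=> /h[->|->]; [left|right].
  by case=> ->.
- by apply/seteqP; split=> X //= [-> /nAB].
- by exists A.
- by exists B.
- exact: convex1.
- exact: convex1.
- by case=> _ [].
- by case=> + _ => [].
Qed.

Lemma seg_extend A B : A <> B -> exists2 C, s A C B & C <> B.
Proof.
case: isplane => -[_ _ ax] _ _ nAB.
have [C [D [_ h]]] := ax _ _ nAB (seg_conn nAB).
have [hA nA] := h _ (sl A B); have [hB nB] := h _ (sr A B).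
case: (s_tot hA hB) => h1.
  by exists C; [exact: sC | move=> e; apply: nB; left].
by exists D; [apply: s_in h1 | move=> e; apply: nB; right].
Qed.

Lemma seg_end A B C D : s C D A -> s A B C -> s A B D -> exists E, s C D = s A E.
Proof.
have comm X Y : s X Y = s Y X by apply/seteqP; split=> Z /sC.
move=> hA hC hD; case: (s_tot hC hD) => h.
  by exists C; rewrite (s_anti hA (sC h)) comm.
by exists D; rewrite (s_anti (sC hA) (sC h)).
Qed.

(** Connectedness of [s A B], applied to [P] and its complement, makes exactly one of the two a
    closed segment; by [seg_end] it starts at [A] or at [B], and its other endpoint is the cut [M].
    Whether [P M] holds is left open. *)
Lemma dedekind_cut A B (P : set T) : A <> B -> P A -> ~ P B ->
  (forall X Y, s A B Y -> s A Y X -> P Y -> P X) ->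
  exists M, [/\ s A B M, forall X, s A M X -> X <> M -> P X
              & forall X, s M B X -> X <> M -> ~ P X].
Proof.
move=> nAB PA nPB dn.
case: (seg_conn nAB) => _ /(_ [set X | s A B X /\ P X] [set X | s A B X /\ ~ P X]).
case.
- apply/seteqP; split=> X; last by case=> -[].
  by move=> hX; case: (EM (P X)); [left|right].
- by apply/seteqP; split=> X // -[[_ ?] []].
- by exists A.
- by exists B.
- move=> X Y [hX PX] [hY PY] Z hZ; have hZ' := s_sub hX hY hZ; split=> //.
  case: (s_tot hX hY) => h.
    by apply: (dn _ _ hX) PX; apply/sC/(s_tr (sC h))/hZ.
  by apply: (dn _ _ hY) PY; apply/sC/(s_tr (sC h))/sC.
- move=> X Y [hX PX] [hY PY] Z hZ; have hZ' := s_sub hX hY hZ; split=> //.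
  case: (s_tot hX hY) => h PZ.
    by apply: PY; apply: (dn _ _ hZ' _ PZ); exact/sC/(s_in (sC h) hZ).
  by apply: PX; apply: (dn _ _ hZ' _ PZ); exact/sC/(s_in (sC h) (sC hZ)).
- case=> -[C [D e]] _.
  have mem X : s C D X <-> s A B X /\ P X by rewrite -e.
  have [E eE] : exists E, s C D = s A E.
    by apply: (seg_end (B := B)); [apply/mem | case/mem: (sl C D) | case/mem: (sr C D)].
  move: mem; rewrite eE => mem.
  have [hE PE] := (mem E).1 (sr _ _).
  exists E; split=> // X hX nX; first by have [] := (mem X).1 hX.
  move=> PX; apply: nX; have hX' := s_sub hE (sr _ _) hX.
  have h : s A E X by apply/mem.
  by rewrite (s_anti h (sC (s_in (sC hE) (sC hX)))).
- case=> _ [C [D e]].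
  have mem X : s C D X <-> s A B X /\ ~ P X by rewrite -e.
  have [E eE] : exists E, s C D = s B E.
    apply: (seg_end (B := A)); first by apply/mem.
      by case/mem: (sl C D) => /sC.
    by case/mem: (sr C D) => /sC.
  move: mem; rewrite eE => mem.
  have [hE PE] := (mem E).1 (sr _ _).
  exists E; split=> // X hX nX; last by have [] := (mem X).1 (sC hX).
  apply: contrapT => PX; apply: nX.
  have /sC h : s B E X by apply/mem; split=> //; apply: s_tr hE hX.
  exact: (s_cap hE hX h).
Qed.

Lemma line_cut l A B : line_in s l -> l A -> l B -> B <> A ->
  (exists Z, [/\ l Z, s B Z A & Z <> A]) /\
  (forall C D, l C -> l D -> C <> A -> D <> A -> s B C A ->
     (s B D A /\ ~ s C D A) \/ (~ s B D A /\ s C D A)).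
Proof.
case=> _ [_ hl] lA lB nBA.
case: (hl (exist _ A lA)) => c1 [c2 [e e0 [[Z1 hZ1] [Z2 hZ2]] [v1 v2] hb]].
have ne X (lX : l X) : X <> A -> (c1 `|` c2) (exist _ X lX).
  move=> nXA; have : (~` [set exist _ A lA]) (exist _ X lX) by move=> [].
  by rewrite e.
have neA X : (c1 `|` c2) X -> sval X <> A.
  move=> h; have : (~` [set exist _ A lA]) X by rewrite e.
  case: X {h} => X lX /= h1 h2; apply: h1; subst X.
  by congr exist; exact: Prop_irrelevance.
have nA c (v : convex (inherited s l) c) X Y : c `<=` (c1 `|` c2) ->
    c X -> c Y -> ~ s (sval X) (sval Y) A.
  move=> sub cX cY h; have := v _ _ cX cY (exist _ A lA) h.
  by move=> /sub /neA.
have s1 : c1 `<=` (c1 `|` c2) by move=> ? ; left.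
have s2 : c2 `<=` (c1 `|` c2) by move=> ? ; right.
split.
  case: (ne B lB nBA) => hB.
    by exists (sval Z2); split; [exact: svalP | exact: (hb _ _ hB hZ2) | apply/neA; right].
  by exists (sval Z1); split; [exact: svalP | exact: sC (hb _ _ hZ1 hB) | apply/neA; left].
move=> C D lC lD nC nD hBC.
case: (ne B lB nBA) => hB; case: (ne C lC nC) => hC; case: (ne D lD nD) => hD.
- by case: (nA _ v1 _ _ s1 hB hC).
- by case: (nA _ v1 _ _ s1 hB hC).
- by right; split; [exact: (nA _ v1 _ _ s1 hB hD) | exact: sC (hb _ _ hD hC)].
- by left; split; [exact: (hb _ _ hB hD) | exact: (nA _ v2 _ _ s2 hC hD)].
- by left; split; [exact: sC (hb _ _ hD hB) | exact: (nA _ v1 _ _ s1 hC hD)].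
- by right; split; [exact: (nA _ v2 _ _ s2 hB hD) | exact: (hb _ _ hC hD)].
- by case: (nA _ v2 _ _ s2 hB hC).
- by case: (nA _ v2 _ _ s2 hB hC).
Qed.

Lemma seg_ends P Q X Y : s P Q X -> s P Q Y -> s X Y P -> X = P \/ Y = P.
Proof.
move=> hX hY h; case: (s_tot hX hY) => h1.
  by right; rewrite (s_anti h (sC h1)).
by left; rewrite (s_anti (sC h) (sC h1)).
Qed.

Lemma s_mid P Q E X Y : s P Q E -> s P E X -> s E Q Y -> s X Y E.
Proof. by move=> hE hX hY; apply: s_in (sC (s_in (sC hE) (sC hY))) hX. Qed.

(** Open segments are the supply of lines: by the extension axiom every nondegenerate segment lies
    in one, so [maxline A B] contains every segment through [A] and [B] ([line_sub]). *)
Lemma seg_interior_line P Q : P <> Q -> line_in s (seg_interior s P Q).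
Proof.
move=> nPQ.
have open X : s P Q X -> X <> P -> X <> Q -> seg_interior s P Q X.
  by move=> h n1 n2; split=> // -[].
split.
  move=> X Y [hX nX] [hY nY] Z hZ; apply: open; first exact: s_sub hX hY hZ.
    by move=> e; rewrite e in hZ; case: (seg_ends hX hY hZ) => e'; [apply: nX|apply: nY]; left.
  move=> e; rewrite e in hZ.
  by case: (seg_ends (sC hX) (sC hY) hZ) => e'; [apply: nX|apply: nY]; right.
have [U [hU nUP nUQ]] := seg_dense nPQ.
have [V [hV nVP nVU]] := seg_dense (fun e => nUP (esym e)).
split.
  exists (exist _ U (open U hU nUP nUQ)).
  unshelve eexists (exist _ V (open V _ nVP _)); last by case=> e; case: nVU.
    exact: s_tr hU hV.
  by move=> e; apply: nUQ; rewrite e in hV; exact: esym (s_anti hU hV).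
move=> [E [hE nE]].
have nEP : E <> P by move=> e; apply: nE; left.
have nEQ : E <> Q by move=> e; apply: nE; right.
have [X1 [h1 n1 n1']] := seg_dense (fun e => nEP (esym e)).
have [X2 [h2 n2 n2']] := seg_dense nEQ.
exists [set X | s P E (sval X) /\ sval X <> E], [set X | s E Q (sval X) /\ sval X <> E].
split.
- apply/seteqP; split=> -[X hX] /=.
    move=> nX; have nX' : X <> E.
      by move=> e; apply: nX; subst X; congr exist; exact: Prop_irrelevance.
    by case: hX {nX} => hX _; case: (s_split hE hX) => ?; [left|right].
  by case=> -[_ n] [].
- apply/seteqP; split=> -[X hX] //= -[[/= hl n] [hr _]]; apply: n.
  exact: s_cap hE hl hr.
- split.
    unshelve eexists; first (exists X1; apply: open => //; first exact: s_tr hE h1).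
      by move=> e; subst X1; apply: nEQ; exact: esym (s_anti hE h1).
    by [].
  unshelve eexists; first (exists X2; apply: open => //; first exact: sC (s_tr (sC hE) (sC h2))).
    by move=> e; subst X2; apply: nEP; exact: esym (s_anti (sC hE) (sC h2)).
  by [].
- split=> -[X hX] [Y hY] [/= h3 n3] [/= h4 n4] [Z hZ] h; change (s X Y Z) in h; (split => /=;
  first exact: s_sub h3 h4 h).
    by move=> e; rewrite e in h; case: (seg_ends (sC h3) (sC h4) h).
  by move=> e; rewrite e in h; case: (seg_ends h3 h4 h).
- by move=> [X hX] [Y hY] [/= h3 n3] [/= h4 n4]; exact: s_mid hE h3 h4.
Qed.

Definition line A B := maxline s A B.
Definition col A B X := [\/ s A B X, s X B A | s A X B].

(** The default value of [xget] is excluded by the plane axiom: a segment joining the two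
    half-planes meets [maxline A B], which is thus not [set0]. *)
Lemma maxlineP A B : A <> B -> [/\ line_in s (line A B), s A B `<=` line A B &
  forall l', line_in s l' -> s A B `<=` l' -> l' `<=` line A B].
Proof.
move=> nAB; rewrite /line /maxline; case: xgetP => [l _ //|no].
case: isplane => _ _ /(_ A B nAB)[_ [h1 [h2 [_ _ [[C hC] [D hD]] _]]]].
case/(_ C D hC hD) => X [[_ +] _].
by rewrite /maxline; case: xgetP => // l _ /no.
Qed.

Lemma line_sub A B C D : A <> B -> s C D A -> s C D B -> s C D `<=` line A B.
Proof.
move=> nAB hA hB X hX.
have nCD : C <> D by move=> e; apply: nAB; subst D; rewrite (sxx hA) (sxx hB).
case: isplane => -[_ _ ax] _ _; have [P [Q [_ h]]] := ax _ _ nCD (seg_conn nCD).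
have nPQ : P <> Q.
  move=> e; have [/= + +] := h _ hX; rewrite e => /sxx -> n.
  by apply: n; left.
have [_ _ top] := maxlineP nAB.
apply: (top _ (seg_interior_line nPQ)); last exact: h.
by move=> Z hZ; apply: h; exact: s_sub hA hB hZ.
Qed.

Lemma s_ray A B C X : X <> A -> s A B X -> s A C X -> s A B C \/ s A C B.
Proof.
move=> nXA hB hC.
have [e|nXB] := EM (X = B); first by right; rewrite -e.
have [e|nXC] := EM (X = C); first by left; rewrite -e.
case: isplane => -[_ ax _] _ _.
case: (ax A B C) => [|h|h].
- by exists X; split; split=> // -[].
- by right; apply: h; exact: sr.
- by left; apply: h; exact: sr.
Qed.

(** Take [Z] in [l] beyond [X] as seen from [A]. If [X] is not between [A] and [B], it is between
    [Z] and [B]; then [s Z A] and [s Z B] share [X], and one of them contains the other. *)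
Lemma line_in_col l A B X : line_in s l -> A <> B -> l A -> l B -> l X -> col A B X.
Proof.
move=> hl nAB lA lB lX; apply: contrapT => no.
have nXA : X <> A by move=> e; apply: no; rewrite e; constructor 1.
have nXB : X <> B by move=> e; apply: no; rewrite e; constructor 1.
have [[Z [lZ hZ nZX]] _] := line_cut hl lX lA (fun e => nXA (esym e)).
have [_ cutX] := line_cut hl lX lA (fun e => nXA (esym e)).
case: (cutX Z B lZ lB nZX (fun e => nXB (esym e)) hZ) => -[h1 h2].
  by apply: no; constructor 1.
case: (s_ray (fun e => nZX (esym e)) (sC hZ) h2) => h.
  by apply: no; constructor 3; exact: sC (s_in h h2).
by apply: no; constructor 2; exact: s_in h (sC hZ).
Qed.

Lemma line_col A B X : A <> B -> line A B X <-> col A B X.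
Proof.
move=> nAB; have [hl hs _] := maxlineP nAB; split.
  by apply: (line_in_col hl nAB); apply: hs.
by case=> h; [exact: hs | apply: (line_sub (C := X) (D := B)) | apply: (line_sub (C := A) (D
  := X))].
Qed.

Lemma line_l A B : A <> B -> line A B A.
Proof. by move=> /line_col ->; constructor 1. Qed.

Lemma line_r A B : A <> B -> line A B B.
Proof. by move=> /line_col ->; constructor 1. Qed.

Lemma line_seg A B X : A <> B -> s A B X -> line A B X.
Proof. by move=> /line_col -> h; constructor 1. Qed.

Lemma line_incl A B C D : A <> B -> C <> D -> line A B C -> line A B D -> line A B `<=` line C D.
Proof.
move=> nAB nCD hC hD; have [hl _ _] := maxlineP nAB.
have [_ _ top] := maxlineP nCD.
by apply: top => //; case: hl => v _; exact: v.
Qed.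

Lemma line_eq A B C D : A <> B -> C <> D -> line A B C -> line A B D -> line C D = line A B.
Proof.
move=> nAB nCD hC hD; have h := line_incl nAB nCD hC hD.
by apply/seteqP; split=> //; apply: line_incl => //; apply: h; [exact: line_l|exact: line_r].
Qed.

Definition mline (l : set T) := maximal_line s l.

Lemma mline_line A B : A <> B -> mline (line A B).
Proof. by exists A, B. Qed.

Lemma mline_eq l A B : mline l -> A <> B -> l A -> l B -> l = line A B.
Proof. by move=> [C [D [nCD ->]]] nAB hA hB; exact: esym (line_eq nCD nAB hA hB). Qed.

Lemma mline_eq2 l m A B : mline l -> mline m -> A <> B -> l A -> l B -> m A -> m B -> l = m.
Proof. by move=> hl hm nAB ? ? ? ?; rewrite (mline_eq hl nAB) // -(mline_eq hm nAB). Qed.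

Lemma mline_seg l A B X : mline l -> l A -> l B -> s A B X -> l X.
Proof.
move=> hl hA hB; have [<- /sxx->//|nAB] := EM (A = B).
by rewrite (mline_eq hl nAB hA hB); exact: line_seg.
Qed.

Lemma mline_out l A B X : mline l -> l A -> l B -> A <> B -> s A X B -> l X.
Proof.
by move=> hl hA hB nAB h; rewrite (mline_eq hl nAB hA hB); apply/line_col => //; constructor 3.
Qed.

Lemma mline_pt l : mline l -> exists A B, [/\ A <> B, l A, l B & l = line A B].
Proof. by move=> [A [B [nAB ->]]]; exists A, B; split; [|exact: line_l|exact: line_r|]. Qed.

Lemma mline_pt2 l A : mline l -> l A -> exists B, [/\ A <> B, l B & l = line A B].
Proof.
move=> hl lA; have [C [D [nCD lC lD e]]] := mline_pt hl.
have [eAC|nAC] := EM (A = C).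
  by exists D; subst C; split.
by exists C; split=> //; exact: mline_eq.
Qed.

(** The explicit form of [ray A B], identified in [rayE]. For [A = B] it is the whole plane, whence
    the hypotheses [A <> B]. *)
Definition hray A B : set T := [set X | s A B X \/ s A X B].

Lemma hray_r A B : hray A B B. Proof. by left. Qed.
Lemma hray_l A B : hray A B A. Proof. by left. Qed.
Hint Resolve hray_r hray_l : core.

Lemma hray_sub_L A B : A <> B -> hray A B `<=` line A B.
Proof. by move=> nAB X [h|h]; apply/line_col => //; [constructor 1|constructor 3]. Qed.

Lemma hray_tot A B X Y : A <> B -> hray A B X -> hray A B Y -> s A X Y \/ s A Y X.
Proof.
move=> nAB [hX|hX] [hY|hY].
- by case: (s_tot hX hY); [left|right].
- by right; apply: s_tr hY hX.
- by left; apply: s_tr hX hY.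
- by case: (s_ray (fun e => nAB (esym e)) hX hY); [left|right].
Qed.

Lemma hray_mem A B C X : A <> B -> A <> C -> hray A B C -> hray A B X -> hray A C X.
Proof. by move=> nAB nAC hC hX; case: (hray_tot nAB hC hX); [left|right]. Qed.

Lemma hray_sym A B C : hray A B C -> hray A C B.
Proof. by case; [right|left]. Qed.

Lemma hray_eq A B C : A <> B -> A <> C -> hray A B C -> hray A C = hray A B.
Proof.
move=> nAB nAC h; apply/seteqP; split=> X; apply: hray_mem => //; exact: hray_sym.
Qed.

Lemma hray_below A B W V : A <> B -> hray A B W -> s A W V -> hray A B V.
Proof.
move=> nAB hW hV; have [e|nAW] := EM (A = W).
  by subst W; rewrite (sxx hV); left.
by rewrite -(hray_eq nAB nAW hW); left.
Qed.

Lemma hray_conv A B : A <> B -> convex s (hray A B).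
Proof.
move=> nAB X Y hX hY Z hZ; case: (hray_tot nAB hX hY) => h.
  by apply: (hray_below nAB hX); apply: s_sub _ _ hZ; [exact: sr|].
by apply: (hray_below nAB hY); apply: s_sub _ _ hZ; [|exact: sr].
Qed.

Lemma hray_end A B X Y : A <> B -> hray A B X -> hray A B Y -> s X Y A -> X = A \/ Y = A.
Proof.
move=> nAB hX hY h; case: (hray_tot nAB hX hY) => h'.
  by right; rewrite (s_anti h (sC h')).
by left; rewrite (s_anti (sC h) (sC h')).
Qed.

Lemma hray_or A B X : A <> B -> line A B X -> hray A B X \/ s X B A.
Proof. by move=> nAB /(line_col _ nAB)[]; [left; left|right|left; right]. Qed.

Lemma hray_ray A B : A <> B -> ray_from s A (hray A B).
Proof.
move=> nAB; split; first exact: hray_conv.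
- split=> [|X Y hX hY nX nY h]; first exact: hray_l.
  by case: (hray_end nAB hX hY h).
- move=> X Y Z hX hY hZ.
  have [W [hW [wX wY wZ]]] : exists W, hray A B W /\ [/\ s A W X, s A W Y & s A W Z].
    have [V [hV vX vY]] : exists V, [/\ hray A B V, s A V X & s A V Y].
      by case: (hray_tot nAB hX hY) => h; [exists X|exists Y].
    case: (hray_tot nAB hV hZ) => h; first by exists V; split.
    by exists Z; split=> //; split=> //; exact: s_tr h _.
  exists (s A W); split=> //; first by exists A, W.
  by move=> V; apply: hray_below.
- move=> [P [Q e]].
  have hP : hray A B P by rewrite e. have hQ : hray A B Q by rewrite e.
  have hA : s P Q A by rewrite -e.
  have noQ D : hray A B D -> hray A B `<=` s A D -> False.
    move=> hD sub; have nAD : A <> D.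
      by move=> e'; apply: nAB; subst D; rewrite (sxx (sub B _)).
    have [E hE nE] := seg_extend nAD.
    apply: nE; apply: s_anti (hE) _; apply: sub.
    by rewrite -(hray_eq nAB nAD hD); right.
  case: (hray_end nAB hP hQ hA) => e'; subst A.
    by apply: (noQ Q) => // X; rewrite e.
  by apply: (noQ P) => // X; rewrite e => /sC.
Qed.

(** A segment of [r] through [A], [B] and [X] has [A] as an endpoint, since [A] is not between two
    other points of [r]. This makes [hray A B] maximal. *)
Lemma ray_from_sub A B r : A <> B -> ray_from s A r -> r B -> r `<=` hray A B.
Proof.
move=> nAB [_ [rA nb] hs _] rB X rX.
have [S [[P [Q ->]] sub [hA hB hX]]] := hs _ _ _ rA rB rX.
have [e|nPA] := EM (P = A).
  by subst P; case: (s_tot hB hX); [left|right].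
have [e|nQA] := EM (Q = A).
  by subst Q; case: (s_tot (sC hB) (sC hX)); [left|right].
by case: (nb P Q) => //; apply: sub.
Qed.

Lemma hray_max A B : A <> B -> maximal_ray s A (hray A B).
Proof.
move=> nAB; split=> [|r' hr' [sub]]; first exact: hray_ray.
by apply; apply: ray_from_sub => //; apply: sub.
Qed.

Lemma max_rayP A r : maximal_ray s A r -> exists B, A <> B /\ r = hray A B.
Proof.
move=> [hr mr]; have [B [rB nAB]] : exists B, r B /\ A <> B.
  apply: contrapT => no; case: (hr) => _ [rA _] _; apply.
  exists A, A; apply/seteqP; split=> X.
    by move=> rX; apply: contrapT => nX; apply: no; exists X; split=> // e; subst X.
  by move=> /sxx ->.
exists B; split=> //; have sub := ray_from_sub nAB hr rB.
apply/seteqP; split=> //; apply: contrapT => nsub.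
by case: (mr _ (hray_ray nAB)).
Qed.

Lemma rayE A B : A <> B -> ray s A B = hray A B.
Proof.
move=> nAB; apply: xget_unique; first by split; [exact: hray_max|].
by move=> r [/max_rayP[C [nAC ->]] h]; rewrite (hray_eq nAC nAB h).
Qed.

Lemma hray_apex A B C D : A <> B -> C <> D -> hray A B = hray C D -> A = C.
Proof.
move=> nAB nCD e; apply: contrapT => nAC.
have hC : hray A B C by rewrite e.
have [E hE nE] := seg_extend nAC.
have hE' : hray A B E by rewrite -(hray_eq nAB nAC hC); right.
have hA : hray C D A by rewrite -e.
rewrite e in hE'; case: (hray_end nCD hA hE' hE) => [//|]; exact: nE.
Qed.

(** * Half-planes and the group of motions *)

(** The sides of [l] are relations between points, since the two half-planes come without names; the
    half-plane of [P] is [same l P] ([half_planeP]). *)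
Definition same l X Y := [/\ ~ l X, ~ l Y & forall Z, l Z -> ~ s X Y Z].
Definition opp l X Y := [/\ ~ l X, ~ l Y & exists2 Z, l Z & s X Y Z].

Lemma half_ex l : mline l -> exists h1 h2, opposite_half_planes s l h1 h2.
Proof. by move=> [A [B [nAB ->]]]; case: isplane => _ _ /(_ A B nAB)[]. Qed.

Lemma halfP l h1 h2 : opposite_half_planes s l h1 h2 ->
  [/\ forall X, ~ l X <-> h1 X \/ h2 X, forall X, h1 X -> h2 X -> False &
  forall X Y, ~ l X -> ~ l Y -> (h1 X <-> h1 Y) -> same l X Y]
  /\ (forall X Y, h1 X -> h2 Y -> opp l X Y).
Proof.
case=> e e0 _ [v1 v2] h.
have hl X : ~ l X <-> h1 X \/ h2 X.
  by split=> [nl|hX]; [have : (~` l) X by [] | have : (h1 `|` h2) X by []];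
    [rewrite e|rewrite -e].
have dis X : h1 X -> h2 X -> False.
  by move=> a b; have : (h1 `&` h2) X by []; rewrite e0.
split; last first.
  move=> X Y hX hY; split; [by apply/hl; left|by apply/hl; right|].
  by case: (h X Y hX hY) => Z [[? ?] _]; exists Z.
split=> // X Y /hl[hX|hX] /hl[hY|hY] i.
- split; [by apply/hl; left|by apply/hl; left|].
  by move=> Z lZ sZ; have /hl : h1 Z \/ h2 Z by left; apply: v1 sZ.
- by have /dis : h1 Y by apply/i.
- by have /dis : h1 X by apply/i.
- split; [by apply/hl; right|by apply/hl; right|].
  by move=> Z lZ sZ; have /hl : h1 Z \/ h2 Z by right; apply: v2 sZ.
Qed.

Lemma same_opp_ex l X Y : ~ l X -> ~ l Y -> same l X Y \/ opp l X Y.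
Proof.
move=> hX hY; case: (EM (exists2 Z, l Z & s X Y Z)) => h; first by right.
by left; split=> // Z lZ sZ; apply: h; exists Z.
Qed.

Lemma same_opp l X Y : same l X Y -> opp l X Y -> False.
Proof. by move=> [_ _ h] [_ _ [Z /h]]. Qed.

(** One predicate [h] tells the two sides apart, so the composition rules for [same] and [opp]
    become propositional logic. *)
Lemma sideP l : mline l -> exists h : set T,
  (forall X Y, same l X Y <-> [/\ ~ l X, ~ l Y & (h X <-> h Y)]) /\
  (forall X Y, opp l X Y <-> [/\ ~ l X, ~ l Y & ~ (h X <-> h Y)]).
Proof.
move=> hl; have [h1 [h2 hh]] := half_ex hl.
have [[hl1 dis sm] op] := halfP hh.
have smP X Y : same l X Y <-> [/\ ~ l X, ~ l Y & (h1 X <-> h1 Y)].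
  split; last by case; exact: sm.
  move=> sXY; case: (sXY) => nX nY _; split=> //.
  case/hl1: nX => hX; case/hl1: nY => hY.
  - by [].
  - by case: (same_opp sXY (op _ _ hX hY)).
  - have [a b [Z c /sC d]] := op _ _ hY hX.
    by case: (same_opp sXY); split=> //; exists Z.
  - by split=> /dis[].
exists h1; split=> // X Y; split=> [o|[a b c]].
  case: (o) => a b _; split=> // i; apply: (same_opp _ o).
  exact/smP.
by case: (same_opp_ex a b) => // /smP[].
Qed.

Lemma same_refl l X : ~ l X -> mline l -> same l X X.
Proof. by move=> h /sideP[p [sP _]]; apply/sP. Qed.

Lemma same_sym l X Y : same l X Y -> same l Y X.
Proof. by move=> [a b c]; split=> // Z /c h /sC. Qed.

Lemma opp_sym l X Y : opp l X Y -> opp l Y X.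
Proof. by move=> [a b [Z c /sC d]]; split=> //; exists Z. Qed.

Lemma same_trans l X Y Z : mline l -> same l X Y -> same l Y Z -> same l X Z.
Proof. by move=> /sideP[p [sP _]] /sP[a b c] /sP[d e f]; apply/sP; split=> //; rewrite c. Qed.

Lemma same_opp_trans l X Y Z : mline l -> same l X Y -> opp l Y Z -> opp l X Z.
Proof.
by move=> /sideP[p [sP oP]] /sP[a b c] /oP[d e f]; apply/oP; split=> //; rewrite c.
Qed.

Lemma opp_same_trans l X Y Z : mline l -> opp l X Y -> same l Y Z -> opp l X Z.
Proof.
by move=> /sideP[p [sP oP]] /oP[a b c] /sP[d e f]; apply/oP; split=> //; rewrite -f.
Qed.

Lemma opp_opp l X Y Z : mline l -> opp l X Y -> opp l Y Z -> same l X Z.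
Proof.
move=> /sideP[p [sP oP]] /oP[a b c] /oP[d e f]; apply/sP; split=> //.
by case: (EM (p X)); case: (EM (p Y)); case: (EM (p Z)); tauto.
Qed.

Lemma half_opp l X : mline l -> ~ l X -> exists Y, opp l X Y.
Proof.
move=> hl nX; have [h1 [h2 hh]] := half_ex hl.
case: (hh) => _ _ [[C hC] [D hD]] _ _.
have [[hl1 _ _] op] := halfP hh.
case/hl1: nX => h; first by exists D; apply: op.
by exists C; apply/opp_sym/op.
Qed.

Lemma off_ex l : mline l -> exists X, ~ l X.
Proof.
move=> hl; have [h1 [h2 hh]] := half_ex hl.
case: (hh) => _ _ [[C hC] [D hD]] _ _.
have [[hl1 _ _] op] := halfP hh.
by exists C; apply/hl1; left.
Qed.

Lemma half_planeP l h : mline l -> half_plane s l h <-> exists2 P, ~ l P & h = same l P.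
Proof.
move=> hl; split.
  move=> [h' hh]; have [[hl1 dis sm] op] := halfP hh.
  case: hh => _ _ [[C hC] _] _ _; exists C; first by apply/hl1; left.
  apply/seteqP; split=> X hX; first by apply: sm; [apply/hl1; left|apply/hl1; left|].
  case: (hX) => _ /hl1[//|/(op _ _ hC) o] _.
  by case: (same_opp hX o).
move=> [P nP ->]; have [Q o] := half_opp hl nP.
exists (opp l P); split.
- apply/seteqP; split=> X; last by case=> -[].
  by move=> nX; case: (same_opp_ex nP nX); [left|right].
- by apply/seteqP; split=> X // [/same_opp k /k].
- by split; [exists P; exact: same_refl|exists Q].
- split=> X Y hX hY Z hZ.
    have hXY := same_trans hl (same_sym hX) hY.
    apply: (same_trans hl hX).
    have nZ : ~ l Z by move=> lZ; case: hXY => _ _ /(_ Z lZ).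
    case: hXY => nX nY k; split=> // W /k nW sW; apply: nW.
    exact: s_sub (sl _ _) hZ sW.
  have hXY := opp_opp hl (opp_sym hX) hY.
  apply: (opp_same_trans hl hX).
  have nZ : ~ l Z by move=> lZ; case: hXY => _ _ /(_ Z lZ).
  case: hXY => nX nY k; split=> // W /k nW sW; apply: nW.
  exact: s_sub (sl _ _) hZ sW.
- move=> C D hC hD; case: (same_opp_trans hl (same_sym hC) hD) => nC nD [Z lZ sZ].
  exists Z; split=> // W [sW lW].
  apply: contrapT => nZW; apply: nC.
  have mem : line Z W C.
    have nCD : C <> D by move=> e; subst D; case: (same_opp hC hD).
    rewrite (line_eq nCD nZW) //; first exact: line_l; exact: line_seg.
  by rewrite (mline_eq hl nZW).
Qed.

(** * Motions and their action on flags *)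

Lemma I_iso f : I f -> isomorphism s f.
Proof. by case: erl => _ [h _ _ _] _ /h. Qed.

Lemma I_id : I id. Proof. by case: erl => _ []. Qed.

Lemma I_comp f g : I f -> I g -> I (f \o g).
Proof. by case: erl => _ [_ _ h _] _; exact: h. Qed.

Lemma I_inv f : I f -> exists g, [/\ I g, cancel f g & cancel g f].
Proof. by case: erl => _ [_ _ _ h] _; exact: h. Qed.

Lemma I_inj f : I f -> injective f.
Proof. by move=> /I_iso[/bij_inj]. Qed.

Lemma I_surj f Y : I f -> exists X, f X = Y.
Proof. by move=> /I_inv[g [_ _ h]]; exists (g Y). Qed.

Lemma I_s f A B X : I f -> s A B X -> s (f A) (f B) (f X).
Proof. by move=> /I_iso[_ <-] h; exists X. Qed.

Lemma I_s' f A B X : I f -> s (f A) (f B) (f X) -> s A B X.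
Proof. by move=> If; case: (I_iso If) => _ <- [Y h /(I_inj If) <-]. Qed.

Lemma I_ne f A B : I f -> A <> B -> f A <> f B.
Proof. by move=> /I_inj h n /h. Qed.

Lemma I_hray f A B X : I f -> hray A B X <-> hray (f A) (f B) (f X).
Proof.
by move=> If; split=> -[h|h]; [left|right|left|right]; by [apply: I_s|apply: I_s' h].
Qed.

Lemma I_line f A B X : I f -> A <> B -> line A B X <-> line (f A) (f B) (f X).
Proof.
move=> If nAB; rewrite (line_col _ nAB) (line_col _ (I_ne If nAB)); split=> -[h|h|h].
- by constructor 1; apply: I_s. 
- by constructor 2; apply: I_s.
- by constructor 3; apply: I_s.
- by constructor 1; apply: I_s' h.
- by constructor 2; apply: I_s' h.
- by constructor 3; apply: I_s' h.
Qed.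

Lemma im_mem f (l : set T) X : I f -> (f @` l) (f X) <-> l X.
Proof. by move=> /I_inj h; split=> [[Y hY /h <-]|hX]//; exists X. Qed.

Lemma im_ex f (l m : set T) : I f -> (forall X, l X <-> m (f X)) -> f @` l = m.
Proof.
move=> If h; apply/seteqP; split=> Y.
  by move=> [X /h hX <-].
by case: (I_surj Y If) => X <- /h hX; exists X.
Qed.

Lemma im_line f A B : I f -> A <> B -> f @` line A B = line (f A) (f B).
Proof. by move=> If nAB; apply: im_ex => // X; apply: I_line. Qed.

Lemma im_hray f A B : I f -> f @` hray A B = hray (f A) (f B).
Proof. by move=> If; apply: im_ex => // X; apply: I_hray. Qed.

Lemma im_mline f l : I f -> mline l -> mline (f @` l).
Proof. by move=> If [A [B [nAB ->]]]; rewrite im_line //; apply/mline_line/I_ne. Qed.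

Lemma I_same f l X Y : I f -> same l X Y <-> same (f @` l) (f X) (f Y).
Proof.
move=> If; split=> -[a b c].
  split; [by move/im_mem => /(_ If)|by move/im_mem => /(_ If)|].
  by move=> Z [W lW <-] /(I_s' If); apply: c.
split; [by move/(im_mem _ _ If)|by move/(im_mem _ _ If)|].
by move=> Z lZ /(I_s If); apply: c; exists Z.
Qed.

Lemma I_opp f l X Y : I f -> opp l X Y <-> opp (f @` l) (f X) (f Y).
Proof.
move=> If; split=> -[a b [Z c d]].
  split; [by move/im_mem => /(_ If)|by move/im_mem => /(_ If)|].
  by exists (f Z); [exists Z|apply: I_s].
split; [by move/(im_mem _ _ If)|by move/(im_mem _ _ If)|].
by case: c d => W lW <- /(I_s' If); exists W.
Qed.

Lemma im_same f l P : I f -> f @` same l P = same (f @` l) (f P).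
Proof. by move=> If; apply: im_ex => // X; apply: I_same. Qed.

Lemma flagP A B P : A <> B -> ~ line A B P -> flag s (same (line A B) P) (hray A B).
Proof.
move=> nAB nP; exists (line A B); split; first exact: mline_line.
- by apply/half_planeP; [exact: mline_line|exists P].
- exact: hray_sub_L.
- by exists A; exact: hray_max.
Qed.

Lemma same_ext l P Q : mline l -> same l P = same l Q <-> (same l P Q \/ (l P /\ l Q)).
Proof.
move=> hl; split=> [e|[h|[hP hQ]]].
- case: (EM (l Q)) => [lQ|nQ]; last by left; rewrite e; exact: same_refl.
  right; split=> //; apply: contrapT => nP.
  by have := same_refl nP hl; rewrite e => -[].
- by apply/seteqP; split=> X; apply: same_trans => //; exact: same_sym.
- by apply/seteqP; split=> X [].
Qed.

Lemma E_ex A B P A' B' P' : A <> B -> ~ line A B P -> A' <> B' -> ~ line A' B' P' ->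
  exists f, [/\ I f, f A = A', hray A' B' (f B) & same (line A' B') P' (f P)].
Proof.
move=> nAB nP nAB' nP'; case: erl => _ _ ex.
have [f [[If e1 e2] _]] := ex _ _ _ _ (flagP nAB nP) (flagP nAB' nP').
have eA : f A = A'.
  by move: (e2); rewrite im_hray //; exact: hray_apex (I_ne If nAB) nAB'.
exists f; split=> //; first by rewrite -e2; exists B.
by rewrite -e1; exists P => //; apply: same_refl => //; exact: mline_line.
Qed.

(** The standard way to prove motions equal: both carry the flag of [A], [B], [P] to the same flag.
    Applied to a square, through [E_id], it shows that a motion is an involution. *)
Lemma E_uniq f g A B P : I f -> I g -> A <> B -> ~ line A B P -> f A = g A ->
  hray (f A) (f B) (g B) -> same (line (f A) (f B)) (f P) (g P) -> f = g.
Proof.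
move=> If Ig nAB nP eA eB eP; case: erl => _ _ ex.
have nf := I_ne If nAB. have ng := I_ne Ig nAB. rewrite -eA in ng.
have nfP : ~ line (f A) (f B) (f P) by move=> /(I_line _ If nAB).
have [h [_ u]] := ex _ _ _ _ (flagP nAB nP) (flagP nf nfP).
have <- : h = f.
  by apply: u; split=> //; [rewrite im_same // im_line|rewrite im_hray].
apply: u; split=> //; last by rewrite im_hray // -eA; apply: hray_eq.
have eL : line (f A) (g B) = line (f A) (f B) by apply: line_eq => //;
  [exact: line_l|exact: hray_sub_L].
rewrite im_same // im_line // -eA eL; apply/same_ext; first exact: mline_line.
by left; exact: same_sym.
Qed.

Lemma E_id f A B P : I f -> A <> B -> ~ line A B P -> f A = A -> hray A B (f B) ->
  same (line A B) P (f P) -> f = id.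
Proof.
by move=> If nAB nP eA eB eP; apply/esym; apply: (E_uniq I_id If nAB nP).
Qed.

(** * Fixed points and the crossbar theorem *)

(* Monotone maps stand in for continuous ones: the surjectivity onto
   [s (p B) B] excludes jumps. *)
Lemma decreasing_fixpoint A B (p : T -> T) : A <> B ->
  (forall X, s A B X -> s A B (p X)) -> p A = B ->
  (forall X Y, s A B Y -> s A Y X -> s A (p X) (p Y)) ->
  (forall Y, s (p B) B Y -> exists2 X, s A B X & p X = Y) ->
  exists2 M, s A B M & p M = M.
Proof.
move=> nAB pin pA dec sur.
(* In the order of [s A B] starting at [A], [s A Y X] reads [X <= Y]; so [P X] says [X <= p X]. *)
pose P X := s A (p X) X.
have [PB|nPB] := EM (P B).
  by exists B; [exact: sr|exact: esym (s_anti (pin _ (sr _ _)) PB)].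
have PA : P A by exact: sl.
have dn X Y : s A B Y -> s A Y X -> P Y -> P X.
  by move=> hY hXY PY; apply: s_tr (dec _ _ hY hXY) (s_tr PY hXY).
have [M [hM below above]] := dedekind_cut nAB PA nPB dn.
have pB Y : s A B Y -> s A Y (p Y) -> s (p B) B Y.
  by move=> hY h; apply: s_in hY (s_tr h (dec _ _ (sr _ _) hY)).
apply: contrapT => no.
have npM : p M <> M by move=> e; apply: no; exists M.
case: (s_tot hM (pin _ hM)) => hp; last first.
  (* [p] would jump over the diagonal at [M]: the value [Y] strictly between [M] and [p M] is
     attained at some [Z], and both positions of [Z] relative to [M] are contradictory. *)
  have [Y [hY nYM nYp]] := seg_dense (fun e => npM (esym e)).
  have hYB : s A B Y := s_tr (pin _ hM) (s_sub hp (sr _ _) hY).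
  have hMB : s M B Y := s_tr (s_in (pin _ hM) hp) hY.
  have PY := above _ hMB nYM.
  have hYp : s A Y (p Y) by case: (s_tot hYB (pin _ hYB)).
  have [Z hZ eZ] := sur Y (pB _ hYB hYp).
  have YpM : s A (p M) Y := s_sub hp (sr _ _) hY.
  case: (s_tot hZ hM) => hZM; last first.
    have h := dec _ _ hM hZM; rewrite eZ in h.
    by apply: nYp; exact: s_anti h YpM.
  have nZM : Z <> M by move=> e; apply: nYp; rewrite -eZ e.
  have PZ := above _ (s_in hZ hZM) nZM.
  case: (s_tot hZ (pin _ hZ)) => // hZZ; apply: PY.
  by have := dec _ _ hZ hZZ; rewrite eZ.
have [Y [hY nYp nYM]] := seg_dense npM.
have hYM : s A M Y := s_sub hp (sr _ _) hY.
have hYB : s A B Y := s_tr hM hYM.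
have PY := below _ hYM nYM.
have pMY : s A Y (p M) := sC (s_in (sC hp) (sC hY)).
have [Z hZ eZ] : exists2 Z, s A B Z & p Z = Y.
  by apply: sur; apply: s_in hYB (s_tr pMY (dec _ _ (sr _ _) hM)).
have nZM : Z <> M by move=> e; apply: nYp; rewrite -eZ e.
case: (s_tot hZ hM) => hZM.
  by have h := dec _ _ hZ hZM; rewrite eZ in h; apply: nYp; exact: s_anti pMY h.
have PZ := below _ hZM nZM; rewrite /P eZ in PZ.
have h := dec _ _ hYB PZ; rewrite eZ in h.
by apply: no; exists Y => //; exact: s_anti PY h.
Qed.

(** The Knaster-Tarski argument: [M] is the supremum of the points [Z] with [Z <= p Z] in the order
    from [A], and [P] collects the points below one of them. *)
Lemma increasing_fixpoint A B (p : T -> T) : A <> B ->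
  (forall X, s A B X -> s A B (p X)) ->
  (forall X Y, s A B Y -> s A Y X -> s A (p Y) (p X)) ->
  exists2 M, s A B M & p M = M.
Proof.
move=> nAB pin inc.
pose P X := exists Z, [/\ s A B Z, s A Z X & s A (p Z) Z].
have [[Z [hZ h1 h2]]|nPB] := EM (P B).
  by move: h2; rewrite -(s_anti hZ h1) => h2; exists B => //;
    exact: esym (s_anti (pin _ (sr _ _)) h2).
have PA : P A by exists A.
have dn X Y : s A B Y -> s A Y X -> P Y -> P X.
  by move=> hY hXY [Z [hZ h1 h2]]; exists Z; split=> //; exact: s_tr h1 hXY.
have [M [hM below above]] := dedekind_cut nAB PA nPB dn.
exists M => //; apply: contrapT => npM.
have PM' Z : s A B Z -> s A (p Z) Z -> s A M Z.
  move=> hZ PZ; case: (s_tot hZ hM) => // h.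
  have [-> //|nZM] := EM (Z = M).
  by case: (above Z (s_in hZ h) nZM); exists Z.
case: (s_tot hM (pin _ hM)) => hp; last first.
  apply: (above _ (s_in (pin _ hM) hp) npM); exists (p M); split=> //; first exact: pin.
  exact: inc (pin _ hM) hp.
have [Y [hY nYp nYM]] := seg_dense npM.
have hYM : s A M Y := s_sub hp (sr _ _) hY.
have [Z [hZ ZY PZ]] := below _ hYM nYM.
have h := s_tr (inc _ _ hM (PM' _ hZ PZ)) (s_tr PZ ZY).
by apply: nYp; exact: s_anti (sC (s_in (sC hp) (sC hY))) h.
Qed.

Definition noncol A B C := A <> B /\ ~ line A B C.

Lemma line_comm A B : A <> B -> line B A = line A B.
Proof. by move=> nAB; apply: line_eq => //; [exact: nesym|exact: line_r|exact: line_l]. Qed.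

Lemma noncol_ne A B C : noncol A B C -> [/\ A <> B, A <> C & B <> C].
Proof.
by move=> [nAB h]; split=> // e; apply: h; subst C; [exact: line_l|exact: line_r].
Qed.

Lemma noncol_rot A B C : noncol A B C -> noncol A C B.
Proof.
move=> h; have [nAB nAC nBC] := noncol_ne h; case: h => _ h; split=> // h'.
apply: h; rewrite (line_eq nAC nAB (line_l _) h') //; exact: line_r.
Qed.

Lemma noncol_sym A B C : noncol A B C -> noncol B A C.
Proof. by move=> [nAB h]; split; [exact: nesym|rewrite line_comm]. Qed.

Lemma ray_same l A X Y : mline l -> l A -> ~ l X -> hray A X Y -> Y <> A -> same l X Y.
Proof.
move=> hl lA nX hY nYA; have nAX : A <> X by move=> e; subst X.
have off Z : hray A X Z -> Z <> A -> ~ l Z.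
  move=> hZ nZ lZ; apply: nX; rewrite (mline_eq hl (nesym nZ) lA lZ).
  by rewrite (line_eq nAX (nesym nZ)) //; [exact: line_r|exact: line_l|exact: hray_sub_L].
split=> // [|Z lZ sZ]; first exact: off.
apply: (off Z) => // [|e]; first exact: hray_conv sZ.
by subst Z; case: (hray_end nAX (hray_r _ _) hY sZ) => // e; subst X.
Qed.

Lemma seg_same l B C Z : mline l -> l B -> ~ l C -> s B C Z -> Z <> B -> same l C Z.
Proof. by move=> hl lB nC h; apply: ray_same => //; left. Qed.

Lemma seg_opp l A X Y : mline l -> l A -> ~ l X -> s X Y A -> Y <> A -> opp l X Y.
Proof.
move=> hl lA nX h nYA; split=> // [lY|]; last by exists A.
by apply: nX; apply: (mline_out hl lY lA nYA); exact: sC.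
Qed.

Lemma hray_pt l A B X : mline l -> l A -> ~ l B -> line A B X -> same l B X -> hray A B X.
Proof.
move=> hl lA nB hX sX; have nAB : A <> B by move=> e; subst B.
case: (hray_or nAB hX) => // h; case: (same_opp sX); apply: (seg_opp hl lA nB (sC h)).
by move=> e; subst X; case: sX.
Qed.

(** Prolong [BA] beyond [A] to [D]. The line [AX] separates [B] from [D]. It does not separate [D]
    from [C]: a crossing point would lie on the ray [AX], hence on the side of [B] of the line [AC],
    but also on the side of [D]. So it separates [B] from [C]. *)
Lemma crossbar A B C X : noncol A B C -> same (line A B) C X -> same (line A C) B X ->
  exists2 Z, s B C Z & hray A X Z.
Proof.
move=> t s1 s2; have [nAB nAC nBC] := noncol_ne t.
have hAB := mline_line nAB; have hAC := mline_line nAC.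
have [D hD nDA] := seg_extend (nesym nAB).
have nX1 : ~ line A B X by case: s1. have nX2 : ~ line A C X by case: s2.
have nAX : A <> X by move=> e; subst X; apply: nX1; exact: line_l.
have hAX := mline_line nAX; pose l := line A X.
have lB : ~ l B by have [] := noncol_rot (conj nAB nX1).
have lC : ~ l C by have [] := noncol_rot (conj nAC nX2).
have oBD : opp l B D by apply: (seg_opp hAX (line_l nAX)).
have dAB : line A B D by apply/line_col => //; constructor 2; exact: sC.
have nBAC : ~ line A C B by have [] := noncol_rot t.
have oBD' : opp (line A C) B D by apply: (seg_opp hAC (line_l nAC)).
have nD : ~ l D by case: oBD.
have sDC : same l D C.
  case: (same_opp_ex nD lC) => // -[_ _ [Z lZ sZ]].
  have nZD : Z <> D by move=> e; subst Z.
  have nZC : Z <> C by move=> e; subst Z.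
  have s3 : same (line A B) C Z by apply: (seg_same hAB dAB) => //; case: t.
  have RZ : hray A X Z.
    by apply: (hray_pt hAB (line_l nAB) nX1 lZ); apply: same_trans s3 => //; exact: same_sym.
  have nZA : Z <> A by move=> e; subst Z; case: s3 => _ + _; case; exact: line_l.
  have s4 : same (line A C) X Z by apply: (ray_same hAC (line_l nAC)).
  have s5 : same (line A C) D Z.
    by apply: (seg_same hAC (line_r nAC)); [case: oBD'|exact: sC|].
  case: (same_opp (same_trans hAC (same_trans hAC s2 s4) (same_sym s5)) oBD').
case: (opp_same_trans hAX oBD sDC) => _ _ [Z lZ sZ]; exists Z => //.
have nZB : Z <> B by move=> e; subst Z.
have s3 : same (line A B) C Z by apply: (seg_same hAB (line_r nAB)) => //; case: t.
by apply: (hray_pt hAB (line_l nAB) nX1 lZ); apply: same_trans s3 => //; exact: same_sym.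
Qed.

Lemma hray_L A B X : A <> B -> A <> X -> hray A B X -> line A X = line A B.
Proof. by move=> nAB nAX h; apply: line_eq => //; [exact: line_l|exact: hray_sub_L]. Qed.

Lemma noncol_R A B C X : noncol A B C -> hray A B X -> X <> A -> noncol A X C.
Proof.
move=> [nAB h] hX nX; split; first exact: nesym.
by rewrite (hray_L nAB _ hX) //; exact: nesym.
Qed.

Lemma inner_same A B C X : noncol A B C -> s B C X -> X <> B -> X <> C ->
  same (line A B) C X /\ same (line A C) B X.
Proof.
move=> t h nB nC; have [nAB nAC nBC] := noncol_ne t; split.
  by apply: (seg_same (mline_line nAB) (line_r nAB)) => //; case: t.
by apply: (seg_same (mline_line nAC) (line_r nAC)) (sC h) _ => //; case: (noncol_rot t).
Qed.

(** Central projection from [A] between two transversals of the same angle. *)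
Lemma crossbar_seg A B C X B' C' : noncol A B C -> s B C X -> hray A B B' -> hray A C C' ->
  B' <> A -> C' <> A -> exists2 X', s B' C' X' & hray A X X'.
Proof.
move=> t hX hB hC nB' nC'; have [nAB nAC nBC] := noncol_ne t.
have [->|nXB] := EM (X = B); first by exists B'.
have [->|nXC] := EM (X = C); first by exists C'.
have [s1 s2] := inner_same t hX nXB nXC.
have t' : noncol A B' C' := noncol_rot (noncol_R (noncol_rot (noncol_R t hB nB')) hC nC').
apply: crossbar => //.
  rewrite (hray_L nAB _ hB); last exact: nesym.
  apply: same_trans (mline_line nAB) (same_sym _) s1.
  by apply: (ray_same (mline_line nAB) (line_l nAB)) => //; case: t.
rewrite (hray_L nAC _ hC); last exact: nesym.
apply: same_trans (mline_line nAC) (same_sym _) s2.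
by apply: (ray_same (mline_line nAC) (line_l nAC)) => //; case: (noncol_rot t).
Qed.

(** * Half-turns *)

Lemma reversal_fixpoint0 f A B : I f -> A <> B -> f A = B -> s A B (f B) ->
  exists2 M, s A B M & f M = M.
Proof.
move=> If nAB eA hB.
have pin X : s A B X -> s A B (f X).
  by move=> /(I_s If); rewrite eA; exact: s_sub (sr _ _) hB.
apply: decreasing_fixpoint => //.
- move=> X Y hY /(I_s If); rewrite eA => h.
  by apply/sC/(s_in (sC (pin _ hY))).
- move=> Y; case: (I_surj Y If) => X <-; rewrite -{2}eA => /(I_s' If) /sC h.
  by exists X.
Qed.

Lemma reversal_fixpoint f A B : I f -> A <> B -> f A = B -> hray B A (f B) ->
  exists2 M, s A B M & f M = M.
Proof.
move=> If nAB eA [/sC hB|hB]; first exact: reversal_fixpoint0.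
(* The remaining case has [f B] beyond [A]; then the inverse maps [B] to [A] and [A] into [s A B],
   and the first case applies to it. *)
have [g [Ig fK gK]] := I_inv If.
have eB : g B = A by rewrite -eA fK.
have [|M hM eM] := reversal_fixpoint0 Ig (nesym nAB) eB.
  by have := I_s Ig hB; rewrite eB fK => /sC.
by exists M; [exact: sC|rewrite -{1}eM gK].
Qed.

Lemma other_point (A : T) : exists B, A <> B.
Proof.
case: isplane => _ [C [D nCD]] _; have [e|] := EM (A = C); last by exists C.
by exists D; rewrite e.
Qed.

Lemma triangle_ex (A : T) : exists B C, noncol A B C.
Proof.
have [B nAB] := other_point A; have [C h] := off_ex (mline_line nAB).
by exists B, C.
Qed.

Lemma opp_ray A B C D : A <> B -> s B C A -> s B D A -> C <> A -> hray A C D.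
Proof.
move=> nAB hC hD nC; have [->|nD] := EM (D = A); first exact: hray_l.
have hl : line_in s (line A B) by case: (maxlineP nAB).
have lC : line A B C by apply/line_col => //; constructor 2; exact: sC.
have lD : line A B D by apply/line_col => //; constructor 2; exact: sC.
have [_ cut] := line_cut hl (line_l nAB) (line_r nAB) (nesym nAB).
case: (cut C D lC lD nC nD hC) => -[// _ h].
have lD' : line A C D by rewrite (line_eq nAB (nesym nC) (line_l nAB) lC).
by case: (hray_or (nesym nC) lD') => // /sC.
Qed.

Lemma opp_ray_s A B C D : A <> B -> A <> C -> s B C A -> hray A C D -> s B D A.
Proof.
move=> nAB nAC hC hD; have [->|nD] := EM (D = A); first exact: sr.
have hl : line_in s (line A B) by case: (maxlineP nAB).
have lC : line A B C by apply/line_col => //; constructor 2; exact: sC.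
have lD : line A B D by rewrite -(line_eq nAB nAC (line_l nAB) lC); exact: hray_sub_L.
have [_ cut] := line_cut hl (line_l nAB) (line_r nAB) (nesym nAB).
case: (cut C D lC lD (nesym nAC) nD hC) => -[// _ h].
by case: (hray_end nAC (hray_r _ _) hD h) => e; [case: nAC|case: nD].
Qed.

Lemma mline_int l X Y Z W : mline l -> ~ l X -> l Z -> l W -> s X Y Z -> s X Y W -> Z = W.
Proof.
move=> hl nX lZ lW hZ hW; apply: contrapT => nZW; apply: nX.
by case: (s_tot hZ hW) => h; [apply: (mline_out hl lZ lW nZW)|apply: (mline_out hl lW lZ
  (nesym nZW))]; exact: sC.
Qed.

Lemma mline_s l A B C : mline l -> l A -> l B -> A <> B -> s C B A -> l C.
Proof. by move=> hl lA lB n h; apply: (mline_out hl lB lA (nesym n)); exact: sC. Qed.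

Lemma opp_rays A B C X Y : A <> B -> A <> C -> s B C A -> hray A B X -> hray A C Y -> s X Y A.
Proof.
move=> nAB nAC h hX hY; have [->|nY] := EM (Y = A); first exact: sr.
have h' := opp_ray_s nAB nAC h hY.
by apply/sC/(opp_ray_s (A := A) _ nAB (sC h')) => //; exact: nesym.
Qed.

(** [f] reverses a line through [A] and exchanges its sides, so [f \o f] fixes a flag. For [X] off
    that line, the point [Z] where [s X (f X)] crosses it satisfies [f Z = Z], so [Z = A]: the
    motion acts alike on every line through [A]. *)
Lemma halfturn_ex A : exists f, [/\ I f, f A = A & forall X, s X (f X) A /\ f (f X) = X].
Proof.
have [B [P [nAB nP]]] := triangle_ex A.
have hl := mline_line nAB; set l := line A B in nP hl.
have [C hC nCA] := seg_extend (nesym nAB).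
have [Q oPQ] := half_opp hl nP.
have eC : line A C = l.
  by apply: line_eq => //; [exact: nesym|exact: line_l|apply/line_col => //; constructor 2;
    exact: sC].
have [|f [If fA fB fP]] := E_ex nAB nP (nesym nCA) (P' := Q).
  by rewrite -/l eC; case: oPQ.
rewrite eC in fP.
have im : f @` l = l by rewrite im_line // fA (hray_L (nesym nCA) _ fB) // -{1}fA; exact: I_ne.
have nfB : A <> f B by rewrite -{1}fA; exact: I_ne.
have s1 X : hray A B X -> s X (f X) A.
  move=> h; apply: (opp_rays nAB (nesym nCA) hC h).
  have := (I_hray A B X If).1 h; rewrite fA => h'.
  by rewrite -(hray_eq (nesym nCA) nfB fB).
have hffB : s (f B) (f (f B)) A.
  by have := I_s If (s1 B (hray_r _ _)); rewrite fA.
have RffB : hray A B (f (f B)) by apply: (opp_ray nfB (sC (s1 B (hray_r _ _))) hffB (nesym nAB)).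
have oP : opp l P (f P) by apply: (opp_same_trans hl oPQ).
have ff : f \o f = id.
  apply: (E_id (I_comp If If) nAB nP) => /=; first by rewrite fA.
    exact: RffB.
  apply: (opp_opp hl oP).
  by have := (I_opp l P (f P) If).1 oP; rewrite im.
have fK X : f (f X) = X by have := congr1 (fun h => h X) ff.
have on X : l X -> s X (f X) A.
  move=> lX; case: (hray_or nAB lX) => h; first exact: s1.
  have := I_s If h; rewrite fA => /sC h'.
  have [->|nX] := EM (X = A); first exact: sl.
  apply/sC/(opp_ray_s _ nfB (sC h')); first by rewrite -{1}fA; apply: I_ne => //; exact: nesym.
  by apply: (opp_ray nAB (s1 B (hray_r _ _)) (sC h)); exact: nesym.
exists f; split=> // X; split=> //.
have [lX|nX] := EM (l X); first exact: on.
have oX : opp l X (f X).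
  have [sPX|oPX] := same_opp_ex nP nX.
    apply: (same_opp_trans hl (same_sym sPX)); apply: (opp_same_trans hl oP).
    by have := (I_same l P X If).1 sPX; rewrite im.
  apply: (opp_same_trans hl (opp_sym oPX)); apply: (opp_opp hl oP).
  by have := (I_opp l P X If).1 oPX; rewrite im.
have [_ _ [Z lZ sZ]] := oX.
have lfZ : l (f Z) by rewrite -im; exists Z.
have := I_s If sZ; rewrite fK => /sC /(mline_int hl nX lZ lfZ sZ) e.
by have := on Z lZ; rewrite -e => /sxx ->.
Qed.

Definition hturn A : T -> T := @xget {classic T -> T} id
  [set f : T -> T | [/\ I f, f A = A & forall X, s X (f X) A /\ f (f X) = X]].

Lemma hturnP A : [/\ I (hturn A), hturn A A = A & forall X, s X (hturn A X) A /\ hturn A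
  (hturn A X) = X].
Proof.
have [f hf] := halfturn_ex A.
exact: (@xgetI {classic T -> T} id
  [set f : T -> T | [/\ I f, f A = A & forall X, s X (f X) A /\ f (f X) = X]] f hf).
Qed.

Lemma I_hturn A : I (hturn A). Proof. by case: (hturnP A). Qed.
Hint Resolve I_hturn : core.
Lemma hturn_A A : hturn A A = A. Proof. by case: (hturnP A). Qed.
Lemma hturn_s A X : s X (hturn A X) A. Proof. by case: (hturnP A) => _ _ /(_ X)[]. Qed.
Lemma hturnK A X : hturn A (hturn A X) = X. Proof. by case: (hturnP A) => _ _ /(_ X)[]. Qed.

Lemma hturn_fix A X : hturn A X = X -> X = A.
Proof. by move=> e; have := hturn_s A X; rewrite e => /sxx ->. Qed.

Lemma hturn_ne A X : X <> A -> hturn A X <> A.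
Proof. by move=> n e; apply: n; rewrite -(hturnK A X) e hturn_A. Qed.

Lemma hturn_ml A l X : mline l -> l A -> l X -> l (hturn A X).
Proof.
move=> hl lA lX; have [->|n] := EM (X = A); first by rewrite hturn_A.
exact: (mline_out hl lX lA n (hturn_s A X)).
Qed.

Lemma hturn_mlE A l X : mline l -> l A -> l (hturn A X) <-> l X.
Proof. by move=> hl lA; split; [rewrite -{2}(hturnK A X)|]; exact: hturn_ml. Qed.

Lemma hturn_opp A l X : mline l -> l A -> ~ l X -> opp l X (hturn A X).
Proof.
move=> hl lA nX; split=> //; first by rewrite hturn_mlE.
by exists A => //; exact: hturn_s.
Qed.

Lemma hturn_uniq f A B P : I f -> A <> B -> ~ line A B P -> f A = A -> s B (f B) A ->
  opp (line A B) P (f P) -> f = hturn A.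
Proof.
move=> If nAB nP fA fB fP; have nfB : A <> f B by rewrite -{1}fA; exact: I_ne.
have lfB : line A B (f B) by apply/line_col => //; constructor 2; exact: sC.
apply: (E_uniq If (I_hturn A) nAB nP); first by rewrite hturn_A.
  by rewrite fA; apply: (opp_ray nAB fB (hturn_s _ _)); exact: nesym.
rewrite fA (line_eq nAB nfB (line_l nAB) lfB).
apply: (opp_opp (mline_line nAB) (opp_sym fP)); exact: hturn_opp (mline_line nAB) (line_l nAB) nP.
Qed.

(** * Reflections, perpendiculars and midpoints *)

(** A motion fixing [A] preserves the order on the ray, and an order-preserving involution moves no
    point. *)
Lemma inv_fix f A B X : A <> B -> hray A B X -> hray A B (f X) -> I f -> f A = A -> f (f X) = X ->
  f X = X.
Proof.
move=> nAB h1 h2 If fA ffX; case: (hray_tot nAB h1 h2) => /[dup] h /(I_s If); rewrite fA ffX.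
  by move/s_anti => /(_ h).
by move=> h'; exact: esym (s_anti h' h).
Qed.

Lemma refl_ex l : mline l -> exists f,
  [/\ I f, forall X, l X -> f X = X & forall X, ~ l X -> opp l X (f X)].
Proof.
move=> hl; have [A [B [nAB lA lB el]]] := mline_pt hl.
have [P nP] := off_ex hl; have [Q oPQ] := half_opp hl nP.
have nQ : ~ l Q by case: oPQ.
have [||f [If fA fB fP]] := @E_ex A B P A B Q nAB _ nAB; rewrite -?el //.
rewrite -el in fP.
have nfB : A <> f B by rewrite -{1}fA; exact: I_ne.
have im : f @` l = l by rewrite el im_line // fA (hray_L nAB nfB fB).
have oP : opp l P (f P) by exact: opp_same_trans fP.
have ffB : hray A B (f (f B)).
  by rewrite -(hray_eq nAB nfB fB); have := (I_hray A B (f B) If).1 fB; rewrite fA.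
have ff : f \o f = id.
  apply: (E_id (A := A) (B := B) (P := P) (I_comp If If) nAB) => /=; rewrite -?el ?fA //.
  apply: (opp_opp hl oP).
  by have := (I_opp l P (f P) If).1 oP; rewrite im.
have fK X : f (f X) = X by have := congr1 (fun h => h X) ff.
have fR C X : l C -> A <> C -> f C = C -> hray A C X -> f X = X.
  move=> lC nAC fC h; apply: (inv_fix nAC h) => //.
  by have := (I_hray A C X If).1 h; rewrite fA fC.
have eB : f B = B by apply: (inv_fix nAB).
exists f; split=> // X hX.
  have [RX|sX] : hray A B X \/ s X B A by apply: hray_or => //; rewrite -el.
    exact: fR RX.
  have [->//|/nesym nX] := EM (X = A).
  apply: (inv_fix nX) => //.
  apply: (opp_ray nAB (sC sX) _ (nesym nX)).
  by have := I_s If sX; rewrite fA eB => /sC.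
have [sPX|oPX] := same_opp_ex nP hX.
  apply: (same_opp_trans hl (same_sym sPX)); apply: (opp_same_trans hl oP).
  by have := (I_same l P X If).1 sPX; rewrite im.
apply: (opp_same_trans hl (opp_sym oPX)); apply: (opp_opp hl oP).
by have := (I_opp l P X If).1 oPX; rewrite im.
Qed.

Definition refl (l : set T) : T -> T := @xget {classic T -> T} id
  [set f : T -> T | [/\ I f, forall X, l X -> f X = X & forall X, ~ l X -> opp l X (f X)]].

Lemma reflP l : mline l ->
  [/\ I (refl l), forall X, l X -> refl l X = X & forall X, ~ l X -> opp l X (refl l X)].
Proof.
move=> /refl_ex[f hf]; exact: (@xgetI {classic T -> T} id
  [set f : T -> T | [/\ I f, forall X, l X -> f X = X & forall X, ~ l X -> opp l X (f X)]] f hf).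
Qed.

Lemma I_refl l : mline l -> I (refl l). Proof. by case/reflP. Qed.
Lemma refl_fix l X : mline l -> l X -> refl l X = X. Proof. by case/reflP => _ h _; exact: h. Qed.
Lemma refl_opp l X : mline l -> ~ l X -> opp l X (refl l X). Proof. by case/reflP => _ _;
  exact. Qed.

Lemma refl_fixE l X : mline l -> refl l X = X <-> l X.
Proof.
move=> hl; split; last exact: refl_fix.
move=> e; apply: contrapT => /(refl_opp hl); rewrite e.
by case=> nX _ [Z lZ /sxx e']; apply: nX; rewrite -e'.
Qed.

Lemma refl_uniq f l A B P : I f -> mline l -> l A -> l B -> A <> B -> f A = A -> f B = B ->
  opp l P (f P) -> f = refl l.
Proof.
move=> If hl lA lB nAB fA fB oP; have nP : ~ l P by case: oP.
have el := mline_eq hl nAB lA lB.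
apply: (E_uniq (A := A) (B := B) (P := P) If (I_refl hl) nAB);
  rewrite ?fA ?fB ?(refl_fix hl lA) ?(refl_fix hl lB) -?el //.
exact: (opp_opp hl (opp_sym oP) (refl_opp hl nP)).
Qed.

Lemma two_fix f A B P : I f -> noncol A B P -> f A = A -> f B = B ->
  f = id \/ f = refl (line A B).
Proof.
move=> If [nAB nP] fA fB; have hl := mline_line nAB.
have nfP : ~ line A B (f P) by have := nP; rewrite (I_line _ If nAB) fA fB.
have [sP|oP] := same_opp_ex nP nfP.
  by left; apply: (E_id If nAB nP); rewrite ?fB.
by right; apply: (refl_uniq If hl (line_l nAB) (line_r nAB) nAB fA fB oP).
Qed.

Lemma refl_im l : mline l -> refl l @` l = l.
Proof.
move=> hl; apply/seteqP; split=> X; first by move=> [Y lY <-]; rewrite refl_fix.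
by move=> lX; exists X; rewrite ?refl_fix.
Qed.

Lemma reflK l X : mline l -> refl l (refl l X) = X.
Proof.
move=> hl; have [A [B [nAB lA lB el]]] := mline_pt hl.
have [P nP] := off_ex hl.
suff ff : refl l \o refl l = id by have := congr1 (fun h => h X) ff.
apply: (E_id (A := A) (B := B) (P := P) (I_comp (I_refl hl) (I_refl hl)) nAB) => /=;
  rewrite -?el ?(refl_fix hl lA) ?(refl_fix hl lB) ?(refl_fix hl lA) //.
have o := refl_opp hl nP; apply: (opp_opp hl o).
by have := (I_opp l P (refl l P) (I_refl hl)).1 o; rewrite refl_im.
Qed.

Lemma refl_inj l m : mline l -> mline m -> refl l = refl m -> l = m.
Proof.
by move=> hl hm e; apply/seteqP; split=> X; rewrite -(refl_fixE _ hl) -(refl_fixE _ hm) e.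
Qed.

Lemma refl_conj f l X : I f -> mline l -> refl (f @` l) (f X) = f (refl l X).
Proof.
move=> If hl; have [g [Ig fK gK]] := I_inv If.
suff -> : refl (f @` l) = f \o refl l \o g by rewrite /= fK.
have [A [B [nAB lA lB el]]] := mline_pt hl; have [P nP] := off_ex hl.
apply/esym; apply: (refl_uniq (A := f A) (B := f B) (P := f P)) => /=;
  rewrite ?fK ?(refl_fix hl lA) ?(refl_fix hl lB) //.
- exact: (I_comp If (I_comp (I_refl hl) Ig)).
- exact: im_mline.
- by exists A.
- by exists B.
- exact: I_ne.
- by apply: (I_opp l P (refl l P) If).1; exact: refl_opp.
Qed.

(** Commuting reflections make the relation visibly symmetric. It amounts to invariance of one line
    under the reflection in the other ([perp_im], [im_perp]) and to right angles in the sense of the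
    measure ([right_angleP]). *)
Definition perp l m := [/\ mline l, mline m, l <> m & forall X, refl l (refl m X) = refl m
  (refl l X)].

Lemma perp_sym l m : perp l m -> perp m l.
Proof. by case=> a b c d; split=> //; exact: nesym. Qed.

Lemma perp_in l m X : perp l m -> m X -> m (refl l X).
Proof. by move=> [hl hm _ h] mX; apply/(refl_fixE _ hm); rewrite -h (refl_fix hm mX). Qed.

Lemma perp_im l m : perp l m -> refl l @` m = m.
Proof.
move=> h; have [hl _ _ _] := h; apply/seteqP; split=> X.
  by move=> [Y mY <-]; exact: perp_in.
by move=> mX; exists (refl l X); [exact: perp_in|exact: reflK].
Qed.

Lemma im_perp l m : mline l -> mline m -> l <> m -> refl l @` m = m -> perp l m.
Proof.
move=> hl hm n e; split=> // X.
by rewrite -(refl_conj _ (I_refl hl) hm) e.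
Qed.

Lemma I_perp f l m : I f -> perp l m -> perp (f @` l) (f @` m).
Proof.
move=> If [hl hm n h]; split; [exact: im_mline|exact: im_mline| |].
  move=> e; apply: n; apply/seteqP; split=> X; first by move/(im_mem _ _ If); rewrite e =>
    /im_mem; exact.
  by move/(im_mem _ _ If); rewrite -e => /im_mem; exact.
by move=> X; have [Y <-] := I_surj X If; rewrite !refl_conj // h.
Qed.

Lemma mline_diff l m : mline l -> mline m -> l <> m -> exists2 X, m X & ~ l X.
Proof.
move=> hl hm n; apply: contrapT => no.
have sub X : m X -> l X by move=> mX; apply: contrapT => nX; apply: no; exists X.
by apply: n; have [A [B [nAB mA mB _]]] := mline_pt hm; apply: (mline_eq2 hl hm nAB) => //;
  exact: sub.
Qed.

Lemma mline_one l m X Y : mline l -> mline m -> l <> m -> l X -> m X -> l Y -> m Y -> X = Y.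
Proof. by move=> hl hm n *; apply: contrapT => nXY; apply: n; apply: (mline_eq2 hl hm nXY). Qed.

Lemma perp_meet l m : perp l m -> exists P, l P /\ m P.
Proof.
move=> h; have [hl hm n _] := h; have [X mX nX] := mline_diff hl hm n.
have [_ _ [Z lZ sZ]] := refl_opp hl nX.
by exists Z; split=> //; apply: mline_seg sZ => //; exact: perp_in.
Qed.

Lemma perp_hturn l m P X : perp l m -> l P -> m P -> refl l (refl m X) = hturn P X.
Proof.
move=> h lP mP; have [hl hm n _] := h; have hs := perp_sym h.
suff -> : hturn P = refl l \o refl m by [].
have [B [nPB lB el]] := mline_pt2 hl lP; have [Q [nPQ mQ em]] := mline_pt2 hm mP.
have nQ : ~ l Q by move=> lQ; apply: nPQ; exact: (mline_one hl hm n).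
have nB : ~ m B by move=> mB; apply: nPB; exact: (mline_one hl hm n).
apply/esym; apply: (hturn_uniq (A := P) (B := B) (P := Q)) => //=.
- exact: I_comp (I_refl hl) (I_refl hm).
- by rewrite -el.
- by rewrite !refl_fix.
- rewrite (refl_fix hl (perp_in hs lB)); have [_ _ [Z mZ sZ]] := refl_opp hm nB.
  by rewrite (mline_one hl hm n lP mP _ mZ) //; apply: (mline_seg hl) sZ => //; exact: perp_in.
- by rewrite -el (refl_fix hm mQ); exact: refl_opp.
Qed.

(** Off [l], a perpendicular through [P] joins [P] to its mirror image. On [l], the reflection in it
    is the product of [refl l] and the half-turn about [P]. *)
Lemma perp_uniq l m m' P : perp l m -> perp l m' -> m P -> m' P -> m = m'.
Proof.
move=> h h' mP mP'; have [hl hm n _] := h; have [_ hm' n' _] := h'.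
have [lP|nP] := EM (l P); last first.
  apply: (mline_eq2 hm hm' (A := P) (B := refl l P)) => //; try exact: perp_in.
  by move=> e; apply: nP; apply/(refl_fixE _ hl).
apply: refl_inj => //; apply/funext => X.
by rewrite -[LHS](reflK _ hl) -[RHS](reflK _ hl) (perp_hturn X h lP mP) (perp_hturn X h' lP mP').
Qed.

(** [f] reverses [l] at [M] and keeps its sides, so it is an involution; it fixes [M] and a point
    off [l], found on the segment from [P] to [f P], hence it is the reflection in the line joining
    them. *)
Lemma perp_at l M : mline l -> l M -> exists2 m, m M & perp l m.
Proof.
move=> hl lM; have [B [nMB lB el]] := mline_pt2 hl lM; have [P nP] := off_ex hl.
have [C hC nC] := seg_extend (nesym nMB).
have lC : l C by apply: (mline_out hl lB lM (nesym nMB)).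
have eC : line M C = l by rewrite (mline_eq hl (nesym nC) lM lC).
have [||f [If fM fB fP]] := @E_ex M B P M C P nMB _ (nesym nC); rewrite -?el ?eC //.
rewrite eC in fP.
have nfB : M <> f B by rewrite -{1}fM; exact: I_ne.
have im : f @` l = l by rewrite {1}el im_line // fM (hray_L (nesym nC) nfB fB).
have ofB : s B (f B) M by apply: (opp_ray_s nMB (nesym nC)).
have ff : f \o f = id.
  apply: (E_id (A := M) (B := B) (P := P) (I_comp If If) nMB) => /=; rewrite -?el ?fM //.
    by apply: (opp_ray nfB (sC ofB) _ (nesym nMB)); have := I_s If ofB; rewrite fM.
  apply: (same_trans hl fP).
  by have := (I_same l P (f P) If).1 fP; rewrite im.
have fK X : f (f X) = X by have := congr1 (fun h => h X) ff.
have [N nN fN] : exists2 N, ~ l N & f N = N.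
  have [e|nPf] := EM (P = f P); first by exists P.
  have [|N hN fN] := reversal_fixpoint If nPf (erefl _); first by rewrite fK; exact: hray_r.
  exists N => // lN; case: fP => _ _ /(_ N lN); exact.
have nMN : M <> N by move=> e; subst N.
have [|e|e] := @two_fix f M N B If _ fM fN.
- by apply/noncol_rot; split=> //; rewrite -el.
- by move: ofB; rewrite e => /sxx.
exists (line M N); first exact: line_l.
apply/perp_sym/im_perp => //; first exact: mline_line.
  by move=> e'; apply: nN; rewrite -e'; exact: line_r.
by rewrite -e.
Qed.

Lemma perp_from l P : mline l -> ~ l P -> exists2 m, m P & perp l m.
Proof.
move=> hl nP; have n : P <> refl l P by move=> e; apply: nP; apply/(refl_fixE _ hl).
exists (line P (refl l P)); first exact: line_l.
apply: im_perp => //; first exact: mline_line.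
  by move=> e; apply: nP; rewrite e; exact: line_l.
by rewrite (im_line (I_refl hl)) // reflK // line_comm.
Qed.

Lemma perp_ex l P : mline l -> exists2 m, m P & perp l m.
Proof. by move=> hl; case: (EM (l P)); [exact: perp_at|exact: perp_from]. Qed.

(** The motion [f] exchanges the rays [AB] and [BA] and keeps the sides of the line, so it reverses
    the segment and fixes a point [M]; the half-turn about [M] is [f] after the reflection in the
    line. *)
Lemma midpoint A B : A <> B -> exists2 M, s A B M & hturn M A = B.
Proof.
move=> nAB; have [P nP] := off_ex (mline_line nAB).
have tBA : ~ line B A P by rewrite line_comm.
have [f [If fA fB fP]] := E_ex nAB nP (nesym nAB) tBA.
have [M hM fM] := reversal_fixpoint If nAB fA fB.
exists M => //; have hl := mline_line nAB; rewrite line_comm // in fP.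
have nMA : M <> A by move=> e; move: fM; rewrite e fA => /esym.
have nMB : M <> B by move=> e; move: fM; rewrite e => fB'; apply: nAB; apply: (I_inj If);
  rewrite fA.
have lM : line A B M by exact: line_seg.
have el : line M A = line A B by apply: line_eq => //; exact: line_l.
suff -> : hturn M = f \o refl (line A B) by rewrite /= (refl_fix hl (line_l nAB)).
apply/esym; apply: (hturn_uniq (A := M) (B := A) (P := P)) => //=.
- exact: I_comp If (I_refl hl).
- by rewrite el.
- by rewrite (refl_fix hl lM).
- by rewrite (refl_fix hl (line_l nAB)) fA.
rewrite el; have o := refl_opp hl nP.
have im : f @` line A B = line A B.
  have nfB : B <> f B by rewrite -{1}fA; exact: I_ne.
  by rewrite (im_line If nAB) fA (hray_L (nesym nAB) nfB fB) (line_comm nAB).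
by have := (I_opp (line A B) P (refl (line A B) P) If).1 o; rewrite im; exact: same_opp_trans.
Qed.

(** * Isosceles triangles *)

Lemma noncol_cyc A B C : noncol A B C -> noncol B C A.
Proof. by move=> t; exact: noncol_rot (noncol_sym t). Qed.

Lemma noncol_apex A B C X : noncol A B C -> s B C X -> X <> A.
Proof. by move=> /noncol_cyc[n h] hX e; subst X; apply: h; exact: line_seg. Qed.

Lemma ray_meet A B C Z W : noncol A B C -> s B C Z -> s B C W -> hray A Z W -> Z = W.
Proof.
move=> t hZ hW h; have [nAB nAC nBC] := noncol_ne t.
have off X : s B C X -> X <> A by exact: noncol_apex.
apply: contrapT => nZW.
have : line Z W A.
  by apply/line_col => //; case: h => h; [constructor 3; exact: sC|constructor 2].
have lZ := line_seg nBC hZ; have lW := line_seg nBC hW.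
rewrite (line_eq nBC nZW lZ lW) => lA.
by case: (noncol_cyc t) => _; apply.
Qed.

Lemma hray_join A U V X : A <> U -> A <> V -> A <> X -> hray A U X -> hray A V X -> hray A U V.
Proof.
by move=> nU nV nX hU hV; rewrite -(hray_eq nU nX hU); exact: hray_sym.
Qed.

(* [f] followed by the projection from [A] is a decreasing map of [s B C] into
   itself; a fixed point of it spans with [A] a line in which [f] reflects. *)
Lemma flip_inner f A B C : noncol A B C -> I f -> f A = A -> f B = C ->
  same (line A C) B (f C) -> same (line A B) C (f C) -> f C = B.
Proof.
move=> t If fA fB s1 s2; have [nAB nAC nBC] := noncol_ne t.
have nA X : X <> A -> f X <> A by move=> n; rewrite -fA; exact: I_ne.
have off X : s B C X -> X <> A by exact: noncol_apex.
have tC : noncol A C (f C) by split=> //; case: s1.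
have tR X : s B C X -> X <> B -> noncol A B X.
  move=> hX nX; apply: noncol_sym; apply: noncol_rot; apply: (noncol_R (noncol_cyc t)) => //.
  by left.
have tf X : s B C X -> X <> B -> noncol A C (f X).
  move=> hX nX; have [h1 h2] := tR _ hX nX; rewrite -{1}fA -fB; split; first exact: I_ne.
  by rewrite -I_line.
have [Z0 hZ0 rZ0] : exists2 Z, s B C Z & hray A (f C) Z by exact: crossbar.
have ex X : exists Z, s B C X -> s B C Z /\ hray A Z (f X).
  have [hX|] := EM (s B C X); last by exists X.
  have hfX : s C (f C) (f X) by rewrite -{1}fB; exact: I_s.
  have nZ0 := off _ hZ0.
  have [X' sX' rX'] := crossbar_seg tC hfX (hray_r _ _) rZ0 (nesym nAC) nZ0.
  exists X' => _; split; last exact: hray_sym.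
  exact: s_sub (sr _ _) hZ0 sX'.
have [p hp] := choice ex.
have pE X Y : s B C X -> s B C Y -> hray A Y (f X) -> p X = Y.
  move=> hX hY r; have [h1 h2] := hp _ hX; apply: (ray_meet t) => //.
  by apply: (hray_join _ _ _ h2 r); apply: nesym; [exact: off|exact: off|apply: nA; exact: off].
have pin X (hX : s B C X) := (hp X hX).1.
have pr X (hX : s B C X) := (hp X hX).2.
have pB : p B = C by apply: pE => //; rewrite fB; exact: hray_r.
have [X Y hY hXY|Y hY|M hM eM] := decreasing_fixpoint nBC pin pB.
- have hX := s_tr hY hXY.
  have [e|nYB] := EM (Y = B); first by subst Y; rewrite (sxx hXY).
  have hf : s C (f Y) (f X) by rewrite -fB; exact: I_s.
  have [X' sX' rX'] := crossbar_seg (tf _ hY nYB) hf (hray_r _ _) (hray_sym (pr _ hY)) (nesym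
    nAC) (off _ (pin _ hY)).
  have hX' : s B C X' by apply: s_sub (sr _ _) (pin _ hY) sX'.
  rewrite (pE _ _ hX hX' (hray_sym rX')).
  exact/sC/(s_in (sC (pin _ hY)) sX').
- have hC := pin _ (sr B C).
  have hY' : s B C Y by apply: s_sub hC (sr _ _) hY.
  have tpC : noncol A C (p C).
    have n : p C <> C.
      move=> e; have := pr _ (sr B C); rewrite e => r.
      by case: tC => _; apply; exact: hray_sub_L.
    apply: noncol_rot; apply: (noncol_R (B := f C)); first exact: noncol_rot.
      by apply: hray_sym; apply: pr.
    exact: off.
  have [X' sX' rX'] := crossbar_seg tpC (sC hY) (hray_r _ _) (pr _ (sr B C)) (nesym nAC) (nA _
    (nesym nAC)).
  have [X eX] := I_surj X' If; rewrite -{1}fB -eX in sX'.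
  have hX := I_s' If sX'; exists X => //.
  by apply: pE => //; rewrite eX.
have rM : hray A M (f M) by rewrite -{1}eM; exact: pr.
have nMA := off _ hM.
have nMB : M <> B.
  by move=> e; subst M; case: t => _; apply; rewrite -fB; exact: hray_sub_L.
have nMC : M <> C.
  by move=> e; subst M; case: tC => _; apply; exact: hray_sub_L.
have nAM := nesym nMA; have hl := mline_line nAM; set l := line A M in hl.
have lB : ~ l B by case: (noncol_rot (tR _ hM nMB)).
have oBC : opp l B C by apply: (seg_opp hl (line_r nAM)) => //; exact: nesym.
have im : f @` l = l.
  by rewrite im_line // fA (hray_L nAM _ rM) // -{1}fA; exact: I_ne.
have ff : f \o f = id.
  apply: (E_id (A := A) (B := M) (P := B) (I_comp If If) nAM lB) => /=; first by rewrite !fA.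
    rewrite -(hray_eq nAM _ rM); last by rewrite -{1}fA; exact: I_ne.
    by have := (I_hray A M (f M) If).1 rM; rewrite fA.
  apply: (opp_opp hl oBC).
  by have := (I_opp l B C If).1 oBC; rewrite im fB.
by have := congr1 (fun h => h B) ff; rewrite /= fB.
Qed.

(** Three positions of [f C]. On the line [AB], the square of [f] fixes a flag; on the side of [C],
    this is [flip_inner]; otherwise the ray [AB] runs inside the angle of [C] and [f C], and
    [flip_inner] applies to the inverse of [f] with [B] and [C] exchanged. *)
Lemma iso_flip f A B C : noncol A B C -> I f -> f A = A -> f B = C ->
  same (line A C) B (f C) -> f C = B.
Proof.
move=> t If fA fB s1; have [nAB nAC nBC] := noncol_ne t.
have hAC := mline_line nAC; have hAB := mline_line nAB.
have imB : f @` line A B = line A C by rewrite im_line // fA fB.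
have imC : f @` line A C = line A (f C) by rewrite im_line // fA.
have nfC : A <> f C by rewrite -{1}fA; exact: I_ne.
have nC : ~ line A B C by case: t.
have [hC|nfCAB] := EM (line A B (f C)).
  have rC : hray A B (f C) by apply: (hray_pt hAC (line_l nAC)) => //; case: (noncol_rot t).
  have ff : f \o f = id.
    apply: (E_id (A := A) (B := B) (P := C) (I_comp If If) nAB nC) => /=; first by rewrite !fA.
      by rewrite fB.
    apply: (ray_same hAB (line_l nAB) nC); last by rewrite -fA; apply: I_ne => //; exact: nesym.
    by have := (I_hray A B (f C) If).1 rC; rewrite fA fB.
  by have := congr1 (fun h => h B) ff; rewrite /= fB.
have [s2|o2] := same_opp_ex nC nfCAB; first exact: (flip_inner t If fA fB s1 s2).
have [g [Ig fK gK]] := I_inv If.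
have gA : g A = A by rewrite -{1}fA fK.
have gC : g C = B by rewrite -fB fK.
suff : g B = C by move=> e; rewrite -e gK.
have [_ _ [Z lZ sZ]] := o2.
have nZC : Z <> C by move=> e; subst Z.
have nZfC : Z <> f C by move=> e; subst Z.
have tC : noncol A C (f C) by split=> //; case: s1.
have [s3 s4] := inner_same tC sZ nZC nZfC.
have rZ : hray A B Z.
  apply: (hray_pt hAC (line_l nAC)) => //; first by case: (noncol_rot t).
  exact: same_trans hAC s1 s3.
have nZA : Z <> A by move=> e; subst Z; case: s3 => _ + _; case; exact: line_l.
have s5 : same (line A (f C)) B C.
  apply: (same_trans (mline_line nfC) _ (same_sym s4)).
  apply: same_sym; apply: (ray_same (mline_line nfC) (line_l nfC)); last exact: nesym.
    by case: s4.
  exact: hray_sym.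
apply: (flip_inner (noncol_rot t) Ig gA gC).
  by apply/(I_same (line A B) C (g B) If); rewrite imB gK; exact: same_sym.
by apply/(I_same (line A C) B (g B) If); rewrite imC gK fB; exact: same_sym.
Qed.

(** [f] is the reflection in the bisector of the angle at [A]: it carries the flag of [AB] and [C]
    to that of [AC] and [B], and it is an involution by [iso_flip]. *)
Lemma flip_ex A B C : noncol A B C -> exists f,
  [/\ I f, f A = A, hray A C (f B), f (f B) = B & forall X, f (f X) = X].
Proof.
move=> t; have [nAB nAC nBC] := noncol_ne t.
have [f [If fA fB fC]] := E_ex nAB t.2 nAC (noncol_rot t).2.
have nfB : A <> f B by rewrite -{1}fA; exact: I_ne.
have eL : line A (f B) = line A C by exact: hray_L.
have t' : noncol A B (f B).
  by apply: noncol_rot; apply: (noncol_R (noncol_rot t)) => //; exact: nesym.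
have rf : hray A (f C) (f (f B)).
  by have := (I_hray A C (f B) If).1 fB; rewrite fA.
have e : f (f B) = B.
  apply: (iso_flip t' If fA erefl); rewrite eL.
  apply: (same_trans (mline_line nAC) fC); apply: (ray_same (mline_line nAC) (line_l nAC)) => //.
    by case: fC.
  by rewrite -fA; apply: I_ne => //; exact: nesym.
exists f; split=> // X.
suff ff : f \o f = id by have := congr1 (fun h => h X) ff.
apply: (E_id (A := A) (B := B) (P := C) (I_comp If If) nAB t.2) => /=; first by rewrite !fA.
  by rewrite e.
have s1 : same (line A B) (f B) C.
  by apply: same_sym; apply: (ray_same (mline_line nAB) (line_l nAB) t.2) => //; exact: nesym.
have im : f @` line A B = line A (f B) by rewrite im_line // fA.
have im' : f @` line A C = line A B by rewrite -eL im_line // fA e.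
have := (I_same (line A B) (f B) C If).1 s1; rewrite im eL e => s2.
have := (I_same (line A C) B (f C) If).1 s2; rewrite im' => s3.
exact: same_trans (mline_line nAB) (same_sym s1) s3.
Qed.

(** * Translations and rectangles *)

Lemma hturn2_same l M N X : mline l -> l M -> l N -> ~ l X -> same l X (hturn M (hturn N X)).
Proof.
move=> hl lM lN nX; have nHX : ~ l (hturn N X) by rewrite hturn_mlE.
exact: opp_opp hl (hturn_opp hl lN nX) (hturn_opp hl lM nHX).
Qed.

(** A fixed point [P] gives another one, [hturn N P = hturn M P]. Unless they coincide, they span a
    line through [M] and [N] whose sides are kept, so the product is the identity, which forces
    [M = N]. *)
Lemma hturn2_nofix M N P : M <> N -> hturn M (hturn N P) <> P.
Proof.
move=> nMN e; have eQ : hturn N P = hturn M P by rewrite -{2}e hturnK.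
have [ePQ|nPQ] := EM (P = hturn N P).
  by apply: nMN; rewrite -(hturn_fix (esym ePQ)); apply/esym/hturn_fix; rewrite -eQ.
have hl := mline_line nPQ; set l := line P (hturn N P) in hl.
have lN : l N by apply: line_seg => //; exact: hturn_s.
have lM : l M by apply: line_seg => //; rewrite eQ; exact: hturn_s.
have [X nX] := off_ex hl.
have ff : hturn M \o hturn N = id.
  apply: (E_id (A := P) (B := hturn N P) (P := X) _ nPQ nX) => //=.
  - exact: I_comp.
  - by rewrite hturnK -eQ; exact: hray_r.
  - exact: hturn2_same.
have := congr1 (fun h => h N) ff; rewrite /= hturn_A => /hturn_fix.
exact: nesym.
Qed.

Lemma hturn_inj M N A : hturn M A = hturn N A -> M = N.
Proof.
move=> e; apply: contrapT => n; apply: (hturn2_nofix (P := hturn N A) n).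
by rewrite hturnK.
Qed.

(** With [N] the midpoint of [R0] and its image [R1] under [t = hturn P \o hturn Q], the motions [t]
    and [hturn N \o hturn R0] agree on a flag. They move [R1] in the same direction, since otherwise
    [t] would reverse [s R0 R1] and have a fixed point. *)
Lemma hturn3 a P Q R0 : mline a -> a P -> a Q -> a R0 ->
  exists2 N, a N & forall X, hturn P (hturn Q (hturn R0 X)) = hturn N X.
Proof.
move=> ha aP aQ aR; have [ePQ|nPQ] := EM (P = Q).
  by exists R0 => // X; rewrite ePQ hturnK.
pose t := hturn P \o hturn Q; set R1 := t R0.
have nR : R0 <> R1 by apply: nesym; exact: hturn2_nofix.
have aR1 : a R1 by do 2 apply: hturn_ml => //.
have [N hN eN] := midpoint nR; have aN := mline_seg ha aR aR1 hN.
exists N => // X; have [Y nY] := off_ex ha.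
have ea := mline_eq ha nR aR aR1; have ea' := mline_eq ha (nesym nR) aR1 aR.
have It : I t by exact: I_comp.
suff et : t = hturn N \o hturn R0.
  by have := congr1 (fun h => h (hturn R0 X)) et; rewrite /= hturnK.
have nt : t R1 <> R1 by exact: hturn2_nofix.
apply: (E_uniq (A := R0) (B := R1) (P := Y) It _ nR) => /=; rewrite -?ea //.
- exact: I_comp.
- by rewrite hturn_A eN.
- rewrite -/R1.
  have h1 : s R0 (hturn N (hturn R0 R1)) R1.
    by have := I_s (I_hturn N) (hturn_s R0 R1); rewrite -{1}eN hturnK eN.
  have h2 : s R0 (t R1) R1.
    have : line R1 R0 (t R1) by rewrite -ea'; do 2 apply: hturn_ml => //.
    move/(hray_or (nesym nR)) => [h|/sC //].
    have [M _ /hturn2_nofix] := reversal_fixpoint It nR (erefl _) h.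
    by case.
  exact: (opp_ray (nesym nR) h2 h1 nt).
have -> : line (t R0) (t R1) = a.
  by apply/esym; apply: mline_eq => //; [exact: nesym|do 2 apply: hturn_ml => //].
apply: (same_trans ha (same_sym _) (hturn2_same ha aN aR nY)).
exact: hturn2_same.
Qed.

Lemma perp_hturn2 l x y P Q X : perp l x -> perp l y -> l P -> l Q -> x P -> y Q ->
  hturn P (hturn Q X) = refl x (refl y X).
Proof.
move=> hx hy lP lQ xP yQ; have [hl _ _ _] := hx.
by rewrite -(perp_hturn _ (perp_sym hx) xP lP) -(perp_hturn _ hy lQ yQ) reflK.
Qed.

(** * Rectangles and glide reflections *)

Definition rectangle := exists a b c d,
  [/\ perp a b, perp a d, perp c b, perp c d & a <> c /\ b <> d].

Lemma perp_disj l x y X : perp l x -> perp l y -> x <> y -> x X -> y X -> False.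
Proof. by move=> hx hy n xX yX; apply: n; apply: (perp_uniq hx hy xX). Qed.

(* With [Y] the foot on the axis of a point [X] of [m], the translation is the
   product of the reflections in the perpendiculars [b] and [y], [y] through [X];
   hence [b] exchanges [X] with its image and is perpendicular to [m] too. *)
Lemma two_axes M N m : M <> N -> mline m -> (forall X, m X -> m (hturn M (hturn N X))) ->
  m <> line M N -> rectangle.
Proof.
move=> nMN hm mt nml; have hl := mline_line nMN; set l := line M N in nml hl.
have lM : l M by exact: line_l. have lN : l N by exact: line_r.
have dis X : m X -> l X -> False.
  move=> mX lX; apply: nml; apply: (mline_eq2 hm hl (A := X) (B := hturn M (hturn N X))) => //.
  - by apply: nesym; exact: hturn2_nofix.
  - exact: mt.
  - by do 2 apply: hturn_ml => //.
have [X [_ [_ mX _ _]]] := mline_pt hm.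
have nX : ~ l X by move/(dis _ mX).
have [y yX ply] := perp_from hl nX; have [Y [lY yY]] := perp_meet ply.
have [K lK eK] := hturn3 hl lM lN lY.
have [b bK plb] := perp_at hl lK.
have et Z : hturn M (hturn N Z) = refl b (refl y Z).
  by rewrite -(perp_hturn2 _ plb ply lK lY bK yY) -eK hturnK.
have [_ hb _ _] := plb; have [_ hy _ _] := ply.
have bX : refl b X = hturn M (hturn N X) by rewrite et (refl_fix hy yX).
have nbX : refl b X <> X by rewrite bX; exact: hturn2_nofix.
have mbX : m (refl b X) by rewrite bX; exact: mt.
have imb : refl b @` m = m.
  rewrite (mline_eq hm (nesym nbX) mX mbX) (im_line (I_refl hb) (nesym nbX)) reflK //
    line_comm //.
  exact: nesym.
have pbm : perp b m.
  by apply: im_perp => // e; apply: nbX; rewrite refl_fix // e.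
have pym : perp y m.
  apply: im_perp => //; first by move=> e; apply: (dis Y) => //; rewrite -e.
  have sub Z : m Z -> m (refl y Z).
    by move=> mZ; have := mt _ mZ; rewrite et => /(perp_in pbm); rewrite reflK.
  apply/seteqP; split=> Z; first by move=> [W mW <-]; exact: sub.
  by move=> mZ; exists (refl y Z); [exact: sub|exact: reflK].
exists l, b, m, y; split=> //; try exact: perp_sym.
split; first exact: nesym.
by move=> e; apply: nbX; rewrite refl_fix // e.
Qed.

Lemma perp_same x v U : perp x v -> ~ v U -> same v U (refl x U).
Proof.
move=> h nU; have [hx hv n _] := h.
have [B xB nB] := mline_diff hv hx (nesym n).
have fB := refl_fix hx xB.
have [sUB|oUB] := same_opp_ex nU nB.
  have := (I_same v U B (I_refl hx)).1 sUB; rewrite perp_im // fB.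
  by move/same_sym; exact: same_trans.
have := (I_opp v U B (I_refl hx)).1 oUB; rewrite perp_im // fB.
by move/opp_sym; exact: opp_opp.
Qed.

Lemma glide_opp x v A W : perp x v -> v A -> ~ v W -> opp v W (refl x (hturn A W)).
Proof.
move=> h vA nW; have [_ hv _ _] := h.
apply: (opp_same_trans hv (hturn_opp hv vA nW)); apply: perp_same => //.
by rewrite hturn_mlE.
Qed.

(** On its axis [v] the glide reflection acts as the product of the half-turns about the foot [F] of
    [x] and about [A], so a fixed point forces [A = F]. *)
Lemma glide_fix x v A Z : perp x v -> v A -> ~ x A -> v Z -> refl x (hturn A Z) <> Z.
Proof.
move=> h vA nA vZ e; have [hx hv _ _] := h; have [F [xF vF]] := perp_meet h.
apply: nA; suff -> : A = F by [].
apply: (hturn_inj (A := Z)); rewrite -(perp_hturn _ h xF vF) (refl_fix hv vZ).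
by rewrite -{2}e reflK.
Qed.

(* A glide reflection exchanges the sides of its axis, hence preserves it alone. *)
Lemma glide_axis x y v w A D : perp x v -> v A -> ~ x A -> perp y w -> w D -> ~ y D ->
  (forall W, refl x (hturn A W) = refl y (hturn D W)) -> v = w.
Proof.
move=> hx vA nA hy wD nD e; apply: contrapT => nvw.
have [_ hv _ _] := hx; have [_ hw _ _] := hy.
have v_in Z : v Z -> v (refl x (hturn A Z)) by move=> vZ; apply: (perp_in hx); exact: hturn_ml.
have w_in Z : w Z -> w (refl x (hturn A Z)).
  by move=> wZ; rewrite e; apply: (perp_in hy); exact: hturn_ml.
have dis Z : v Z -> w Z -> False.
  move=> vZ wZ; apply: (glide_fix hx vA nA vZ).
  by apply: (mline_one hv hw nvw) => //; [exact: v_in|exact: w_in].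
have nDv : ~ v D by move/dis; apply.
have [_ _ [Z vZ sZ]] := glide_opp hx vA nDv.
by apply: (dis Z vZ); apply: (mline_seg hw wD (w_in _ wD)) sZ.
Qed.

(* [refl x], [refl b], [refl d] compose to some [refl y]; cancelling along [c],
   [refl x] after a half-turn on [b] is [refl y] after a half-turn on [d], a
   glide reflection whose axis passes through both centres. *)
Lemma rect_perp a b c d x : perp a b -> perp a d -> perp c b -> perp c d ->
  a <> c -> b <> d -> perp a x -> perp c x.
Proof.
move=> ab ad cb cd nac nbd ax.
have [->//|nxb] := EM (x = b).
have [ha hx _ _] := ax; have [hc hb _ _] := cb; have [_ hd _ _] := cd.
have [P [aP xP]] := perp_meet ax; have [Q [aQ bQ]] := perp_meet ab.
have [S [aS dS]] := perp_meet ad.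
have [N aN eN] := hturn3 ha aP aQ aS; have [y yN ay] := perp_at ha aN.
have [_ hy _ _] := ay.
have exy W : refl x (refl b (refl d W)) = refl y W.
  rewrite -(reflK W ha) -(perp_hturn2 _ ax ab aP aQ xP bQ).
  by rewrite (perp_hturn _ (perp_sym ad) dS aS) eN (perp_hturn _ (perp_sym ay) yN aN).
have [A [cA bA]] := perp_meet cb; have [D [cD dD]] := perp_meet cd.
have eG W : refl x (hturn A W) = refl y (hturn D W).
  by rewrite -exy -(perp_hturn2 _ cb cd cA cD bA dD) hturnK.
have nA : ~ x A by move=> xA; apply: nxb; exact: (perp_uniq ax ab xA).
have nD : ~ y D.
  move=> yD; have e := perp_uniq ay ad yD dD.
  apply: nxb; apply: refl_inj => //; apply/funext => W.
  by have := exy (refl d (refl b W)); rewrite e !reflK.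
have [v vA xv] := perp_from hx nA; have [w wD yw] := perp_from hy nD.
have evw := glide_axis xv vA nA yw wD nD eG.
suff -> : c = v by exact: perp_sym.
have [_ hv _ _] := xv.
apply: (mline_eq2 hc hv (A := A) (B := D)) => //; last by rewrite evw.
by move=> e; apply: (perp_disj ab ad nbd bA); rewrite e.
Qed.

Lemma rect_coord a b c d x z : perp a b -> perp a d -> perp c b -> perp c d ->
  a <> c -> b <> d -> perp a x -> perp b z -> perp x z.
Proof.
move=> ab ad cb cd nac nbd ax bz.
have dz : perp d z.
  by apply: (rect_perp (perp_sym ab) (perp_sym cb) (perp_sym ad) (perp_sym cd)).
have [<-|naz] := EM (a = z); first exact: perp_sym.
by apply: perp_sym; apply: (rect_perp ab ad (perp_sym bz) (perp_sym dz)).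
Qed.

Lemma move_perp a b l p : perp a b -> perp l p -> exists f, [/\ I f, f @` a = l & f @` b = p].
Proof.
move=> ab lp; have [ha hb _ _] := ab; have [hl hp _ _] := lp.
have [O0 [aO bO]] := perp_meet ab; have [F [lF pF]] := perp_meet lp.
have [A [nA aA ea]] := mline_pt2 ha aO; have [B [nB lB el]] := mline_pt2 hl lF.
have [P nP] := off_ex ha; have [Q nQ] := off_ex hl.
rewrite ea in nP; rewrite el in nQ.
have [f [If fO fA _]] := E_ex nA nP nB nQ.
have eal : f @` a = l.
  by rewrite ea im_line // fO (hray_L nB _ fA) // -{1}fO; exact: I_ne.
exists f; split=> //; have := I_perp If ab; rewrite eal => lf.
by apply: (perp_uniq lf lp (P := F)) => //; exists O0.
Qed.

Lemma im_can (f g : T -> T) (l : set T) : cancel f g -> g @` (f @` l) = l.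
Proof. by move=> fK; rewrite image_comp; apply/seteqP; split=> X; [move=> [Y lY <-] /=;
  rewrite fK|exists X => //=; rewrite fK]. Qed.

(** The group is transitive on pairs of perpendicular lines, so what holds for two sides of the
    given rectangle holds for every such pair. *)
Lemma rect_everywhere : rectangle -> forall l p x z, perp l p -> perp l x -> perp p z -> perp x z.
Proof.
move=> [a [b [c [d [ab ad cb cd [nac nbd]]]]]] l p x z lp lx pz.
have [f [If fl fp]] := move_perp lp ab.
have [g [Ig fK gK]] := I_inv If.
have := rect_coord ab ad cb cd nac nbd (x := f @` x) (z := f @` z).
rewrite -{1}fl -fp => /(_ (I_perp If lx) (I_perp If pz)) /(I_perp Ig).
by rewrite !im_can.
Qed.

(** * The parallel postulate *)

(** [hturn Y C] doubles [Y] away from [C]. Were the order of the doubles reversed, the translation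
    [hturn Y \o hturn W] would map the segment from [hturn W Y] to [hturn W C] into itself,
    preserving its order, and so have a fixed point. *)
Lemma double_mono C W Y : s C Y W -> s C (hturn Y C) (hturn W C).
Proof.
move=> hW.
have [<-|nCW] := EM (C = W); first by rewrite hturn_A.
have [<-|nWY] := EM (W = Y); first exact: sr.
have nCY : C <> Y by move=> e; subst Y; rewrite (sxx hW) in nCW.
set M := hturn W C; set M' := hturn Y C.
have sW : s C M W := hturn_s W C. have sY : s C M' Y := hturn_s Y C.
have rW : hray C Y W by left.
have rM : hray C Y M by rewrite -(hray_eq nCY nCW rW); right.
have rM' : hray C Y M' by right.
case: (hray_tot nCY rM' rM) => // h; exfalso.
pose A := hturn W Y.
have hYM := s_tr h sY.
have hA : s C W A by apply: sC; have := I_s (I_hturn W) (s_in hYM hW); rewrite hturnK hturn_A.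
have aM X : s C M X -> s C X W -> s A M X by move=> h1 h2; apply: s_in h1 (s_tr h2 hA).
have hAY : s A M Y by apply: aM.
have hAM' : s A M M' by apply: aM => //; exact: s_tr sY hW.
have nAM : A <> M by move=> e; apply: nCY; apply: (I_inj (I_hturn W)).
have im X : s A M X -> s Y M' (hturn Y (hturn W X)).
  move=> hX; have := I_s (I_hturn Y) (I_s (I_hturn W) hX).
  by rewrite hturnK hturn_A hturnK.
have [||Z _ /(hturn2_nofix (nesym nWY)) //] := @increasing_fixpoint A M (fun X =>
  hturn Y (hturn W X)) nAM.
- by move=> X /im; exact: s_sub.
- move=> X X' hX' hX; have hgX := im _ hX'.
  have h1 := I_s (I_hturn Y) (I_s (I_hturn W) hX); rewrite hturnK hturn_A in h1.
  apply: s_sub _ (sr _ _) h1.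
  exact/sC/(s_in (sC (s_in sY (s_tr hW hA))) (sC hgX)).
Qed.

(** If the iterated doubles stay in [s C F], let [M] be their supremum. Some double reaches the
    midpoint of [C] and [M], so the next one is [M] by [double_mono], and the one after exceeds
    [M]. *)
Lemma archimedes C F Y : C <> F -> hray C F Y -> Y <> C ->
  exists k, s C (iter k (fun Z => hturn Z C) Y) F.
Proof.
move=> nCF rY nY; apply: contrapT => no.
pose y k := iter k (fun Z => hturn Z C) Y.
have ry k : hray C F (y k).
  elim: k => [//|k IH]; rewrite /y iterS -/(y k).
  have [->|n] := EM (y k = C); first by rewrite hturn_A; exact: hray_l.
  by rewrite -(hray_eq nCF (nesym n) IH); right; exact: hturn_s.
have hy k : s C F (y k) by case: (ry k) => // h; case: no; exists k.
pose P Z := exists k, s C (y k) Z.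
have [||X Z _ hXZ [k hk]|M [hM below above]] := @dedekind_cut C F P nCF.
- by exists 0%N; exact: sl.
- by case=> k h; apply: no; exists k.
- by exists k; exact: s_tr hk hXZ.
have yM k : s C M (y k).
  case: (s_tot (hy k) hM) => // h.
  have [->//|n] := EM (y k = M).
  by case: (above _ (s_in (hy k) h) n); exists k; exact: sr.
have nCM : C <> M by move=> e; apply: nY; have := yM 0%N; rewrite -e => /sxx.
have [W hW eW] := midpoint nCM.
have nWM : W <> M by move=> e; apply: nCM; apply: (I_inj (I_hturn W)); rewrite eW e hturn_A.
have [k hk] := below W hW nWM.
have h1 := double_mono hk; rewrite eW -/(y k.+1) in h1.
have e : y k.+1 = M := s_anti h1 (yM k.+1).
have h2 : s C M (hturn (y k.+1) C) := yM k.+2; rewrite e in h2.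
by apply: (hturn_ne nCM); exact: esym (s_anti h2 (hturn_s M C)).
Qed.

Definition unique_parallels := forall l C, mline l ->
  exists! l', [/\ mline l', l' C & parallel l' l].

Lemma perp_setI l x y : perp l x -> perp l y -> x <> y -> x `&` y = set0.
Proof.
by move=> hx hy n; apply/seteqP; split=> // X [xX yX]; exact: (perp_disj hx hy n xX yX).
Qed.

Lemma meet_or (l m : set T) : (exists Z, l Z /\ m Z) \/ l `&` m = set0.
Proof.
case: (EM (exists Z, l Z /\ m Z)) => h; [by left|right].
by apply/seteqP; split=> // X [lX mX]; apply: h; exists X.
Qed.

(* Doubling a point of [n] away from [C] doubles its projection to the common
   perpendicular [p], so by Archimedes [n] eventually crosses [l]. *)
Lemma rect_meet : rectangle -> forall l p m n C, perp l p -> perp p m -> p C -> ~ l C ->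
  m C -> mline n -> n C -> n <> m -> exists Z, l Z /\ n Z.
Proof.
move=> hr l p m n C lp pm pC nlC mC hn nC nnm.
have [hl hp _ _] := lp; have [_ hm _ _] := pm.
have [F [lF pF]] := perp_meet lp.
have nlm : l <> m by move=> e; apply: nlC; rewrite e.
have nCF : C <> F by move=> e; subst F.
have nmF : ~ m F by move=> mF; apply: (perp_disj (perp_sym lp) pm nlm lF mF).
have [X [nX sX]] : exists X, n X /\ same m F X.
  have [X nX nmX] := mline_diff hm hn (nesym nnm).
  have [h|h] := same_opp_ex nmF nmX; first by exists X.
  exists (hturn C X); split; first exact: hturn_ml.
  exact: opp_opp hm h (hturn_opp hm mC nmX).
have [z zX pz] := perp_ex X hp; have [Y [pY zY]] := perp_meet pz.
have nzm : z <> m by move=> e; case: sX => _; rewrite -e.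
have sY : same m F Y.
  have nY : ~ m Y by move=> mY; apply: (perp_disj pz pm nzm zY mY).
  have [//|h] := same_opp_ex nmF nY.
  have [_ hz _ _] := pz.
  have [_ _ [W mW sW]] := same_opp_trans hm (same_sym sX) h.
  by case: (perp_disj pz pm nzm (mline_seg hz zX zY sW) mW).
have rY : hray C F Y.
  by apply: (hray_pt hm mC nmF _ sY); rewrite -(mline_eq hp nCF pC pF).
have nY : Y <> C by move=> e; subst Y; case: sY.
have [k hk] := archimedes nCF rY nY.
pose d := fun Z => hturn Z C.
have inv j : exists z', [/\ perp p z', z' (iter j d X), z' (iter j d Y), n (iter j d X) & p
  (iter j d Y)].
  elim: j => [|j [z' [pz' zX' zY' nX' pY']]]; first by exists z.
  rewrite !iterS; set X' := iter j d X in zX' nX' *; set Y' := iter j d Y in zY' pY' *.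
  have [x xX lx] := perp_ex X' hl.
  have xz := rect_everywhere hr lp lx pz'; have xm := rect_everywhere hr lp lx pm.
  have [_ hz' _ _] := pz'.
  (* The half-turn about [X'] is the product of the reflections in [z'] and in the perpendicular [x]
     of [l] through [X']. The rectangle makes [x] perpendicular to [m] too, so [x] preserves [m],
     and the mirror image of [m] in [z'] contains both doubled points. *)
  exists (refl z' @` m); split.
  - by rewrite -(perp_im (perp_sym pz')); apply: I_perp => //; exact: I_refl.
  - rewrite /d -(perp_hturn C (perp_sym xz) zX' xX); exists (refl x C) => //.
    exact: perp_in xm mC.
  - rewrite /d -(perp_hturn C (perp_sym pz') zY' pY').
    by exists C => //; rewrite (refl_fix hp pC).
  - by apply: hturn_ml.
  - by apply: hturn_ml.
have [z' [pz' zX' zY' nX' pY']] := inv k.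
have [_ hz' _ _] := pz'.
have [e|nzl] := EM (z' = l); first by exists (iter k d X); split=> //; rewrite -e.
have dis Z : l Z -> z' Z -> False by exact: perp_disj (perp_sym lp) pz' (nesym nzl).
(* The perpendicular [z'] stays on one side of [l], that of the doubled [Y], which [F] separates
   from [C]; so [n] joins [C] to a point beyond [l]. *)
have oY : opp l C (iter k d Y) by split=> //; [move/dis; exact|exists F].
have sXY : same l (iter k d Y) (iter k d X).
  split; [by move/dis; exact|by move/dis; exact|] => Z lZ sZ.
  by apply: (dis Z lZ); apply: mline_seg sZ.
have [_ _ [Z lZ sZ]] := opp_same_trans hl oY sXY.
by exists Z; split=> //; apply: mline_seg sZ.
Qed.

Lemma rect_parallels : rectangle -> unique_parallels.
Proof.
move=> hr l C hl; have [lC|nC] := EM (l C).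
  exists l; split; first by split=> //; left.
  move=> l' [_ lC' [//|e]]; have : (l' `&` l) C by [].
  by rewrite e.
have [p pC lp] := perp_from hl nC; have [_ hp _ _] := lp.
have [m mC pm] := perp_at hp pC; have [_ hm _ _] := pm.
have nlm : m <> l by move=> e; apply: nC; rewrite -e.
exists m; split.
  by split=> //; right; exact: perp_setI pm (perp_sym lp) nlm.
move=> n [hn nnC par]; apply: contrapT => /nesym nnm.
have [Z [lZ nZ]] := rect_meet hr lp pm pC nC mC hn nnC nnm.
case: par => [e|e]; first by apply: nC; rewrite -e.
by have : (n `&` l) Z by []; rewrite e.
Qed.

(* Equivalently, the product of three half-turns is always a half-turn. *)
Definition half_turn_cancel := forall P Q C, exists Z, forall X,
  hturn P (hturn Q X) = hturn Z (hturn C X).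

(** For [C] off the line [PQ], the translation is [refl b' \o refl b] with [b], [b'] perpendicular
    to that line and [b] through [C]. Let [m] be the perpendicular of [b] at [C]. Unique parallels
    make [b'] meet [m] (otherwise [b] and [m] would both be parallels of [b'] through [C]) and make
    [m] invariant under [refl b']. So [b'] is perpendicular to [m], and [Z] is their
    intersection. *)
Lemma parallels_cancel : unique_parallels -> half_turn_cancel.
Proof.
move=> ep P Q C; have [->|nPQ] := EM (P = Q); first by exists C => X; rewrite !hturnK.
have ha := mline_line nPQ; set a := line P Q in ha.
have aP : a P := line_l nPQ. have aQ : a Q := line_r nPQ.
have [aC|nC] := EM (a C).
  by have [Z _ eZ] := hturn3 ha aP aQ aC; exists Z => X; rewrite -eZ hturnK.
have [b bC ab] := perp_from ha nC; have [B [aB bB]] := perp_meet ab.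
have [K aK eK] := hturn3 ha aP aQ aB; have [b' bK ab'] := perp_at ha aK.
have [_ hb _ _] := ab; have [_ hb' _ _] := ab'.
have et X : hturn P (hturn Q X) = refl b' (refl b X).
  by rewrite -(perp_hturn2 _ ab' ab aK aB bK bB) -eK hturnK.
have [m mC bm] := perp_at hb bC; have [_ hm _ _] := bm.
have nbb : b <> b'.
  by move=> e; apply: (hturn2_nofix (P := B) nPQ); rewrite et e reflK.
have nam : a <> m by move=> e; apply: nC; rewrite e.
have dam Z : a Z -> m Z -> False by exact: perp_disj (perp_sym ab) bm nam.
have [[Z [bZ mZ]]|e] := meet_or b' m; last first.
  have [k [_ u]] := ep b' C hb'.
  have e1 : k = b by apply: u; split=> //; right; exact: perp_setI ab ab' nbb.
  have e2 : k = m by apply: u; split=> //; right; rewrite setIC.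
  by case: bm => _ _ []; rewrite -e1 -e2.
have im : refl b' @` m = m.
  have [k [_ u]] := ep a Z ha.
  have e1 : k = m by apply: u; split=> //; right; exact: perp_setI bm (perp_sym ab) (nesym nam).
  have e2 : k = refl b' @` m.
    apply: u; split; [exact: im_mline (I_refl hb') hm|by exists Z => //; exact: refl_fix|].
    right; apply/seteqP; split=> // X [[W mW <-]].
    move/(perp_in (perp_sym ab')); rewrite reflK // => aW.
    exact: dam aW mW.
  by rewrite -e2 e1.
have bm' : perp b' m.
  by apply: im_perp => // e; apply: (dam K) => //; rewrite -e.
exists Z => X.
rewrite et -(perp_hturn _ bm' bZ mZ) -(perp_hturn _ (perp_sym bm) mC bC) reflK //.
Qed.

(** * Translations as products of two half-turns *)

Lemma end_rayE A B C : A <> B -> s A C B -> C <> B ->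
  xget set0 [set r : set T | maximal_ray s B r /\ r `<=` ray s A B] = hray B C.
Proof.
move=> nAB hC nC; rewrite rayE //; apply: xget_unique.
  split; first by apply: hray_max; exact: nesym.
  by move=> X hX; right; exact: (opp_ray_s (nesym nAB) (nesym nC) hC hX).
move=> r [/max_rayP[D [nD ->]] sub].
case: (sub _ (hray_r B D)) => hD; last first.
  apply: hray_eq => //; first exact: nesym.
  exact: (opp_ray (nesym nAB) hC hD).
have [E hE nE] := seg_extend (nesym nAB).
have rE : hray A B E.
  apply: sub; rewrite -(hray_eq nD (nesym nAB) _); first by right.
  by right; exact: sC.
by case: (hray_end nAB (hray_r A B) rE hE) => // /esym.
Qed.

Lemma tauE M A B : hturn M A = B -> tau s I A B = hturn M \o hturn A.
Proof.
move=> eM; rewrite /tau; case: pselect => [e|nAB].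
  rewrite -e in eM; rewrite -(hturn_fix eM).
  by apply/funext => X /=; rewrite hturnK.
have eM' : hturn M B = A by rewrite -eM hturnK.
have hl := mline_line nAB.
have [C hC nC] := seg_extend nAB.
have lA : line A B A by exact: line_l.
have lM : line A B M by apply: line_seg => //; rewrite -eM; exact: hturn_s.
pose f := hturn M \o hturn A.
have If : I f by exact: I_comp.
have fA : f A = B by rewrite /f /= hturn_A.
have hfB : s A (f B) B.
  by have := I_s (I_hturn M) (hturn_s A B); rewrite eM' eM.
have nfB : B <> f B by rewrite -{1}fA; exact: I_ne.
have rfB : hray B C (f B) by apply: (opp_ray (nesym nAB) hC hfB nC).
rewrite -/f; apply: (@xget_unique {classic T -> T}) => [|g [Ig gray gh]].
  split=> // [|h].
    by rewrite (end_rayE nAB hC nC) rayE // im_hray // fA (hray_eq (nesym nC) nfB rfB).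
  move/(half_planeP _ hl) => [P nP ->].
  rewrite im_same // im_line // fA.
  have -> : line B (f B) = line A B.
    by apply: line_eq => //; [exact: line_r|do 2 apply: hturn_ml => //; exact: line_r].
  by apply/same_ext => //; left; apply/same_sym/hturn2_same.
have [P nP] := off_ex hl.
rewrite (end_rayE nAB hC nC) rayE // im_hray // in gray.
have gA : g A = B by exact: hray_apex (I_ne Ig nAB) (nesym nC) gray.
rewrite gA in gray.
apply: (E_uniq (A := A) (B := B) (P := P) Ig If nAB nP); rewrite ?gA ?fA //.
  by rewrite gray.
have -> : line B (g B) = line A B.
  have ngB : B <> g B by rewrite -{1}gA; exact: I_ne.
  have rg : hray B C (g B) by rewrite -gray.
  apply: line_eq => //; first exact: line_r.
  apply/line_col => //; constructor 3.
  exact: (opp_ray_s (nesym nAB) (nesym nC) hC rg).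
have hh : half_plane s (line A B) (same (line A B) P) by apply/half_planeP => //; exists P.
have sP : same (line A B) P (g P) by rewrite -(gh _ hh); exists P => //; exact: same_refl.
by apply: (same_trans hl (same_sym sP)); exact: hturn2_same.
Qed.

Lemma mid_ex A B : exists M, hturn M A = B.
Proof.
have [->|/midpoint[M _ e]] := EM (A = B); last by exists M.
by exists B; rewrite hturn_A.
Qed.

Lemma transP t : translation s I t <-> exists M N, t = hturn M \o hturn N.
Proof.
split=> [[A [B ->]]|[M [N ->]]].
  by have [M e] := mid_ex A B; exists M, A; exact: tauE.
by exists N, (hturn M N); apply/esym/tauE.
Qed.

Lemma hturn2_trans M N : translation s I (hturn M \o hturn N).
Proof. by apply/transP; exists M, N. Qed.

Definition base_free := forall t, translation s I t ->
  forall C D, D = t C -> t = tau s I C D.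

Lemma cancel_base_free : half_turn_cancel <-> base_free.
Proof.
split=> [h t /transP[P [Q ->]] C D ->|h P Q C].
  have [Z e] := h P Q C.
  rewrite (@tauE Z C) /=; last by rewrite e hturn_A.
  by apply/funext => X /=.
have [Z e] := mid_ex C (hturn P (hturn Q C)); exists Z => X.
by have := h _ (hturn2_trans P Q) C _ erefl; rewrite /= (tauE e) => /(congr1 (fun f => f X)).
Qed.

Definition commuting := forall t1 t2, translation s I t1 -> translation s I t2 ->
  t1 \o t2 = t2 \o t1.

Lemma cancel_commuting : half_turn_cancel -> commuting.
Proof.
move=> h t1 t2 /transP[A [B ->]] /transP[C [D ->]]; apply/funext => X /=.
(* A product of three half-turns is a half-turn, hence equal to its inverse. Reversing three factors
   twice turns the order [A B C D] into [C D A B]. *)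
have rev P Q N Y : hturn P (hturn Q (hturn N Y)) = hturn N (hturn Q (hturn P Y)).
  have [Z e] := h P Q N.
  have e' W : hturn P (hturn Q (hturn N W)) = hturn Z W by rewrite e hturnK.
  have eZ : hturn Z (hturn N (hturn Q (hturn P Y))) = Y by rewrite -e' !hturnK.
  by rewrite e' -{1}eZ hturnK.
by rewrite rev; congr (hturn C _); rewrite rev.
Qed.

Definition group := is_subgroup I [set t | translation s I t].

Lemma cancel_group : half_turn_cancel -> group.
Proof.
move=> h; split.
- by move=> t /transP[M [N ->]]; exact: I_comp.
- have [A _] : exists A : T, True by case: isplane => _ [A _] _; exists A.
  by apply/transP; exists A, A; apply/funext => X /=; rewrite hturnK.
- move=> t1 t2 /transP[A [B ->]] /transP[C [D ->]].
  have [Z e] := h A B C; apply/transP; exists Z, D; apply/funext => X /=.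
  by rewrite e hturnK.
- move=> t /transP[M [N ->]]; exists (hturn N \o hturn M); split; first exact: hturn2_trans.
    by move=> X /=; rewrite !hturnK.
  by move=> X /=; rewrite !hturnK.
Qed.

Lemma mid_line A B M : A <> B -> hturn M A = B -> line A B M /\ line M A = line A B.
Proof.
move=> nAB e; have lM : line A B M by apply: line_seg => //; rewrite -e; exact: hturn_s.
split=> //; apply: line_eq => //; last exact: line_l.
by move=> e'; apply: nAB; rewrite -e e' hturn_A.
Qed.

Lemma commuting_rect : commuting -> rectangle.
Proof.
move=> h; have [A0 _] : exists A : T, True by case: isplane => _ [A _] _; exists A.
have [B [C t]] := triangle_ex A0; move: A0 t => A t; have [nAB nAC nBC] := noncol_ne t.
have [M eM] := mid_ex A B; have [N eN] := mid_ex A C.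
have [lM eL] := mid_line nAB eM; have hl := mline_line nAB.
pose t2 := hturn N \o hturn A.
have It : I t2 by exact: I_comp.
apply: (@two_axes M A (t2 @` line A B)).
- by move=> e; apply: nAB; rewrite -eM e hturn_A.
- exact: im_mline.
- move=> _ [W lW <-].
  have := congr1 (fun f => f W) (h _ _ (hturn2_trans M A) (hturn2_trans N A)) => /= ->.
  exists (hturn M (hturn A W)) => //.
  by apply: hturn_ml => //; apply: hturn_ml => //; exact: line_l.
- rewrite eL => e; case: t => _; apply; rewrite -e; exists A; first exact: line_l.
  by rewrite /t2 /= hturn_A.
Qed.

(* For the midpoints of the sides of a triangle, the product of the translations
   [AB], [BC], [CA] fixes [A]; if it is a translation, it is the identity. *)
Lemma group_rect : group -> rectangle.
Proof.
move=> [_ _ h _]; have [A0 _] : exists A : T, True by case: isplane => _ [A _] _; exists A.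
have [B [C t]] := triangle_ex A0; move: A0 t => A t; have [nAB nAC nBC] := noncol_ne t.
have [M eM] := mid_ex A B; have [N eN] := mid_ex B C; have [P eP] := mid_ex C A.
have [lM eL] := mid_line nAB eM; have [lP eL'] := mid_line (nesym nAC) eP;
  have hl := mline_line nAB.
have /transP[K [K' eK]] := h _ _ (hturn2_trans P N) (hturn2_trans M A).
have eKX X : hturn P (hturn N (hturn M (hturn A X))) = hturn K (hturn K' X).
  exact: (congr1 (fun f => f X) eK).
have eKK : K = K'.
  apply: contrapT => /hturn2_nofix n; apply: (n A).
  by rewrite -eKX hturn_A eM eN eP.
have e2 Y : hturn P (hturn N Y) = hturn A (hturn M Y).
  by have := eKX (hturn A (hturn M Y)); rewrite eKK !hturnK.
apply: (@two_axes P N (line A B)) => //.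
- by move=> e; apply: nAB; rewrite -eP e -eN hturnK.
- move=> X lX; rewrite e2; apply: hturn_ml => //; first exact: line_l.
  exact: hturn_ml.
- move=> e; have nPN : P <> N by move=> e'; apply: nAB; rewrite -eP e' -eN hturnK.
  have lP' : line A B P by rewrite e; exact: line_l.
  case: t => _; apply; rewrite -(hturnK P C) eP; apply: hturn_ml => //; exact: line_l.
Qed.

(** * The pencil of rays at a point *)

Section Pencil.
Variables A B P : T.
Hypothesis t0 : noncol A B P.

Let nAB : A <> B. Proof. by case: t0. Qed.
Let l := line A B.
Let hl : mline l. Proof. exact: mline_line. Qed.
Let lA : l A. Proof. exact: line_l. Qed.
Let lB : l B. Proof. exact: line_r. Qed.
Let nP : ~ l P. Proof. by case: t0. Qed.
Let r0 := hray A B.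

Definition upper X := same l P X.
Definition upper_ray r := r = r0 \/ exists2 X, upper X & r = hray A X.
(* [r1] lies in the closed angle between [r0] and [r2]. *)
Definition ray_le r1 r2 := exists X Y, [/\ r2 Y, Y <> A, s B Y X & r1 = hray A X].

Lemma upper_noncol X : upper X -> noncol A B X.
Proof. by move=> [_ nX _]; split. Qed.

Lemma upper_ne X : upper X -> A <> X.
Proof. by move=> /upper_noncol/noncol_ne[]. Qed.

Lemma upper_r0 X : upper X -> hray A X <> r0.
Proof.
move=> hX e; case: (hX) => _ + _; apply.
by apply: (hray_sub_L nAB); rewrite -/r0 -e; exact: hray_r.
Qed.

Lemma r0_eq X : hray A B X -> A <> X -> hray A X = r0.
Proof. by move=> h n; exact: hray_eq. Qed.

Lemma upper_seg X Y : upper Y -> s B Y X -> X <> B -> upper X.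
Proof.
move=> hY hX nX; apply: (same_trans hl hY).
by apply: (seg_same hl lB) => //; case: hY.
Qed.

Lemma upper_ray_seg X Y : upper Y -> s B Y X -> upper_ray (hray A X).
Proof.
move=> hY hX; have [->|n] := EM (X = B); first by left.
by right; exists X => //; exact: upper_seg hX n.
Qed.

Lemma upper_R X Y : upper X -> hray A X Y -> Y <> A -> upper Y.
Proof.
move=> hX h n; apply: (same_trans hl hX); apply: (ray_same hl lA) => //.
by case: hX.
Qed.

(** Central projection allows any point [Y] of the upper ray. The rays below it then correspond to
    the points of [s B Y], whose order properties pass to the pencil. *)
Lemma le_upper r Y : upper Y -> ray_le r (hray A Y) <-> exists2 X, s B Y X & r = hray A X.
Proof.
move=> hY; split=> [[X [Y' [h n hX ->]]]|[X hX ->]]; last first.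
  by exists X, Y; split=> //; apply: nesym; exact: upper_ne.
have hY' := upper_R hY h n; have t := upper_noncol hY'.
have [X' hX' rX'] := crossbar_seg t hX (hray_r A B) (hray_sym h) (nesym nAB) (nesym (upper_ne
  hY)).
exists X' => //; apply/esym/hray_eq => //.
- by apply: nesym; exact: noncol_apex t hX.
- by apply: nesym; exact: noncol_apex (upper_noncol hY) hX'.
Qed.

Lemma le_r0 r : ray_le r r0 <-> r = r0.
Proof.
split=> [[X [Y [h n hX ->]]]|->]; last by exists B, B; split=> //; [exact: hray_r|exact: nesym].
have rX : hray A B X by apply: (hray_conv nAB (hray_r A B) h hX).
apply: r0_eq => // e; subst X.
by case: (hray_end nAB (hray_r A B) h hX) => // /esym.
Qed.

Lemma r0_le r : upper_ray r -> ray_le r0 r.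
Proof.
case=> [->|[X hX ->]]; first exact/le_r0.
by apply/le_upper => //; exists B.
Qed.

Lemma le_anti x y : upper_ray x -> upper_ray y -> ray_le x y -> ray_le y x -> x = y.
Proof.
case=> [->|[X hX ->]] [->|[Y hY ->]] //; try by move=> /le_r0.
  by move=> _ /le_r0.
move=> /(le_upper _ hY)[X' hX' e]; rewrite e => h; congr (hray A _).
have nX' : X' <> B.
  by move=> e'; apply: (upper_r0 hX); rewrite e e'.
have uX' := upper_seg hY hX' nX'.
move: h => /(le_upper _ uX')[Y' hY' eY].
have := ray_meet (upper_noncol hY) (sr _ _) (s_tr hX' hY').
rewrite eY => /(_ _)/esym e2.
have rYY' : hray A Y Y' by rewrite eY; exact: hray_r.
have e3 := ray_meet (upper_noncol hY) (sr _ _) (s_tr hX' hY') rYY'.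
by rewrite -e3 in hY'; exact: s_anti hY' hX'.
Qed.

Lemma le_trans x y z : upper_ray x -> upper_ray y -> upper_ray z ->
  ray_le x y -> ray_le y z -> ray_le x z.
Proof.
move=> _ hy [->|[Z hZ ->]]; first by move=> h /le_r0 e; rewrite e in h.
move=> h /(le_upper _ hZ)[Y hY e]; apply/le_upper => //.
have [eY|nY] := EM (Y = B).
  by rewrite e eY in h; move/le_r0: h => ->; exists B.
move: h; rewrite e => /(le_upper _ (upper_seg hZ hY nY))[X hX ->].
by exists X => //; exact: s_tr hX.
Qed.

Lemma le_total x y : upper_ray x -> upper_ray y -> ray_le x y \/ ray_le y x.
Proof.
move=> hx hy; case: (hx) => [->|[X hX ex]]; first by left; exact: r0_le.
case: (hy) => [->|[Y hY ey]]; first by right; exact: r0_le.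
have nAX := upper_ne hX; have nAY := upper_ne hY; have hAY := mline_line nAY.
have nBY : ~ line A Y B by case: (noncol_rot (upper_noncol hY)).
have [lX|nX] := EM (line A Y X).
  have rYX : hray A Y X.
    apply: (hray_pt hl lA) => //; first by case: hY.
    by apply: (same_trans hl (same_sym hY)).
  left; rewrite ex ey (hray_eq nAY nAX rYX).
  by apply/le_upper => //; exists Y.
have [sXB|oXB] := same_opp_ex nX nBY.
  left; have [Z hZ rZ] : exists2 Z, s B Y Z & hray A X Z.
    apply: crossbar (upper_noncol hY) _ (same_sym sXB).
    exact: same_trans hl (same_sym hY) hX.
  rewrite ex ey; apply/le_upper => //; exists Z => //; apply/esym/hray_eq => //.
  by apply: nesym; exact: noncol_apex (upper_noncol hY) hZ.
right; have [_ _ [Z lZ /sC sZ]] := oXB.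
have nZ : Z <> B by move=> e; subst Z.
have uZ := upper_seg hX sZ nZ.
rewrite ex ey; apply/le_upper => //; exists Z => //; apply/esym/hray_eq => //.
  exact: upper_ne.
apply: (hray_pt hl lA) => //; first by case: hY.
exact: same_trans hl (same_sym hY) uZ.
Qed.

Lemma le_dense x y : upper_ray x -> upper_ray y -> ray_le x y -> x <> y ->
  exists z, [/\ upper_ray z, ray_le x z, ray_le z y, z <> x & z <> y].
Proof.
move=> hx [->|[Y hY ->]]; first by move=> /le_r0.
move=> /(le_upper _ hY)[X hX ->] n.
have nXY : X <> Y by move=> e; apply: n; rewrite e.
have [Z [hZ nZX nZY]] := seg_dense nXY.
have hZ' := s_sub hX (sr _ _) hZ.
have hXZ : s B Z X by apply: sC; apply: s_in (sC hX) (sC hZ).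
have nZB : Z <> B by move=> e; subst Z; apply: nZX; exact: esym (sxx hXZ).
have uZ := upper_seg hY hZ' nZB.
have inj V W : s B Y V -> s B Y W -> hray A V = hray A W -> V = W.
  by move=> hV hW e; apply: (ray_meet (upper_noncol hY)) => //; rewrite e; exact: hray_r.
exists (hray A Z); split.
- by right; exists Z.
- by apply/le_upper => //; exists X.
- by apply/le_upper => //; exists Z.
- by move/(inj _ _ hZ' hX).
- by move/(inj _ _ hZ' (sr _ _)).
Qed.

(* [r] is the second side of the angle [(p, q)] once it is moved by the group
   onto the flag of [A], [B], [P], with [p] sent to [r0]. *)
Definition Nrm p q r := exists f, [/\ I f, f @` p = r0, f @` q = r & upper_ray r].

Lemma Nrm_uniq V C D r r' : V <> C -> V <> D ->
  Nrm (hray V C) (hray V D) r -> Nrm (hray V C) (hray V D) r' -> r = r'.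
Proof.
move=> nVC nVD [f [If f1 <- fO]] [g [Ig g1 <- gO]].
rewrite !im_hray // in f1 g1 fO gO *.
have fV : f V = A := hray_apex (I_ne If nVC) nAB f1.
have gV : g V = A := hray_apex (I_ne Ig nVC) nAB g1.
(* For equal sides [f] and [g] may differ by a reflection in [l], but both results are [r0]. *)
have [rCD|nCD] := EM (hray V C D).
  have eqr k : I k -> hray (k V) (k C) = r0 -> hray (k V) (k D) = r0.
    by move=> Ik <-; apply: hray_eq; [exact: I_ne|exact: I_ne|exact: (I_hray V C D Ik).1].
  by rewrite (eqr f) // (eqr g).
have up k : I k -> k V = A -> hray (k V) (k C) = r0 -> upper_ray (hray (k V) (k D)) -> upper
  (k D).
  move=> Ik kV h1 [e|[X uX e]].
    by case: nCD; apply/(I_hray V C D Ik); rewrite h1 -e; exact: hray_r.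
  apply: (upper_R uX); last by rewrite -kV; apply: nesym; exact: I_ne.
  by rewrite -e; exact: hray_r.
have uf := up f If fV f1 fO; have ug := up g Ig gV g1 gO.
have nD : ~ line V C D.
  move=> /(I_line D If nVC); have -> : line (f V) (f C) = l.
    rewrite fV; apply: (hray_L nAB); first by rewrite -fV; exact: I_ne.
    by rewrite -/r0 -f1 fV; exact: hray_r.
  by case: uf.
have rC : hray (f V) (f C) (g C) by rewrite f1 -g1; exact: hray_r.
have efl : line (f V) (f C) = l.
  rewrite fV; apply: (hray_L nAB); first by rewrite -fV; exact: I_ne.
  by rewrite -/r0 -f1 fV; exact: hray_r.
have -> : f = g; last by [].
apply: (E_uniq If Ig nVC nD) => //; first by rewrite fV.
by rewrite efl; exact: same_trans hl (same_sym uf) ug.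
Qed.

Lemma Nrm_ex V C D : noncol V C D -> exists2 X, upper X & Nrm (hray V C) (hray V D) (hray A X).
Proof.
move=> [nVC nD]; have [f [If fV fC fD]] := E_ex nVC nD nAB nP.
exists (f D) => //; exists f; rewrite !im_hray // fV; split=> //.
  by apply: r0_eq => //; rewrite -fV; exact: I_ne.
by right; exists (f D).
Qed.

Lemma Nrm_refl V C : V <> C -> Nrm (hray V C) (hray V C) r0.
Proof.
move=> nVC; have [D nD] := off_ex (mline_line nVC).
have [X uX [f [If f1 _ _]]] := Nrm_ex (conj nVC nD).
by exists f; split=> //; left.
Qed.

Lemma Nrm_I g p q r : I g -> Nrm p q r -> Nrm (g @` p) (g @` q) r.
Proof.
move=> Ig [f [If f1 f2 Or]]; have [k [Ik gK kK]] := I_inv Ig.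
exists (f \o k); split=> //; first exact: I_comp.
  by rewrite image_comp -f1; apply/seteqP; split=> X [Y hY <-]; exists Y; rewrite //= gK.
by rewrite image_comp -f2; apply/seteqP; split=> X [Y hY <-]; exists Y; rewrite //= gK.
Qed.

(** The reflection in the bisector exchanges the two sides. Opposite rays drop out because they have
    no normal form. *)
Lemma Nrm_sym V C D r : V <> C -> V <> D -> Nrm (hray V C) (hray V D) r -> Nrm (hray V D)
  (hray V C) r.
Proof.
move=> nVC nVD h; have [lD|nD] := EM (line V C D).
  have [rCD|sCD] := hray_or nVC lD; first by rewrite (hray_eq nVC nVD rCD) in h *.
  case: h => f [If f1 <- Or]; exfalso.
  rewrite !im_hray // in f1 Or.
  have fV : f V = A := hray_apex (I_ne If nVC) nAB f1.
  have nfD : A <> f D by rewrite -fV; exact: I_ne.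
  have hfD := I_s If sCD.
  case: Or => [e|[X uX e]].
    have := hray_end (I_ne If nVC) _ (hray_r _ _) hfD; rewrite f1 -e => /(_ (hray_r _ _))[] e'.
      by apply: nVD; apply: (I_inj If).
    by apply: nVC; apply: (I_inj If).
  have uf : upper (f D).
    by apply: (upper_R uX); [rewrite -e fV; exact: hray_r|exact: nesym].
  have lfC : l (f C) by apply: (hray_sub_L nAB); rewrite -/r0 -f1; exact: hray_r.
  case: uf => _ + _; apply; apply: (mline_s hl (B := f C) lA) => //; last by rewrite -fV.
  by rewrite -fV; exact: I_ne.
have [f [If fV fC ffC fK]] := flip_ex (conj nVC nD).
have fD : hray V C (f D).
  by have := (I_hray V D (f C) If).1 fC; rewrite fV ffC => /hray_sym.
have nfC : V <> f C by rewrite -{1}fV; exact: I_ne.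
have nfD : V <> f D by rewrite -{1}fV; exact: I_ne.
by have := Nrm_I If h; rewrite !im_hray // fV (hray_eq nVD nfC fC) (hray_eq nVC nfD fD).
Qed.

(** The default [r0] is returned for opposite rays, which have no normal form; [aval] treats them
    apart. *)
Definition ang p q : set T := xget r0 (Nrm p q).
(* The difference of the angles [(r0, z)] and [(r0, x)]. *)
Definition asub z x := ang x z.

Lemma angE V C D r : V <> C -> V <> D ->
  Nrm (hray V C) (hray V D) r -> ang (hray V C) (hray V D) = r.
Proof. by move=> h1 h2 h; apply: xget_unique => // r' h'; exact: Nrm_uniq h' h. Qed.

(** [Z] is the mirror image of [B] in the bisector, so the reflection reverses [s B Z]; subtraction
    from [hray A Z] becomes this reversal. *)
Lemma upper_flip Z0 : upper Z0 -> exists Z f,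
  [/\ upper Z, hray A Z0 = hray A Z, I f, f A = A & [/\ f B = Z, f Z = B & forall X, f (f X) =
    X]].
Proof.
move=> uZ; have [f [If fA fB ffB fK]] := flip_ex (upper_noncol uZ).
have nfB : f B <> A by rewrite -fA; apply: I_ne => //; exact: nesym.
exists (f B), f; split=> //; first exact: upper_R uZ fB nfB.
by apply/esym/hray_eq => //; [exact: upper_ne|exact: nesym].
Qed.

Lemma upper_seg_ne X Y : upper Y -> s B Y X -> A <> X.
Proof. by move=> uY h; apply: nesym; exact: noncol_apex (upper_noncol uY) h. Qed.

(* The reflection swapping the sides of the angle [(r0, z)] computes the
   subtraction from [z]. *)
Lemma asub_flip Z f X : upper Z -> I f -> f A = A -> f B = Z -> f Z = B ->
  s B Z X -> asub (hray A Z) (hray A X) = hray A (f X) /\ s B Z (f X).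
Proof.
move=> uZ If fA fB fZ hX; have hfX : s B Z (f X).
  by have := I_s If hX; rewrite fB fZ => /sC.
split=> //; have nX := upper_seg_ne uZ hX; have nZ := upper_ne uZ.
apply: angE => //; apply: Nrm_sym => //; exists f; split=> //.
- by rewrite im_hray // fA fZ.
- by rewrite im_hray // fA.
- exact: upper_ray_seg uZ hfX.
Qed.

Lemma asub_Nrm x z : upper_ray x -> upper_ray z -> ray_le x z -> Nrm x z (asub z x).
Proof.
move=> _ [->|[Z0 uZ0 ->]].
  by move=> /le_r0 ->; rewrite /asub (angE _ _ (Nrm_refl nAB)) //; exact: Nrm_refl.
have [Z [f [uZ -> If fA [fB fZ fK]]]] := upper_flip uZ0.
move=> /(le_upper _ uZ)[X hX ->].
have [-> hfX] := asub_flip uZ If fA fB fZ hX.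
have nX := upper_seg_ne uZ hX; have nZ := upper_ne uZ.
apply: Nrm_sym => //; exists f; split=> //.
- by rewrite im_hray // fA fZ.
- by rewrite im_hray // fA.
- exact: upper_ray_seg uZ hfX.
Qed.

Lemma asub_r0 : asub r0 r0 = r0.
Proof. by apply: angE => //; exact: Nrm_refl. Qed.

Lemma asub_o z : upper_ray z -> asub z r0 = z.
Proof.
case=> [->|[Z0 uZ0 ->]]; first exact: asub_r0.
have [Z [f [uZ -> If fA [fB fZ fK]]]] := upper_flip uZ0.
by have [-> _] := asub_flip uZ If fA fB fZ (sl B Z); rewrite fB.
Qed.

Lemma asub_le x z : upper_ray x -> upper_ray z -> ray_le x z ->
  upper_ray (asub z x) /\ ray_le (asub z x) z.
Proof.
move=> _ [->|[Z0 uZ0 ->]].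
  by move=> /le_r0 ->; rewrite asub_r0; split; [left|exact/le_r0].
have [Z [f [uZ -> If fA [fB fZ fK]]]] := upper_flip uZ0.
move=> /(le_upper _ uZ)[X hX ->].
have [-> hfX] := asub_flip uZ If fA fB fZ hX.
split; first exact: upper_ray_seg uZ hfX.
by apply/le_upper => //; exists (f X).
Qed.

Lemma asubK x z : upper_ray x -> upper_ray z -> ray_le x z -> asub z (asub z x) = x.
Proof.
move=> _ [->|[Z0 uZ0 ->]].
  by move=> /le_r0 ->; rewrite !asub_r0.
have [Z [f [uZ -> If fA [fB fZ fK]]]] := upper_flip uZ0.
move=> /(le_upper _ uZ)[X hX ->].
have [-> hfX] := asub_flip uZ If fA fB fZ hX.
by have [-> _] := asub_flip uZ If fA fB fZ hfX; rewrite fK.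
Qed.

Lemma le_chain x y z : upper_ray x -> upper_ray y -> upper_ray z -> z <> r0 ->
  ray_le x y -> ray_le y z -> exists X Y Z f,
  [/\ upper Z, x = hray A X, y = hray A Y, z = hray A Z & [/\ s B Z Y, s B Y X & [/\
    I f, f A = A, f B = Z, f Z = B & forall W, f (f W) = W]]].
Proof.
move=> hx hy [//|[Z0 uZ0 ->]] _.
have [Z [f [uZ -> If fA [fB fZ fK]]]] := upper_flip uZ0.
move=> h /(le_upper _ uZ)[Y hY e]; subst y.
have [X hX ->] : exists2 X, s B Y X & x = hray A X.
  have [eY|nY] := EM (Y = B).
    by rewrite eY in h *; move/le_r0: h => ->; exists B.
  by move: h => /(le_upper _ (upper_seg uZ hY nY)).
by exists X, Y, Z, f.
Qed.

Lemma asub_anti x y z : upper_ray x -> upper_ray y -> upper_ray z ->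
  ray_le x y -> ray_le y z -> ray_le (asub z y) (asub z x).
Proof.
move=> hx hy hz hxy hyz; have [e|n] := EM (z = r0).
  rewrite e in hyz *; move/le_r0: hyz => e'; rewrite e' in hxy *.
  by move/le_r0: hxy => ->; rewrite asub_r0; exact/le_r0.
have [X [Y [Z [f [uZ -> -> -> [hY hX [If fA fB fZ fK]]]]]]] := le_chain hx hy hz n hxy hyz.
have [-> hfX] := asub_flip uZ If fA fB fZ (s_tr hY hX).
have [-> hfY] := asub_flip uZ If fA fB fZ hY.
exists (f Y), (f X); split=> //.
- by apply: nesym; exact: upper_seg_ne uZ hfX.
- have := I_s If hX; rewrite fB => h.
  exact: sC (s_in (sC hfY) h).
Qed.

(** A single motion [g] taking [x] to [r0] turns [y - x] and [z - x] into the images of [y] and [z];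
    the axioms [sc_sub_mono] and [sc_subB] are read off at once. *)
Lemma chain_norm x y z : upper_ray x -> upper_ray y -> upper_ray z ->
  ray_le x y -> ray_le y z -> exists g, [/\ I g, asub y x = g @` y, asub z x = g @` z,
   ray_le (g @` y) (g @` z) & asub z y = ang (g @` y) (g @` z)].
Proof.
move=> hx hy hz hxy hyz; have [e|n] := EM (z = r0).
  rewrite e in hyz *; move/le_r0: hyz => e'; rewrite e' in hxy *.
  move/le_r0: hxy => ->; exists id; rewrite !image_id asub_r0; split=> //.
  - exact: I_id.
  - exact/le_r0.
  - exact: esym asub_r0.
have [X [Y [Z [f [uZ ex ey ez [hY hX _]]]]]] := le_chain hx hy hz n hxy hyz.
have hXZ := s_tr hY hX.
have nX := upper_seg_ne uZ hXZ; have nY := upper_seg_ne uZ hY; have nZ := upper_ne uZ.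
have [g [Ig g1 g2 Og]] : exists g, [/\ I g, g @` hray A X = r0, ray_le (g @` hray A Y) (g @`
  hray A Z)
   & upper_ray (g @` hray A Z) /\ upper_ray (g @` hray A Y)].
  have [eXZ|nXZ] := EM (X = Z).
    have eYZ : Y = Z by rewrite eXZ in hX; exact: s_anti hX hY.
    have [g [Ig g1 _ _]] := Nrm_refl nX.
    exists g; rewrite eYZ -eXZ g1; split=> //; last by split; left.
    exact/le_r0.
  have tXZ : noncol A X Z.
    have [eXB|nXB] := EM (X = B); first by rewrite eXB; exact: upper_noncol.
    have rX : hray Z B X by left; exact: sC.
    have := noncol_R (noncol_sym (noncol_cyc (upper_noncol uZ))) rX nXZ.
    by move=> t; exact: noncol_rot (noncol_cyc (noncol_cyc t)).
  have [W uW [g [Ig g1 g2 _]]] := Nrm_ex tXZ.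
  rewrite !im_hray // in g1 g2.
  have gA : g A = A := hray_apex (I_ne Ig nX) nAB g1.
  have ngZ : g Z <> A by rewrite -gA; apply: nesym; exact: I_ne.
  have ngX : g X <> A by rewrite -gA; apply: nesym; exact: I_ne.
  have ngY : A <> g Y by rewrite -{1}gA; exact: I_ne.
  have ugZ : upper (g Z).
    by apply: (upper_R uW) => //; rewrite -g2 gA; exact: hray_r.
  have tg : noncol A (g X) (g Z).
    by rewrite -{1}gA; case: tXZ => n1 n2; split; [exact: I_ne|rewrite -I_line].
  have sg : s (g X) (g Z) (g Y) by apply: I_s => //; exact: s_in hY hX.
  have rB : hray A (g X) B by rewrite gA in g1; rewrite g1; exact: hray_r.
  have [Y' hY' rY'] := crossbar_seg tg sg rB (hray_r _ _) (nesym nAB) ngZ.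
  have nY' := upper_seg_ne ugZ hY'.
  have eY' : hray A (g Y) = hray A Y' by apply/esym/hray_eq.
  exists g; rewrite !im_hray // gA; split=> //; first by rewrite -g1 gA.
    by rewrite eY'; apply/le_upper => //; exists Y'.
  by split; [right; exists (g Z)|rewrite eY'; exact: upper_ray_seg ugZ hY'].
exists g; rewrite ex ey ez; split=> //.
- by apply: angE => //; exists g; split=> //; case: Og.
- by apply: angE => //; exists g; split=> //; case: Og.
have [r hr] : exists r, Nrm (hray A Y) (hray A Z) r.
  have [lZ|nl] := EM (hray A Y Z).
    by exists r0; rewrite (hray_eq nY nZ lZ); exact: Nrm_refl.
  have : noncol A Y Z.
    split=> //; apply: contra_not nl => lZ; case: (hray_or nY lZ) => // /sC h.
    have [eYB|nYB] := EM (Y = B).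
      by case: (uZ) => _ + _; rewrite -/l => -[]; rewrite /l -eYB.
    have := same_trans hl (same_sym (upper_seg uZ hY nYB)) uZ => ss.
    case: (same_opp ss); apply: (seg_opp hl lA _ h) => //; first by case: ss.
    exact: nesym.
  by move=> /Nrm_ex[W _ h]; exists (hray A W).
rewrite /asub (angE nY nZ hr); apply/esym.
have := Nrm_I Ig hr; rewrite !im_hray // => hr'.
by apply: angE hr'; apply: I_ne.
Qed.

Lemma asub_half z : upper_ray z -> exists x, [/\ upper_ray x, ray_le x z & asub z x = x].
Proof.
case=> [->|[Z0 uZ0 ->]].
  by exists r0; split; [left|exact/le_r0|exact: asub_r0].
have [Z [f [uZ -> If fA [fB fZ fK]]]] := upper_flip uZ0.
have nBZ : B <> Z by case: (noncol_ne (upper_noncol uZ)).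
have [|M hM fM] := reversal_fixpoint If nBZ fB; first by rewrite fZ; exact: hray_r.
exists (hray A M); split.
- exact: upper_ray_seg uZ hM.
- by apply/le_upper => //; exists M.
- by have [-> _] := asub_flip uZ If fA fB fZ hM; rewrite fM.
Qed.

Lemma upper_perp : exists2 Q, upper Q & perp l (line A Q).
Proof.
have [m mA lm] := perp_at hl lA; have [_ hm _ _] := lm.
have [Q [nAQ mQ em]] := mline_pt2 hm mA.
have nQ : ~ l Q.
  move=> lQ; case: (lm) => _ _ + _; apply; exact: mline_eq2 hl hm nAQ lA lQ mA mQ.
have [sQ|oQ] := same_opp_ex nP nQ; first by exists Q => //; rewrite -em.
exists (hturn A Q).
  exact: (opp_opp hl oQ (hturn_opp hl lA nQ)).
rewrite -(mline_eq hm _ mA (hturn_ml hm mA mQ)) // => e.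
by apply: nAQ; apply: (I_inj (I_hturn A)); rewrite -e hturn_A.
Qed.

(** For [x] beyond the perpendicular [m], reflecting in [m] brings [x] to the side of [B], and the
    flip exchanging [B] and [Q] also exchanges [l] and [m]. The difference of [x] and the right
    angle is then a ray on the side of [B] of [m], hence not above the right angle. *)
Lemma perp_top Q0 x : upper Q0 -> perp l (line A Q0) -> upper_ray x -> ray_le (hray A Q0) x ->
  ~ ray_le (hray A Q0) (asub x (hray A Q0)).
Proof.
move=> uQ0 lm hx.
have [Q [f [uQ eQ If fA [fB fQ fK]]]] := upper_flip uQ0.
have nAQ := upper_ne uQ.
have em : line A Q = line A Q0.
  by apply: hray_L => //; [exact: upper_ne|rewrite eQ; exact: hray_r].
rewrite -em in lm; rewrite eQ; have [_ hm _ _] := lm; set m := line A Q in lm hm em.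
have mA : m A by exact: line_l. have mQ : m Q by exact: line_r.
have nmB : ~ m B by case: (noncol_rot (upper_noncol uQ)).
case: hx => [->|[X uX ->]].
  by move/le_r0 => e _; apply: (upper_r0 uQ).
move=> /(le_upper _ uX)[Q' hQ' eQ'].
have nQQ' : A <> Q' := upper_seg_ne uX hQ'.
have nX := upper_ne uX.
have [eXQ|nXQ] := EM (hray A X = hray A Q).
  rewrite eXQ (_ : asub _ _ = r0) => [/le_r0 e|]; first exact: (upper_r0 uQ).
  by apply: angE => //; exact: Nrm_refl.
have rQQ' : hray A Q Q' by rewrite eQ'; exact: hray_r.
have mQ' : m Q' by exact: hray_sub_L.
have nmX : ~ m X.
  move=> mX; apply: nXQ; apply: hray_eq => //.
  apply: (hray_pt hl lA) => //; first by case: uQ.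
  exact: same_trans hl (same_sym uQ) uX.
have oXB : opp m X B by split=> //; exists Q' => //; exact: sC.
pose X1 := refl m X.
have sX1 : same m B X1 by exact: opp_opp hm (opp_sym oXB) (refl_opp hm nmX).
have uX1 : upper X1.
  apply: (same_trans hl uX); apply: perp_same; first exact: perp_sym.
  by case: uX.
have imL : f @` l = m by rewrite im_line // fA fB.
have imM : f @` m = l by rewrite im_line // fA fQ.
have Im := I_refl hm.
have uX2 : upper (f X1).
  apply: (same_trans hl uQ).
  by have := (I_same m B X1 If).1 sX1; rewrite imM fB.
have sX2 : same m B (f X1).
  have sQX1 : same l Q X1 by exact: same_trans hl (same_sym uQ) uX1.
  by have := (I_same l Q X1 If).1 sQX1; rewrite imL fQ.
have eA : asub (hray A X) (hray A Q) = hray A (f X1).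
  apply: angE => //; exists (f \o refl m); split=> //.
  - exact: I_comp.
  - by rewrite im_hray /=; [rewrite !refl_fix // fA fQ|exact: I_comp].
  - by rewrite im_hray /=; [rewrite (refl_fix hm mA) fA|exact: I_comp].
  - by right; exists (f X1).
rewrite eA => /(le_upper _ uX2)[Q2 hQ2 eQ2].
have mQ2 : m Q2 by apply: hray_sub_L => //; rewrite eQ2; exact: hray_r.
by case: sX2 => _ _ /(_ Q2 mQ2).
Qed.

Lemma pencil_ded Q (F : set (set T)) : upper Q -> F r0 -> ~ F (hray A Q) ->
  (forall x y, upper_ray x -> upper_ray y -> ray_le x y -> ray_le y (hray A Q) -> F y -> F x) ->
  exists M, [/\ upper_ray M, ray_le M (hray A Q),
    forall x, upper_ray x -> ray_le x M -> x <> M -> F x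
    & forall x, upper_ray x -> ray_le M x -> ray_le x (hray A Q) -> x <> M -> ~ F x].
Proof.
move=> uQ F0 FQ dn; have nBQ : B <> Q by case: (noncol_ne (upper_noncol uQ)).
have inj V W : s B Q V -> s B Q W -> hray A V = hray A W -> V = W.
  by move=> hV hW e; apply: (ray_meet (upper_noncol uQ)) => //; rewrite e; exact: hray_r.
have [X Y hY hX FY|M [hM below above]] := @dedekind_cut B Q (fun X => F (hray A X)) nBQ F0 FQ.
  apply: (dn _ (hray A Y)) => //.
  - exact: upper_ray_seg uQ (s_tr hY hX).
  - exact: upper_ray_seg uQ hY.
  - exists X, Y; split=> //; apply: nesym; exact: upper_seg_ne uQ hY.
  - by apply/le_upper => //; exists Y.
have low X Y : s B Q Y -> ray_le X (hray A Y) -> exists2 X', s B Y X' & X = hray A X'.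
  move=> hY h; have [e|n] := EM (Y = B).
    by rewrite e in h *; move/le_r0: h => ->; exists B.
  by move: h => /(le_upper _ (upper_seg uQ hY n)).
exists (hray A M); split.
- exact: upper_ray_seg uQ hM.
- by apply/le_upper => //; exists M.
- move=> x _ /(low _ _ hM)[X hX ->] n; apply: below => // e.
  by apply: n; rewrite e.
- move=> x _ h /(le_upper _ uQ)[X hX e] n; rewrite e in h n *.
  have [M' hM' eM] := low _ _ hX h.
  have e' := inj _ _ hM (s_tr hX hM') eM; rewrite -e' in hM'.
  apply: above; first exact: s_in hX hM'.
  by move=> e2; apply: n; rewrite e2.
Qed.

Lemma pencil_scale Q : upper Q -> perp l (line A Q) ->
  scale upper_ray ray_le asub r0 (hray A Q).
Proof.
move=> uQ lm; split.
- by left.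
- exact: r0_le.
- exact: le_anti.
- exact: le_trans.
- exact: le_total.
- exact: le_dense.
- exact: asub_le.
- exact: asub_o.
- exact: asubK.
- exact: asub_anti.
- by move=> x y z hx hy hz h1 h2; have [g [_ -> -> ]] := chain_norm hx hy hz h1 h2.
- move=> x y z hx hy hz h1 h2; have [g [_ e1 e2 _ ->]] := chain_norm hx hy hz h1 h2.
  by rewrite -e1 -e2.
- exact: asub_half.
- by right; exists Q.
- exact: upper_r0.
- by move=> x; exact: perp_top.
- by move=> F; exact: pencil_ded.
Qed.
End Pencil.

(** * Angles *)

Section Angles.
Variable R : realType.
Local Open Scope ring_scope.

Lemma antipodalP V C D : V <> C -> V <> D ->
  antipodal s V (hray V C) (hray V D) <-> s C D V.
Proof.
move=> nC nD; split=> [[B [E [hB hE [h nV]]]]|h].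
  have nVB : V <> B by move=> e; apply: nV; left.
  have nVE : V <> E by move=> e; apply: nV; right.
  exact: (opp_rays nVB nVE h (hray_sym hB) (hray_sym hE)).
by exists C, D; split; [exact: hray_r|exact: hray_r|split=> // -[]].
Qed.

Lemma ray_segP V C D r : noncol V C D ->
  ray_seg s V (hray V C) (hray V D) r <-> exists2 X, s C D X & r = hray V X.
Proof.
move=> t; have [nC nD nCD] := noncol_ne t.
have nant : ~ (antipodal s V (hray V C) (hray V D) \/ hray V C = hray V D).
  case=> [/(antipodalP nC nD) /(noncol_apex t) //|e].
  by case: t => _; apply; apply: hray_sub_L => //; rewrite e; exact: hray_r.
split=> [[hr [[/nant//]|[_ h]]]|[X hX ->]].
  have [E [nE er]] := max_rayP hr; subst r.
  have [X [rX sX]] := h C D (hray_r _ _) (hray_r _ _).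
  exists X => //; apply/esym/hray_eq => //; apply: nesym; exact: noncol_apex t sX.
have nX : X <> V := noncol_apex t hX.
split; first by apply: hray_max; exact: nesym.
right; split=> // B E hB hE.
have [->|nB] := EM (B = V); first by exists V; split; [exact: hray_l|exact: sl].
have [->|nE] := EM (E = V); first by exists V; split; [exact: hray_l|exact: sr].
have [Y sY rY] := crossbar_seg t hX hB hE nB nE.
by exists Y.
Qed.

Lemma ray_seg_flat V C D r : V <> C -> V <> D -> ~ noncol V C D ->
  ray_seg s V (hray V C) (hray V D) r <-> (r = hray V C \/ r = hray V D).
Proof.
move=> nC nD nt; have lD : line V C D by apply: contrapT => h; apply: nt.
have hd : antipodal s V (hray V C) (hray V D) \/ hray V C = hray V D.
  case: (hray_or nC lD) => [/(hray_eq nC nD) ->|/sC h]; first by right.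
  by left; apply/antipodalP.
split=> [[_ [[_ //]|[/(_ hd)//]]]|h].
by split; [case: h => ->; exact: hray_max|left].
Qed.

Lemma im_ray_seg f V C D : I f -> V <> C -> V <> D ->
  [set f @` r | r in ray_seg s V (hray V C) (hray V D)] =
  ray_seg s (f V) (f @` hray V C) (f @` hray V D).
Proof.
move=> If nC nD; rewrite !im_hray //.
have tf : noncol V C D <-> noncol (f V) (f C) (f D).
  by rewrite /noncol -I_line //; split=> -[_ h]; split=> //; exact: I_ne.
have [t|nt] := EM (noncol V C D).
  apply/seteqP; split=> r.
    move=> [_ /(ray_segP _ t)[X hX ->] <-]; apply/ray_segP; first exact/tf.
    by exists (f X); [exact: I_s|rewrite im_hray].
  move=> /(ray_segP _ (tf.1 t))[Y hY ->]; have [X e] := I_surj Y If; subst Y.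
  exists (hray V X); last by rewrite im_hray.
  by apply/ray_segP => //; exists X => //; exact: I_s' hY.
have nfC := I_ne If nC; have nfD := I_ne If nD.
have ntf : ~ noncol (f V) (f C) (f D) by move/tf.
apply/seteqP; split=> r.
  move=> [x /(ray_seg_flat _ nC nD nt) h <-]; apply/ray_seg_flat => //.
  by case: h => ->; [left|right]; rewrite im_hray.
move=> /(ray_seg_flat _ nfC nfD ntf)[->|->].
  by exists (hray V C); [apply/ray_seg_flat => //; left|rewrite im_hray].
by exists (hray V D); [apply/ray_seg_flat => //; right|rewrite im_hray].
Qed.

Lemma line_rays V C E : V <> C -> V <> E -> s C E V -> hray V C `|` hray V E = line V C.
Proof.
move=> nC nE hE; have lE : line V C E by apply/line_col => //; constructor 2; exact: sC.
apply/seteqP; split=> X.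
  case=> h; first exact: hray_sub_L.
  by rewrite -(line_eq nC nE (line_l nC) lE); exact: hray_sub_L.
move=> /(hray_or nC)[h|h]; [by left|right].
exact: (opp_ray nC hE (sC h) (nesym nE)).
Qed.

(** The motion demanded by [right_angle] preserves the ray [VC] and exchanges the sides of its line,
    so it is the reflection in that line; sending the ray [VD] to its antipode then means preserving
    the line [VD]. *)
Lemma right_angleP V C D : V <> C -> V <> D ->
  right_angle s I V (hray V C) (hray V D) <-> perp (line V C) (line V D).
Proof.
move=> nC nD; have hl := mline_line nC; set l := line V C in hl *.
have lV : l V := line_l nC. have lC : l C := line_r nC.
have hm := mline_line nD; have mV := line_l nD; have mD := line_r nD.
split.
  move=> [ra [ra' [h1 [h2 [f [[/max_rayP[E [nE ->]] aE] [/max_rayP[G [nG ->]] aG] hh [If fr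
    f12 f21] fr']]]]]].
  have hE : s C E V by apply/antipodalP.
  have hG : s D G V by apply/antipodalP.
  rewrite line_rays // -/l in hh; have [[hl1 dis sm] op] := halfP hh.
  have [_ _ [[X hX] _] _ _] := hh.
  have hfX : h2 (f X) by rewrite -f12; exists X.
  have oX := op _ _ hX hfX; have nX : ~ l X by case: oX.
  rewrite im_hray // in fr.
  have fV : f V = V := hray_apex (I_ne If nC) nC fr.
  rewrite fV in fr.
  have nfC : V <> f C by rewrite -{1}fV; exact: I_ne.
  have rC : hray V C (f C) by rewrite -fr; exact: hray_r.
  have im : f @` l = l by rewrite im_line // fV (hray_L nC nfC rC).
  have rffC : hray V C (f (f C)).
    by rewrite -fr; have := (I_hray V C (f C) If).1 rC; rewrite fV.
  have ff : f \o f = id.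
    apply: (E_id (A := V) (B := C) (P := X) (I_comp If If) nC nX) => //=; first by rewrite !fV.
    apply: (opp_opp hl oX).
    by have := (I_opp l X (f X) If).1 oX; rewrite im.
  have fC : f C = C.
    by apply: (inv_fix nC (hray_r _ _) rC If fV); have := congr1 (fun k => k C) ff.
  have ef := refl_uniq If hl lV lC nC fV fC oX.
  rewrite im_hray // fV ef in fr'.
  have hD : s D (refl l D) V.
    by apply: (opp_ray_s nD nG hG); rewrite -fr'; exact: hray_r.
  have nlD : ~ l D.
    by move=> lD; rewrite (refl_fix hl lD) in hD; apply: nD; exact: sxx hD.
  have nS : V <> refl l D by rewrite -{1}(refl_fix hl lV); apply: I_ne => //; exact: I_refl.
  apply: im_perp => //; first by move=> e; apply: nlD; rewrite e.
  rewrite im_line ?(refl_fix hl lV) //; last exact: I_refl.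
  by apply: line_eq => //; apply/line_col => //; constructor 2; exact: sC.
move=> h; have [h1 [h2 hh]] := half_ex hl; have [[hl1 dis sm] op] := halfP hh.
have nHC : V <> hturn V C by apply/nesym/hturn_ne/nesym.
have nHD : V <> hturn V D by apply/nesym/hturn_ne/nesym.
have If := I_refl hl.
have swap (k1 k2 : set T) : (forall X, ~ l X <-> k1 X \/ k2 X) ->
    (forall X Y, ~ l X -> ~ l Y -> (k1 X <-> k1 Y) -> same l X Y) ->
    (forall X, k1 X -> k2 (refl l X)).
  move=> kl ks X kX; have nX : ~ l X by apply/kl; left.
  have oX := refl_opp hl nX; have [_ nS _] := oX.
  by case/kl: (nS) => // kS; case: (same_opp (ks _ _ nX nS _) oX).
have s12 : forall X, h1 X -> h2 (refl l X) by apply: swap.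
have s21 : forall X, h2 X -> h1 (refl l X).
  apply: swap => X; first by rewrite hl1; split=> -[]; [right|left|right|left].
  move=> Y nX nY i; apply: sm => //; move: (dis X) (dis Y) i.
  by case/hl1: (nX) => hX; case/hl1: (nY) => hY; tauto.
exists (hray V (hturn V C)), (hray V (hturn V D)), h1, h2, (refl l); split.
- by split; [exact: hray_max|apply/antipodalP => //; exact: hturn_s].
- by split; [exact: hray_max|apply/antipodalP => //; exact: hturn_s].
- by rewrite line_rays //; exact: hturn_s.
- split=> //; first by rewrite im_hray // !refl_fix.
    apply/seteqP; split=> Y; first by move=> [X hX <-]; exact: s12.
    by move=> hY; exists (refl l Y); [exact: s21|exact: reflK].
  apply/seteqP; split=> Y; first by move=> [X hX <-]; exact: s21.
  by move=> hY; exists (refl l Y); [exact: s12|exact: reflK].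
- by rewrite im_hray // -(perp_hturn D h lV mV) (refl_fix hm mD) (refl_fix hl lV).
Qed.

(** * Angle values computed on a reference pencil *)

Section AngleValue.
Variables A B P Q : T.
Hypotheses (t0 : noncol A B P) (uQ : upper A B P Q) (pQ : perp (line A B) (line A Q)).
Variable mu : set T -> R.
Hypotheses (mu_add : scale_additive (upper_ray A B P) (ray_le A B) (asub A B P) mu)
  (mu_Q : mu (hray A Q) = 90).

Let nAB : A <> B. Proof. by case: t0. Qed.
Let r0 := hray A B.
Let ang := ang A B P.
Let hs := pencil_scale t0 uQ pQ.

Lemma mu_r0 : mu r0 = 0.
Proof.
have [_ h] := mu_add; have O0 := sc_o hs.
by have := h _ _ O0 O0 (sc_o_le hs O0); rewrite (asub_o t0 O0) => e; apply: (addrI (mu r0));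
  rewrite addr0 -e.
Qed.

(* Antipodal rays have no normal form, hence the separate value. *)
Definition aval V C D : R := if pselect (s C D V) then 180 else mu (ang (hray V C) (hray V D)).

Lemma aval_180 V C D : s C D V -> aval V C D = 180.
Proof. by rewrite /aval; case: pselect. Qed.

Lemma aval_mu V C D r : V <> C -> V <> D -> ~ s C D V ->
  Nrm A B P (hray V C) (hray V D) r -> aval V C D = mu r.
Proof. by move=> nC nD; rewrite /aval; case: pselect => //= n0 _ h;
  rewrite /ang (angE t0 nC nD h). Qed.

Lemma aval_ray V C D C' D' : V <> C -> V <> D -> V <> C' -> V <> D' ->
  hray V C C' -> hray V D D' -> aval V C' D' = aval V C D.
Proof.
move=> nC nD nC' nD' hC hD; rewrite /aval (hray_eq nC nC' hC) (hray_eq nD nD' hD).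
case: pselect => h; case: pselect => h' //; exfalso.
  by apply: h'; exact: opp_rays nC' nD' h (hray_sym hC) (hray_sym hD).
by apply: h; exact: opp_rays nC nD h' hC hD.
Qed.

Lemma aval_same V C D : V <> C -> V <> D -> hray V C D -> aval V C D = 0.
Proof.
move=> nC nD h; rewrite (aval_mu (r := r0)) ?mu_r0 //.
  by move=> h'; case: (hray_end nC (hray_r _ _) h h') => e; [case: nC|case: nD].
by rewrite (hray_eq nC nD h); exact: Nrm_refl.
Qed.

Lemma noncol_nots V C D : noncol V C D -> ~ s C D V.
Proof. by move=> t /(noncol_apex t). Qed.

Lemma aval_noncol V C D : noncol V C D -> exists X,
  [/\ upper A B P X, Nrm A B P (hray V C) (hray V D) (hray A X) & aval V C D = mu (hray A X)].
Proof.
move=> t; have [nC nD _] := noncol_ne t; have [X uX h] := Nrm_ex t0 t.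
by exists X; split=> //; apply: aval_mu => //; exact: noncol_nots.
Qed.

Lemma aval_gt0 V C D : noncol V C D -> 0 < aval V C D.
Proof.
move=> /aval_noncol[X [uX _ ->]]; apply: (scale_measure_gt0 hs mu_add mu_Q).
  by right; exists X.
exact: (upper_r0 t0 uX).
Qed.

Lemma flat_cases V C D : V <> C -> ~ noncol V C D -> hray V C D \/ s C D V.
Proof.
move=> nC nt; have lD : line V C D by apply: contrapT => h; apply: nt.
by case: (hray_or nC lD) => [|/sC]; [left|right].
Qed.

Lemma aval_ge0 V C D : V <> C -> V <> D -> 0 <= aval V C D.
Proof.
move=> nC nD; have [/aval_gt0/ltW //|nt] := EM (noncol V C D).
by case: (flat_cases nC nt) => h; [rewrite aval_same|rewrite aval_180].
Qed.

Lemma aval_sym V C D : V <> C -> V <> D -> aval V C D = aval V D C.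
Proof.
move=> nC nD; have [t|nt] := EM (noncol V C D).
  have [X [uX h ->]] := aval_noncol t; apply/esym/aval_mu => //; last exact: Nrm_sym.
  exact: noncol_nots (noncol_rot t).
case: (flat_cases nC nt) => h; first by rewrite !aval_same //; exact: hray_sym.
by rewrite !aval_180 //; exact: sC.
Qed.

Lemma aval_I f V C D : I f -> V <> C -> V <> D -> aval (f V) (f C) (f D) = aval V C D.
Proof.
move=> If nC nD; have nfC := I_ne If nC; have nfD := I_ne If nD.
have [h|nh] := EM (s C D V); first by rewrite !aval_180 //; exact: I_s.
have nh' : ~ s (f C) (f D) (f V) by move/(I_s' If).
have [r hr] : exists r, Nrm A B P (hray V C) (hray V D) r.
  have [t|nt] := EM (noncol V C D); first by have [X [_ h _]] := aval_noncol t; exists (hray A X).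
  case: (flat_cases nC nt) => // h; exists r0; rewrite (hray_eq nC nD h).
  exact: Nrm_refl.
rewrite (aval_mu nC nD nh hr); apply: aval_mu => //.
by have := Nrm_I If hr; rewrite !im_hray.
Qed.

(** One motion brings the whole configuration to the reference flag, where the second summand is the
    [asub] of two normal forms. *)
Lemma aval_add V C D X : noncol V C D -> s C D X -> aval V C D = aval V C X + aval V X D.
Proof.
move=> t hX; have [nC nD nCD] := noncol_ne t; have nX := nesym (noncol_apex t hX).
have [eC|nXC] := EM (X = C); first by subst X; rewrite (aval_same nC nC (hray_r _ _)) add0r.
have [eD|nXD] := EM (X = D); first by subst X; rewrite (aval_same nD nD (hray_r _ _)) addr0.
have tCX : noncol V C X.
  by apply: noncol_cyc; apply: noncol_cyc; apply: (noncol_R (noncol_cyc t)) => //; left.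
have tXD : noncol V X D.
  by apply: noncol_sym; apply: noncol_cyc; apply: (noncol_R (noncol_sym (noncol_cyc t))) =>
    //; left; exact: sC.
have [f [If fV fC fD]] := E_ex nC t.2 nAB t0.2.
have tf : noncol A B (f D) by split=> //; case: fD.
have efC : hray A (f C) = r0 by apply: hray_eq => //; rewrite -fV; exact: I_ne.
have nfC : A <> f C by rewrite -fV; exact: I_ne.
have nfD : A <> f D by rewrite -fV; exact: I_ne.
have nfX : f X <> A by rewrite -fV; apply: I_ne => //; exact: nesym.
have tfC : noncol A (f C) (f D).
  by split=> //; rewrite (hray_L nAB nfC fC); case: tf.
have [X' hX' rX'] := crossbar_seg tfC (I_s If hX) (hray_sym fC) (hray_r _ _) (nesym nAB)
  (nesym nfD).
have nX' := upper_seg_ne t0 fD hX'.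
have eX' : hray A (f X) = hray A X' by apply/esym/hray_eq => //; exact: nesym.
have OX : upper_ray A B P (hray A X') := upper_ray_seg t0 fD hX'.
have OD : upper_ray A B P (hray A (f D)) by right; exists (f D).
have le : ray_le A B (hray A X') (hray A (f D)) by apply/(le_upper t0) => //; exists X'.
have n1 : Nrm A B P (hray V C) (hray V D) (hray A (f D)).
  by exists f; split=> //; rewrite im_hray // fV.
have n2 : Nrm A B P (hray V C) (hray V X) (hray A X').
  by exists f; split=> //; rewrite im_hray // fV.
have [Y [uY n3 e3]] := aval_noncol tXD.
have n4 : asub A B P (hray A (f D)) (hray A X') = hray A Y.
  have := Nrm_I If n3; rewrite !im_hray // fV eX' => n3'.
  by rewrite /asub (angE t0 _ _ n3').
rewrite (aval_mu nC nD (noncol_nots t) n1) (aval_mu nC nX (noncol_nots tCX) n2) e3 -n4.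
by case: mu_add => _; exact.
Qed.

Lemma Nrm_perp V C D : V <> C -> V <> D -> perp (line V C) (line V D) ->
  noncol V C D /\ Nrm A B P (hray V C) (hray V D) (hray A Q).
Proof.
move=> nC nD hp; have t : noncol V C D.
  split=> // lD; have [hl hm n _] := hp; apply: n.
  exact: (mline_eq2 hl hm nD (line_l nC) lD (line_l nD) (line_r nD)).
split=> //; have [f [If fV fC fD]] := E_ex nC t.2 nAB t0.2.
have nfC : A <> f C by rewrite -{1}fV; exact: I_ne.
have nfD : A <> f D by rewrite -{1}fV; exact: I_ne.
have := I_perp If hp; rewrite !im_line // fV (hray_L nAB nfC fC) => hp'.
have nAQ := upper_ne t0 uQ.
have eL := perp_uniq pQ hp' (line_l nAQ) (line_l nfD).
have rQ : hray A Q (f D).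
  apply: (hray_pt (mline_line nAB) (line_l nAB)); [by case: uQ|by rewrite eL; exact: line_r|].
  exact: same_trans (mline_line nAB) (same_sym uQ) fD.
exists f; rewrite !im_hray // fV; split=> //.
- exact: hray_eq.
- exact: hray_eq.
- by right; exists Q.
Qed.

Lemma aval_perp V C D : V <> C -> V <> D -> perp (line V C) (line V D) -> aval V C D = 90.
Proof.
move=> nC nD h; have [t n] := Nrm_perp nC nD h.
by rewrite (aval_mu nC nD (noncol_nots t) n).
Qed.

(** Additivity is silent here, because the segment between antipodal rays consists of its ends. The
    perpendicular [VU] splits the straight angle into two right angles, and [E] is compared with
    it. *)
Lemma aval_suppl V C D E : noncol V C E -> V <> D -> s C D V ->
  aval V C E + aval V E D = 180.
Proof.
move=> tE nD hCD; have [nC nE nCE] := noncol_ne tE; have hl := mline_line nC;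
  set l := line V C in hl.
have lV : l V := line_l nC.
have lD : l D by apply/line_col => //; constructor 2; exact: sC.
have eD : line V D = l by exact: line_eq nC nD lV lD.
have tED : noncol V E D by apply: noncol_rot; split=> //; rewrite eD; case: tE.
have [U sU pU] : exists2 U, same l E U & perp l (line V U).
  have [m mV lm] := perp_at hl lV; have [_ hm n _] := lm.
  have [U [nU mU em]] := mline_pt2 hm mV.
  have nlU : ~ l U by move=> lU; apply: n; exact: mline_eq2 hl hm nU lV lU mV mU.
  have [h|h] := same_opp_ex tE.2 nlU; first by exists U => //; rewrite -em.
  exists (hturn V U); first exact: opp_opp hl h (hturn_opp hl lV nlU).
  rewrite -(mline_eq hm _ mV (hturn_ml hm mV mU)) // => e.
  by apply: nU; apply: (I_inj (I_hturn V)); rewrite -e hturn_A.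
have nlU : ~ l U by case: sU.
have nU : V <> U by move=> e; apply: nlU; rewrite -e.
have e1 : aval V C U = 90 by exact: aval_perp.
have e2 : aval V U D = 90 by rewrite aval_sym //; apply: aval_perp; rewrite // eD.
have hm := mline_line nU; set m := line V U in pU hm.
have tU : noncol V C U by [].
have tUD : noncol V D U by split=> //; rewrite eD.
have nmC : ~ m C by case: (noncol_rot tU).
have nmD : ~ m D by case: (noncol_rot tUD).
have oCD : opp m C D by split=> //; exists V => //; exact: line_l.
have [mE|nmE] := EM (m E).
  have rE : hray V U E by apply: (hray_pt hl lV nlU mE); exact: same_sym.
  rewrite (aval_ray nC nU nC nE (hray_r _ _) rE) (aval_ray nU nD nE nD rE (hray_r _ _)) e1 e2.
  by rewrite -natrD.
(* For [E] on the side of [C'], [E] lies inside the right angle of [C'] and [U], and [U] inside the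
   angle of [E] and [D']. The other position follows by exchanging [C] and [D]. *)
have core C' D' : noncol V C' E -> noncol V E D' -> noncol V C' U -> noncol V D' U -> same l E
  U -> line V C' = l ->
    line V D' = l -> s C' D' V -> same m C' E -> opp m C' D' -> aval V C' U = 90 -> aval V U
      D' = 90 ->
    aval V C' E + aval V E D' = 180.
  move=> t1 t2 t3 t4 _ eC' eD' h sm om a1 a2.
  have [nC' nE' _] := noncol_ne t1; have [_ nD' _] := noncol_ne t2.
  have [X hX rX] : exists2 X, s C' U X & hray V E X.
    by apply: crossbar => //; rewrite ?eC' //; exact: same_sym.
  have nX := nesym (noncol_apex t3 hX).
  have b1 := aval_add t3 hX.
  rewrite (aval_ray nC' nE' nC' nX (hray_r _ _) rX) (aval_ray nE' nU nX nU rX (hray_r _ _)) in b1.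
  have [_ _ [Y mY sY]] := same_opp_trans hm (same_sym sm) om.
  have nY := nesym (noncol_apex t2 sY).
  have b2 := aval_add t2 sY.
  have lD' : l D' by rewrite -eD'; exact: line_r.
  have sEY : same l E Y.
    apply: (seg_same hl lD') => //; [by rewrite -eC'; case: t1|exact: sC|].
    by move=> e; subst Y; case: om.
  have rY : hray V U Y by apply: (hray_pt hl lV nlU mY); exact: same_trans hl (same_sym sU) sEY.
  rewrite (aval_ray nE' nU nE' nY (hray_r _ _) rY) (aval_ray nU nD' nY nD' rY (hray_r _ _)) in b2.
  lra.
have [sCE|oCE] := same_opp_ex nmC nmE; first exact: core.
rewrite addrC (aval_sym nE nD) (aval_sym nC nE).
apply: core sU eD _ (sC hCD) _ (opp_sym oCD) _ _ => //.
- exact: noncol_rot.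
- exact: noncol_rot.
- exact: opp_opp hm (opp_sym oCD) oCE.
- by rewrite aval_sym.
- by rewrite aval_sym.
Qed.

(** If the rays differed, one would lie strictly inside the angle of the other, and [aval_gt0] would
    separate the values. *)
Lemma aval_inj V C D D' : noncol V C D -> same (line V C) D D' -> aval V C D = aval V C D' ->
  hray V D D'.
Proof.
move=> t sD e; have [nC nD _] := noncol_ne t; have hl := mline_line nC.
have nlD' : ~ line V C D' by case: sD.
have nD' : V <> D' by move=> e'; apply: nlD'; rewrite -e'; exact: line_l.
have t' : noncol V C D' by [].
have hD := mline_line nD; have nDC : ~ line V D C by case: (noncol_rot t).
have [lD|nlD] := EM (line V D D').
  by apply: (hray_pt hl (line_l nC) t.2).
have tDD : noncol V D D' by [].
have [sC'|oC'] := same_opp_ex nDC nlD.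
  have [X hX rX] := crossbar t sD sC'.
  have nX := nesym (noncol_apex t hX).
  have := aval_add t hX.
  rewrite (aval_ray nC nD' nC nX (hray_r _ _) rX) (aval_ray nD' nD nX nD rX (hray_r _ _)).
  by have := aval_gt0 (noncol_rot tDD); rewrite e; lra.
have [_ _ [X lX sX]] := oC'.
have nX := nesym (noncol_apex t' sX).
have nXC : X <> C by move=> e'; subst X.
have sX' : same (line V C) D' X by exact: seg_same hl (line_r nC) nlD' sX nXC.
have rX : hray V D X by apply: (hray_pt hl (line_l nC) t.2 lX); exact: same_trans hl sD sX'.
have := aval_add t' sX.
rewrite (aval_ray nC nD nC nX (hray_r _ _) rX) (aval_ray nD nD' nX nD' rX (hray_r _ _)) e.
by have := aval_gt0 tDD; lra.
Qed.

Lemma aval_sub V C D X Y : noncol V C D -> s C D Y -> s C Y X -> aval V X Y <= aval V C D.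
Proof.
move=> t hY hX; have [nC nD _] := noncol_ne t; have nY := nesym (noncol_apex t hY).
have [e|n] := EM (Y = C).
  by subst Y; rewrite (sxx hX) (aval_same nC nC (hray_r _ _)); exact: aval_ge0.
have t' : noncol V C Y.
  by apply: noncol_cyc; apply: noncol_cyc; apply: (noncol_R (noncol_cyc t)) => //; left.
have nX := nesym (noncol_apex t' hX).
rewrite (aval_add t hY) (aval_add t' hX).
have := aval_ge0 nY nD; have := aval_ge0 nC nX; lra.
Qed.

(** Serves [aval_wd]: a measure takes a set of rays as its argument, and comparing values in both
    directions avoids recovering the sides of an angle from that set. *)
Lemma aval_mono V C D C' D' : V <> C -> V <> D -> V <> C' -> V <> D' ->
  ray_seg s V (hray V C) (hray V D) (hray V C') -> ray_seg s V (hray V C) (hray V D) (hray V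
    D') ->
  aval V C' D' <= aval V C D.
Proof.
move=> nC nD nC' nD'; have [t|nt] := EM (noncol V C D).
  move=> /(ray_segP _ t)[X hX eX] /(ray_segP _ t)[Y hY eY].
  have nX := nesym (noncol_apex t hX); have nY := nesym (noncol_apex t hY).
  have rX : hray V C' X by rewrite eX; exact: hray_r.
  have rY : hray V D' Y by rewrite eY; exact: hray_r.
  rewrite -(aval_ray nC' nD' nX nY rX rY).
  case: (s_tot hX hY) => h; last exact: aval_sub h.
  by rewrite aval_sym //; exact: aval_sub h.
have mem E : hray V E = hray V C' -> hray V E C' by move=> ->; exact: hray_r.
have mem' E : hray V E = hray V D' -> hray V E D' by move=> ->; exact: hray_r.
move=> /(ray_seg_flat _ nC nD nt)[/esym/mem h1|/esym/mem h1] /(ray_seg_flat _ nC nD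
  nt)[/esym/mem' h2|/esym/mem' h2].
- rewrite (aval_ray nC nC nC' nD' h1 h2) (aval_same nC nC (hray_r _ _)); exact: aval_ge0.
- by rewrite (aval_ray nC nD nC' nD' h1 h2).
- by rewrite (aval_ray nD nC nC' nD' h1 h2) aval_sym.
- rewrite (aval_ray nD nD nC' nD' h1 h2) (aval_same nD nD (hray_r _ _)); exact: aval_ge0.
Qed.

Lemma ray_seg_ends V C D : V <> C -> V <> D ->
  ray_seg s V (hray V C) (hray V D) (hray V C) /\ ray_seg s V (hray V C) (hray V D) (hray V D).
Proof.
move=> nC nD; have [t|nt] := EM (noncol V C D).
  by split; apply/ray_segP => //; [exists C|exists D].
by split; apply/ray_seg_flat => //; [left|right].
Qed.

Lemma aval_wd V C D C' D' : V <> C -> V <> D -> V <> C' -> V <> D' ->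
  ray_seg s V (hray V C) (hray V D) = ray_seg s V (hray V C') (hray V D') -> aval V C D = aval
    V C' D'.
Proof.
move=> nC nD nC' nD' e; have [h1 h2] := ray_seg_ends nC nD.
have [h3 h4] := ray_seg_ends nC' nD'.
apply/eqP; rewrite eq_le; apply/andP; split.
  by apply: aval_mono; rewrite // -e.
by apply: aval_mono; rewrite // e.
Qed.

(** * The angle measure and its uniqueness *)

Definition ameas V (S : set (set T)) : R := xget 0
  [set v | exists C D, [/\ V <> C, V <> D, S = ray_seg s V (hray V C) (hray V D) & v = aval V
    C D]].

Lemma ameasE V C D : V <> C -> V <> D -> ameas V (ray_seg s V (hray V C) (hray V D)) = aval V C D.
Proof.
move=> nC nD; apply: xget_unique; first by exists C, D.
by move=> v [C' [D' [nC' nD' e ->]]]; apply: aval_wd.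
Qed.

Lemma ameasP V : is_angle_measure s I V (ameas V).
Proof.
split.
- move=> S [_ [_ [/max_rayP[C [nC ->]] /max_rayP[D [nD ->]] ->]]].
  by rewrite ameasE //; exact: aval_ge0.
- move=> S1 S2 [_ [_ [/max_rayP[C [nC ->]] /max_rayP[D [nD ->]] ->]]] _ [f [If fV <-]].
  have nfC : V <> f C by rewrite -{1}fV; exact: I_ne.
  have nfD : V <> f D by rewrite -{1}fV; exact: I_ne.
  rewrite im_ray_seg // !im_hray // fV !ameasE //.
  by rewrite -{2}fV aval_I.
- move=> _ _ r3 /max_rayP[C [nC ->]] /max_rayP[D [nD ->]].
  have [t|nt] := EM (noncol V C D).
    move=> /(ray_segP _ t)[X hX ->]; have nX := nesym (noncol_apex t hX).
    by rewrite !ameasE //; exact: aval_add.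
  move=> /(ray_seg_flat _ nC nD nt)[->|->]; rewrite !ameasE //.
    by rewrite (aval_same nC nC (hray_r _ _)) add0r.
  by rewrite (aval_same nD nD (hray_r _ _)) addr0.
- move=> _ _ /max_rayP[C [nC ->]] /max_rayP[D [nD ->]] /(antipodalP nC nD) h.
  by rewrite ameasE // aval_180.
- move=> _ _ /max_rayP[C [nC ->]] /max_rayP[D [nD ->]] /(right_angleP nC nD) h.
  by rewrite ameasE // aval_perp.
Qed.

Lemma upper_rayE x : upper_ray A B P x -> exists2 X, A <> X & x = hray A X.
Proof. by case=> [->|[X uX ->]]; [exists B|exists X => //; exact: upper_ne uX]. Qed.

Lemma ray_seg_upper x z : upper_ray A B P x -> upper_ray A B P z -> ray_le A B x z ->
  ray_seg s A r0 z x.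
Proof.
move=> hx [->|[Z uZ ->]].
  by move=> /(le_r0 t0) ->; case: (ray_seg_ends nAB nAB).
move=> /(le_upper t0 _ uZ)[X hX ->].
by apply/ray_segP; [exact: upper_noncol uZ|exists X].
Qed.

(** A motion [g] from the reference vertex to [V] pulls [m] back to an additive function on the
    reference scale with value 90 at the right angle, and uniqueness there determines [m] on
    non-collinear triples. Zero and straight angles follow from additivity and from the value
    180. *)
Lemma is_angle_measureE V (m : set (set T) -> R) C D : is_angle_measure s I V m ->
  V <> C -> V <> D -> m (ray_seg s V (hray V C) (hray V D)) = aval V C D.
Proof.
move=> [m0 mc ma m180 m90] nC nD.
have bd E : V <> E -> boundary s V (hray V E) by exact: hray_max.
have cong k E F : I k -> k V = V -> V <> E -> V <> F ->
    m (ray_seg s V (k @` hray V E) (k @` hray V F)) = m (ray_seg s V (hray V E) (hray V F)).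
  move=> Ik kV nE nF; apply/esym/mc.
  - by exists (hray V E), (hray V F); split=> //; exact: bd.
  - exists (k @` hray V E), (k @` hray V F); split=> //; rewrite im_hray // kV; apply: bd;
      by rewrite -{1}kV; exact: I_ne.
  - by exists k; split=> //; rewrite im_ray_seg // kV.
have [E [F tV]] := triangle_ex V.
have [nE nF _] := noncol_ne tV.
have [g [Ig gA _ _]] := E_ex nAB t0.2 nE tV.2.
have gne X : A <> X -> V <> g X by rewrite -gA; exact: I_ne.
have gR X : g @` hray A X = hray V (g X) by rewrite im_hray // gA.
have [k [Ik gK kK]] := I_inv Ig.
have kV : k V = A by rewrite -gA gK.
pose mu' x := m (ray_seg s V (g @` r0) (g @` x)).
have move_ f X Y r : I f -> V <> X -> V <> Y -> f @` hray V X = r0 -> f @` hray V Y = r ->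
    m (ray_seg s V (hray V X) (hray V Y)) = mu' r.
  move=> If nX nY f1 f2; rewrite /mu' -f1 -f2 !image_comp.
  rewrite (cong (g \o f)) //; first exact: I_comp.
  by move: f1; rewrite im_hray //= => /(hray_apex (I_ne If nX) nAB) ->.
have add' : scale_additive (upper_ray A B P) (ray_le A B) (asub A B P) mu'.
  split=> [x /upper_rayE[X nX ->]|x z hx hz hxz].
    by apply: m0; exists (g @` r0), (g @` hray A X); rewrite !gR; split=> //; apply: bd;
      exact: gne.
  have [X nX ex] := upper_rayE hx; have [Z nZ ez] := upper_rayE hz.
  have hseg : ray_seg s V (g @` r0) (g @` z) (g @` x).
    rewrite ez -{1}gA -(im_ray_seg Ig nAB nZ) -ez; exists x => //.
    exact: ray_seg_upper.
  rewrite /mu' (ma _ _ _ _ _ hseg); last 2 first.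
  - by rewrite gR; apply: bd; exact: gne.
  - by rewrite ez gR; apply: bd; exact: gne.
  congr (_ + _); have [f [If f1 f2 _]] := asub_Nrm t0 hx hz hxz.
  have kg (Y : set T) : k @` (g @` Y) = Y by exact: im_can.
  rewrite ex ez (gR X) (gR Z) -ex -ez; apply: (move_ (f \o k) (g X) (g Z)).
  - exact: I_comp.
  - exact: gne.
  - exact: gne.
  - by rewrite -gR -image_comp kg -ex.
  - by rewrite -gR -image_comp kg -ez.
have nAQ := upper_ne t0 uQ.
have mu'Q : mu' (hray A Q) = 90.
  rewrite /mu' !gR; apply: m90; [by apply: bd; exact: gne|by apply: bd; exact: gne|].
  apply/right_angleP; [exact: gne|exact: gne|].
  by have := I_perp Ig pQ; rewrite !im_line // gA.
have [t|nt] := EM (noncol V C D).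
  have [X [uX [f [If f1 f2 Or]] ->]] := aval_noncol t.
  rewrite (move_ f C D _ If nC nD f1 f2).
  by have := scale_measure_uniq hs add' mu'Q mu_add mu_Q Or.
case: (flat_cases nC nt) => h; last by rewrite aval_180 // m180 //;
  [exact: bd|exact: bd|exact/antipodalP].
rewrite aval_same // (hray_eq nC nD h).
have [h1 _] := ray_seg_ends nC nC; have e := ma _ _ _ (bd _ nC) (bd _ nC) h1.
by apply: (addrI (m (ray_seg s V (hray V C) (hray V C)))); rewrite addr0 -e.
Qed.

Lemma angle_atE V C D : V <> C -> V <> D -> angle_at R s I V C D = aval V C D.
Proof.
move=> nC nD; rewrite /angle_at !rayE //; apply: is_angle_measureE => //.
exact: (@xgetI {classic set (set T) -> R} _ _ _ (ameasP V)).
Qed.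

(* Half-turns about the midpoints [M], [N] of two sides carry the angles at
   [Y] and [Z] to angles at [X] adjacent to the angle of the triangle. *)
Lemma angle_sum M N X Y Z : noncol X Y Z -> hturn M X = Y -> hturn N X = Z ->
  aval X Y Z + aval Y Z X + aval Z X Y = aval X (hturn M Z) Z + aval X Z (hturn N Y).
Proof.
move=> t eM eN; have [nXY nXZ nYZ] := noncol_ne t.
have [lM eLM] := mid_line nXY eM; have hl := mline_line nXY.
have eM' : hturn M Y = X by rewrite -eM hturnK.
have eN' : hturn N Z = X by rewrite -eN hturnK.
have e1 : aval Y Z X = aval X (hturn M Z) Y.
  by rewrite -(aval_I (I_hturn M) nYZ (nesym nXY)) eM' eM.
have e2 : aval Z X Y = aval X Z (hturn N Y).
  by rewrite -(aval_I (I_hturn N) (nesym nXZ) (nesym nYZ)) eN' eN.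
have nMX : X <> M by move=> e; apply: nXY; rewrite -eM -e hturn_A.
have oZ : opp (line X Y) Z (hturn M Z) by exact: hturn_opp hl lM t.2.
have nB1 : X <> hturn M Z by move=> e; case: oZ => _ + _; rewrite -e; apply; exact: line_l.
have lXM : line X M = line X Y by apply: line_eq => //; exact: line_l.
have hXZ := mline_line nXZ.
have nMXZ : ~ line X Z M.
  by move=> h; apply: t.2; rewrite -lXM (line_eq nXZ nMX (line_l nXZ) h); exact: line_r.
have tB : noncol X (hturn M Z) Z.
  apply: noncol_rot; split=> // lB; apply: nMXZ.
  exact: mline_seg hXZ (line_r nXZ) lB (hturn_s M Z).
have rM : hray X Y M by left; rewrite -eM; exact: hturn_s.
have h := aval_add tB (sC (hturn_s M Z)).
rewrite (aval_ray nB1 nXY nB1 nMX (hray_r _ _) rM) (aval_ray nXY nXZ nMX nXZ rM (hray_r _ _))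
  in h.
by rewrite e1 e2 h; lra.
Qed.

(** [hturn M Z] lies across the line [XY] from [Z], whereas [hturn N Y] stays on the side of [Z].
    Hence [X] is between the two images as soon as they lie on one line through [X]. *)
Lemma flip_sides M N X Y Z : noncol X Y Z -> hturn M X = Y -> hturn N X = Z ->
  opp (line X Y) (hturn M Z) (hturn N Y).
Proof.
move=> t eM eN; have [nXY nXZ nYZ] := noncol_ne t; have hl := mline_line nXY.
have [lM _] := mid_line nXY eM.
have hN : s X Z N by rewrite -eN; exact: hturn_s.
have nNX : N <> X by move=> e; apply: nXZ; rewrite -eN e hturn_A.
have s1 : same (line X Y) Z N by exact: seg_same hl (line_l nXY) t.2 hN nNX.
have nlN : ~ line X Y N by case: s1.
have nNY : hturn N Y <> Y.
  by move=> /hturn_fix e; apply: nlN; rewrite -e; exact: line_r.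
have s2 : same (line X Y) N (hturn N Y).
  by apply: (ray_same hl (line_r nXY) nlN _ nNY); right; exact: hturn_s.
apply: (opp_same_trans hl _ (same_trans hl s1 s2)).
exact: opp_sym (hturn_opp hl lM t.2).
Qed.

Lemma parallels_sum X Y Z : unique_parallels -> noncol X Y Z ->
  aval X Y Z + aval Y Z X + aval Z X Y = 180.
Proof.
move=> ep t; have [nXY nXZ nYZ] := noncol_ne t.
have [M eM] := mid_ex X Y; have [N eN] := mid_ex X Z.
rewrite (angle_sum t eM eN).
have hm := mline_line nYZ; set m := line Y Z in hm.
have nX : ~ m X by case: (noncol_cyc t).
(* The centre [K] is off [m], so [m] and its image are disjoint: a common point and its preimage
   would have [K] between them, on [m]. *)
have par K W : m W -> hturn K X = W -> [/\ mline (hturn K @` m), (hturn K @` m) X & parallel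
  (hturn K @` m) m].
  move=> mW e; have nmK : ~ m K.
    by move=> mK; apply: nX; rewrite -(hturnK K X) e; exact: hturn_ml.
  split; first exact: im_mline.
    by exists W => //; rewrite -e hturnK.
  right; apply/seteqP; split=> // V [[U mU eU] mV].
  have [eUV|nUV] := EM (U = V).
    by apply: nmK; rewrite -(hturn_fix (A := K) (X := U)) // eU.
  by apply: nmK; apply: (mline_seg hm mU mV); rewrite -eU; exact: hturn_s.
have [k [_ u]] := ep m X hm.
have e1 := u _ (par M Y (line_l nYZ) eM); have e2 := u _ (par N Z (line_r nYZ) eN).
have [hk kX _] := par M Y (line_l nYZ) eM; rewrite -e1 in hk kX.
have kB : k (hturn M Z) by rewrite e1; exists Z => //; exact: line_r.
have kC : k (hturn N Y) by rewrite e2; exists Y => //; exact: line_l.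
have [nlB nlC [V lV sV]] := flip_sides t eM eN.
have eV : V = X.
  apply: (mline_one (mline_line nXY) hk _ lV (mline_seg hk kB kC sV) (line_l nXY) kX).
  by move=> e; apply: nlB; rewrite e.
rewrite eV in sV.
have nB : X <> hturn M Z by move=> e; apply: nlB; rewrite -e; exact: line_l.
have nC : X <> hturn N Y by move=> e; apply: nlC; rewrite -e; exact: line_l.
apply: (aval_suppl _ nC sV); split=> // lZ.
apply: nX; suff <- : k = m by [].
have kZ : k Z by rewrite (mline_eq hk nB kX kB).
have [_ _] := par M Y (line_l nYZ) eM; rewrite -e1 => -[//|e0].
have : (k `&` m) Z by split=> //; exact: line_r.
by rewrite e0.
Qed.

Lemma sum_rect X Y Z : noncol X Y Z -> aval X Y Z + aval Y Z X + aval Z X Y = 180 -> rectangle.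
Proof.
move=> t; have [nXY nXZ nYZ] := noncol_ne t.
have [M eM] := mid_ex X Y; have [N eN] := mid_ex X Z.
rewrite (angle_sum t eM eN) => e180.
have [nlB nlC _] := flip_sides t eM eN.
have [_ nlB' _] := flip_sides (noncol_rot t) eN eM.
have nB : X <> hturn M Z by move=> e; apply: nlB; rewrite -e; exact: line_l.
have nC : X <> hturn N Y by move=> e; apply: nlC; rewrite -e; exact: line_l.
(* [E] is antipodal to [hturn M Z], so its angle with [Z] is 180 minus the first summand; by [e180]
   this is the second summand, and the rays of [E] and [hturn N Y] coincide. *)
pose E := hturn X (hturn M Z).
have sE : s (hturn M Z) E X := hturn_s _ _.
have nE : X <> E by apply/nesym/hturn_ne/nesym.
have hXZ := mline_line nXZ.
have tB : noncol X (hturn M Z) Z by apply: noncol_rot.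
have h := aval_suppl tB nE sE.
have oB : opp (line X Z) (hturn N Y) (hturn M Z) by exact: flip_sides (noncol_rot t) eN eM.
have sEC : same (line X Z) E (hturn N Y).
  apply: same_sym; apply: (opp_opp hXZ oB); exact: hturn_opp (line_l nXZ) nlB'.
have tE : noncol X Z E by split=> //; case: sEC.
have rE : hray X E (hturn N Y) by apply: (aval_inj tE sEC); lra.
have sX : s (hturn M Z) (hturn N Y) X by exact: opp_ray_s nB nE sE rE.
have hm := mline_line nYZ; set m := line Y Z in hm.
have nX : ~ m X by case: (noncol_cyc t).
have e1 : hturn M @` m = line X (hturn M Z).
  by rewrite im_line // -eM hturnK.
have e2 : hturn N @` m = line X (hturn N Y).
  by rewrite /m -(line_comm nYZ) im_line //; [rewrite -eN hturnK|exact: nesym].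
have e12 : line X (hturn N Y) = line X (hturn M Z).
  by apply: line_eq => //; [exact: line_l|apply/line_col => //; constructor 2; exact: sC].
apply: (@two_axes N M m) => //.
- by move=> e; apply: nYZ; rewrite -eM -e eN.
- move=> V mV.
  have : (hturn N @` m) (hturn M V) by rewrite e2 e12 -e1; exists V.
  by move=> [W mW <-]; rewrite hturnK.
- move=> e; have mM : m M by rewrite e; apply: line_r => e'; apply: nYZ; rewrite -eM -e' eN.
  by apply: nX; rewrite -(hturnK M X) eM; apply: hturn_ml => //; exact: line_l.
Qed.

Lemma flat_sum X Y Z : s X Z Y -> X <> Y -> Y <> Z -> X <> Z ->
  aval X Y Z + aval Y Z X + aval Z X Y = 180.
Proof.
move=> h nXY nYZ nXZ; rewrite (aval_same nXY nXZ) ?(aval_180 (sC h)); last by right.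
rewrite (aval_same (V := Z)); [lra|exact: nesym|exact: nesym|].
by left; exact: sC.
Qed.

Lemma defectE X Y Z : triangle X Y Z ->
  defect R s I X Y Z = 180 - (aval X Y Z + aval Y Z X + aval Z X Y).
Proof.
by move=> [n1 n2 n3]; rewrite /defect !angle_atE //; exact: nesym.
Qed.

Lemma collinearE X Y Z : X <> Y -> collinear s X Y Z <-> ~ noncol X Y Z.
Proof.
move=> n; have [hl _ _] := maxlineP n; split=> [[k [hk [kX kY kZ]]] [_]|nt].
  by apply; apply/line_col => //; exact: line_in_col hk n kX kY kZ.
exists (line X Y); split=> //; split; [exact: line_l|exact: line_r|].
by apply: contrapT => h; apply: nt.
Qed.

Lemma parallels_defect X Y Z : unique_parallels -> triangle X Y Z -> defect R s I X Y Z = 0.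
Proof.
move=> ep ht; rewrite defectE //; case: (ht) => n1 n2 n3.
suff -> : aval X Y Z + aval Y Z X + aval Z X Y = 180 by rewrite subrr.
have [t|nt] := EM (noncol X Y Z); first exact: parallels_sum.
have : line X Y Z by apply: contrapT => h; apply: nt.
move/(line_col _ n1) => [h|h|h].
- have := flat_sum (sC h) n2 (nesym n3) (nesym n1); lra.
- have := flat_sum h (nesym n3) n1 (nesym n2); lra.
- exact: flat_sum.
Qed.
End AngleValue.

(** * From angle sums to the equivalences *)

Lemma angle_value_ex : exists A B P Q mu, [/\ noncol A B P, upper A B P Q, perp (line A B)
  (line A Q),
  scale_additive (upper_ray A B P) (ray_le A B) (asub A B P) mu & mu (hray A Q) = 90 :> R].
Proof.
have [A0 _] : exists A : T, True by case: isplane => _ [A _] _; exists A.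
have [B [P t]] := triangle_ex A0; have [Q uQ pQ] := upper_perp t.
have [mu [h1 h2]] := scale_measure R (pencil_scale t uQ pQ).
by exists A0, B, P, Q, mu.
Qed.

Lemma parallels_defects : unique_parallels ->
  forall A B C, triangle A B C -> defect R s I A B C = 0.
Proof.
have [A [B [P [Q [mu [t uQ pQ h1 h2]]]]]] := angle_value_ex.
by move=> ep X Y Z; exact: (parallels_defect t uQ pQ h1 h2 ep).
Qed.

Lemma defect_rect : (exists A B C, [/\ triangle A B C, ~ collinear s A B C
  & defect R s I A B C = 0]) -> rectangle.
Proof.
have [A [B [P [Q [mu [t uQ pQ h1 h2]]]]]] := angle_value_ex.
move=> [X [Y [Z [ht nc]]]]; case: (ht) => n1 n2 n3.
rewrite (defectE t uQ pQ h1 h2 ht) => e.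
have tX : noncol X Y Z by apply: contrapT => /(collinearE _ n1).
by apply: (sum_rect t uQ pQ h1 h2 tX); apply/esym/eqP; rewrite -subr_eq0 e.
Qed.

Lemma noncollinear_ex : exists A B C, triangle A B C /\ ~ collinear s A B C.
Proof.
have [A0 _] : exists A : T, True by case: isplane => _ [A _] _; exists A.
have [B [C t]] := triangle_ex A0; exists A0, B, C; have [n1 n2 n3] := noncol_ne t.
by split=> // /(collinearE _ n1).
Qed.

Lemma equivalences :
  [<-> euclidean_plane s I;
       forall A B C : T, triangle A B C -> defect R s I A B C = 0;
       forall t : T -> T, translation s I t ->
         forall C D : T, D = t C -> t = tau s I C D;
       exists A B C : T, [/\ triangle A B C, ~ collinear s A B C
                            & defect R s I A B C = 0];
       forall t1 t2 : T -> T, translation s I t1 -> translation s I t2 ->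
         t1 \o t2 = t2 \o t1;
       is_subgroup I [set t | translation s I t] /\
         (forall t1 t2 : T -> T, translation s I t1 -> translation s I t2 ->
            t1 \o t2 = t2 \o t1);
       is_subgroup I [set t | translation s I t]].
Proof.
(* Flat triangles have defect 0 in every Erlangen plane, so a non-collinear triangle has to be
   supplied. *)
have rd : (forall A B C : T, triangle A B C -> defect R s I A B C = 0) -> rectangle.
  move=> h; apply: defect_rect; have [A [B [C [ht nc]]]] := noncollinear_ex.
  by exists A, B, C; split=> //; exact: h.
have rc h := parallels_cancel (rect_parallels h).
have cr : half_turn_cancel -> rectangle.
  by move=> h; apply: commuting_rect; exact: cancel_commuting.
tfae.
- by move=> [_ h]; exact: parallels_defects.
- by move=> h; apply/cancel_base_free/rc/rd.
- move=> /cancel_base_free h; have [A [B [C [ht nc]]]] := noncollinear_ex.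
  exists A, B, C; split=> //; apply: parallels_defects ht.
  exact/rect_parallels/cr.
- by move=> /defect_rect h; exact/cancel_commuting/rc.
- move=> /commuting_rect h; split; first exact/cancel_group/rc.
  exact/cancel_commuting/rc.
- by case.
- by move=> /group_rect h; split; [exact: erl|exact: rect_parallels].
Qed.

End Angles.
End Plane.

Local Open Scope ring_scope.

Theorem theorem19p4 (R : realType) (Pi : Type) (s : Pi -> Pi -> set Pi)
    (I : set (Pi -> Pi)) (hE : erlangen_plane s I) :
  [<-> euclidean_plane s I;
       forall A B C : Pi, triangle A B C -> defect R s I A B C = 0;
       forall t : Pi -> Pi, translation s I t ->
         forall C D : Pi, D = t C -> t = tau s I C D;
       exists A B C : Pi, [/\ triangle A B C, ~ collinear s A B C
                            & defect R s I A B C = 0];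
       forall t1 t2 : Pi -> Pi, translation s I t1 -> translation s I t2 ->
         t1 \o t2 = t2 \o t1;
       is_subgroup I [set t | translation s I t] /\
         (forall t1 t2 : Pi -> Pi, translation s I t1 -> translation s I t2 ->
            t1 \o t2 = t2 \o t1);
       is_subgroup I [set t | translation s I t]].
Proof. exact: equivalences. Qed.
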